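(* Let $B_1\subset\mathbb{R}^2$ be the open unit disc, let $u\in C^{1,1}(B_1)$ be nonnegative, let $\Omega:=\{u>0\}\cap B_1$, and assume $u\in C^2(\overline\Omega)$ and \[ \Delta u=1\ \text{ in }\Omega,\qquad u=0=|\nabla u|\ \text{ on }\partial\Omega\cap B_1. \] Then the set of branching points \[ \mathcal B(u):=\Big\{x\in\partial\Omega\cap B_1:\ \lim_{r\to0}\frac{|B_r(x)\cap\Omega|}{|B_r(x)|}=1\Big\}\cap\overline{\mathrm{int}(\{u=0\})} \] is locally finite in $B_1$, i.e. every compact subset of $B_1$ contains only finitely many points of $\mathcal B(u)$.
   Context: $|E|$ denotes Lebesgue measure and $\mathrm{int}(\{u=0\})$ the interior of the zero set of $u$. *)

(* Defs.v *)
From HB Require Import structures.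
From mathcomp Require Import all_boot all_order all_algebra.
From mathcomp Require Import all_classical all_reals all_analysis.
Set Implicit Arguments. Unset Strict Implicit. Unset Printing Implicit Defensive.
Import Order.TTheory GRing.Theory Num.Theory.
Import numFieldNormedType.Exports.
Local Open Scope classical_set_scope.
Local Open Scope ring_scope.

Section Defs.
Variable R : realType.

Definition edist (x y : R * R) : R :=
  Num.sqrt ((x.1 - y.1) ^+ 2 + (x.2 - y.2) ^+ 2).

Definition edisc (x : R * R) (r : R) : set (R * R) :=
  [set y | edist x y < r].

Definition B1 : set (R * R) := edisc (0, 0) 1.

Definition e1 : R * R := (1, 0).
Definition e2 : R * R := (0, 1).

Definition d1 (f : R * R -> R) : R * R -> R := fun x => 'D_e1 f x.
Definition d2 (f : R * R -> R) : R * R -> R := fun x => 'D_e2 f x.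

Definition gradnorm (f : R * R -> R) (x : R * R) : R :=
  Num.sqrt (d1 f x ^+ 2 + d2 f x ^+ 2).

Definition C11_on (D : set (R * R)) (u : R * R -> R) : Prop :=
  (forall x, D x -> differentiable u x) /\
  exists L : R, forall x y, D x -> D y ->
    Num.sqrt ((d1 u x - d1 u y) ^+ 2 + (d2 u x - d2 u y) ^+ 2) <= L * edist x y.

Definition C2_closure (O : set (R * R)) (u : R * R -> R) : Prop :=
  (forall x, O x -> differentiable u x /\ differentiable (d1 u) x
                     /\ differentiable (d2 u) x) /\
  forall f, f \in [:: u; d1 u; d2 u; d1 (d1 u); d2 (d1 u); d1 (d2 u); d2 (d2 u)] ->
    exists g : R * R -> R,
      {within closure O, continuous g} /\ (forall x, O x -> g x = f x).

Definition laplacian (u : R * R -> R) (x : R * R) : R :=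
  d1 (d1 u) x + d2 (d2 u) x.

Definition boundary (A : set (R * R)) : set (R * R) := closure A `\` A°.

Definition leb2 : set (R * R) -> \bar R :=
  ((@lebesgue_measure R) \x (@lebesgue_measure R))%E.

Definition density_one (A : set (R * R)) (x : R * R) : Prop :=
  (fun r : R => fine (leb2 (edisc x r `&` A)) / fine (leb2 (edisc x r)))
    @ 0^'+ --> (1 : R).

Definition branching_points (u : R * R -> R) : set (R * R) :=
  let Omega := [set x | 0 < u x] `&` B1 in
  [set x | (boundary Omega `&` B1) x /\ density_one Omega x] `&`
  closure (([set x | u x = 0] `&` B1)°).

End Defs.

(* Main.v *)
Require Import Defs.
From HB Require Import structures.
From mathcomp Require Import all_boot all_order all_algebra.
From mathcomp Require Import all_classical all_reals all_analysis.
From mathcomp Require Import ring lra.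
Set Implicit Arguments. Unset Strict Implicit. Unset Printing Implicit Defensive.
Import Order.TTheory GRing.Theory Num.Theory.
Import numFieldNormedType.Exports.
Local Open Scope classical_set_scope.
Local Open Scope ring_scope.

(** Sakai's argument. Let [z0] be a limit of branching points. The Hessian
extended from [Omega] to [z0] has trace 1, so after exchanging the coordinates
if necessary [u_yy >= 1/4] in [Omega] near [z0]. The map
[T = (x - u_x) + i u_y] is holomorphic in [Omega] with [Re T' = u_yy] and equals
[x] on [{u = 0}]; along vertical lines [u_y] is nondecreasing, hence [{u = 0}]
meets each vertical line in a segment, and density one reduces this segment to a
point at a branching point. Thus [T] has two Lipschitz inverses, [psi_+] on the
closed upper and [psi_-] on the closed lower half square, holomorphic inside.
Put [E(w) = psi_+(w) + conj (psi_-(conj w)) - 2 w]. On the real axis either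
[psi_+ = psi_-] and [E] is real, or both values lie over the abscissa [w] and
[E] is imaginary; so [E^2] is real there. It vanishes at the abscissas of
the branching points, which accumulate, hence (Cauchy's formula on half discs)
it vanishes near [0]. Then [{u = 0}] has no interior near [z0], contradicting
that branching points are limits of interior points of [{u = 0}]. *)

(* [lra] slows down with the number of quantified hypotheses and local bodies. *)
Ltac slra :=
  first [ repeat match goal with
          | x := _ |- _ => clearbody x
          | H : forall _, _ |- _ => clear H
          end; lra
        | lra ].

(** * Derivatives of functions on the plane *)

Section plane_derivatives.
Variable R : realType.
Implicit Types (f g : R * R -> R) (z : R * R).

Definition rder f z (p q : R) := forall e : R, 0 < e -> exists2 d : R, 0 < d &
  forall h k : R, `|h| < d -> `|k| < d ->
    `|f (z.1 + h, z.2 + k) - f z - (p * h + q * k)| <= e * (`|h| + `|k|).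

Lemma is_derive_epsP (g : R -> R) (t l : R) :
  is_derive t 1 g l <-> forall e : R, 0 < e -> exists2 d : R, 0 < d &
    forall h : R, `|h| < d -> `|g (t + h) - g t - l * h| <= e * `|h|.
Proof.
have E (h : R) : h != 0 ->
    `|l - h^-1 *: (g (h *: (1 : R) + t) - g t)| * `|h| =
    `|g (t + h) - g t - l * h|.
  move=> h0; rewrite -normrM -normrN; congr (`| _ |).
  rewrite [h *: _]mulr1 [h^-1 *: _]mulrC (addrC h t).
  by field.
split=> [gl e e0|H].
  have /cvg_ex[m gm] := @ex_derive _ _ _ _ _ _ _ gl.
  have lm : m = l.
    by rewrite -[RHS](@derive_val _ _ _ _ _ _ _ gl); apply/esym/cvg_lim.
  move: gm; rewrite lm => /cvgrPdist_le/(_ e e0)/nbhs_ballP[d /= d0 dh].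
  exists d => // h hd; have [->|h0] := eqVneq h 0.
    by rewrite addr0 subrr mulr0 subrr normr0 mulr0.
  rewrite -E// ler_wpM2r//; apply: dh => //.
  by rewrite /ball/= sub0r normrN.
have gl : (h^-1 *: (g (h *: (1 : R) + t) - g t)) @[h --> 0^'] --> l.
  apply/cvgrPdist_le => e e0; have [d d0 dh] := H e e0.
  apply/nbhs_ballP; exists d => //= h; rewrite /ball/= sub0r normrN => hd h0.
  by rewrite -(@ler_pM2r _ `|h|) ?normr_gt0// E// dh.
split; last exact/cvg_lim.
by apply/cvg_ex; exists l.
Qed.

Lemma rder_curve f (g1 g2 : R -> R) (t p q l1 l2 : R) :
  rder f (g1 t, g2 t) p q -> is_derive t 1 g1 l1 -> is_derive t 1 g2 l2 ->
  is_derive t 1 (fun s => f (g1 s, g2 s)) (p * l1 + q * l2).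
Proof.
move=> Hf /is_derive_epsP H1 /is_derive_epsP H2; apply/is_derive_epsP => e e0.
pose A := `|l1| + `|l2| + 2.
have A0 : 0 < A by rewrite /A; have := normr_ge0 l1; have := normr_ge0 l2; slra.
pose B := `|p| + `|q| + 1.
have B0 : 0 < B by rewrite /B; have := normr_ge0 p; have := normr_ge0 q; slra.
have [d d0 Hd] := Hf (e / 2 / A) ltac:(by rewrite !divr_gt0).
have m0 : 0 < Num.min 1 (e / 2 / B) by rewrite lt_min ltr01 !divr_gt0.
have [d1 d10 Hd1] := H1 _ m0.
have [d2 d20 Hd2] := H2 _ m0.
exists (Num.min (Num.min d1 d2) (d / A)).
  by rewrite !lt_min d10 d20 divr_gt0.
move=> h; rewrite !lt_min => /andP[/andP[hd1 hd2]]; rewrite ltr_pdivlMr// => hd.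
have {Hd1 Hd2} := (Hd1 h hd1, Hd2 h hd2).
set a := g1 (t + h) - g1 t; set b := g2 (t + h) - g2 t.
have m1 : Num.min 1 (e / 2 / B) <= 1 by rewrite ge_min lexx.
have m2 : Num.min 1 (e / 2 / B) <= e / 2 / B by rewrite ge_min lexx orbT.
move: (Num.min _ _) m0 m1 m2 => m m0 m1 m2 [Ha Hb].
have m1h : m * `|h| <= `|h| by rewrite ler_piMl.
have ah : `|a| <= (`|l1| + 1) * `|h|.
  have := ler_normD (a - l1 * h) (l1 * h); rewrite subrK normrM => Na.
  by rewrite mulrDl mul1r; slra.
have bh : `|b| <= (`|l2| + 1) * `|h|.
  have := ler_normD (b - l2 * h) (l2 * h); rewrite subrK normrM => Nb.
  by rewrite mulrDl mul1r; slra.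
have abh : `|a| + `|b| <= A * `|h|.
  have -> : A * `|h| = (`|l1| + 1) * `|h| + (`|l2| + 1) * `|h| by rewrite /A; ring.
  exact: lerD.
have an := normr_ge0 a; have bn := normr_ge0 b.
have := Hd a b ltac:(slra) ltac:(slra).
rewrite /= /a /b !subrKC -/a -/b => Hab.
have -> : f (g1 (t + h), g2 (t + h)) - f (g1 t, g2 t) - (p * l1 + q * l2) * h =
  (f (g1 (t + h), g2 (t + h)) - f (g1 t, g2 t) - (p * a + q * b)) +
  (p * (a - l1 * h) + q * (b - l2 * h)) by ring.
have h0 := normr_ge0 h.
have F1 : e / 2 / A * (`|a| + `|b|) <= e / 2 * `|h|.
  rewrite -[leRHS](_ : e / 2 / A * (A * `|h|) = _); last by field; rewrite gt_eqF.
  by rewrite ler_wpM2l// ltW// !divr_gt0.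
have F2 : `|p * (a - l1 * h) + q * (b - l2 * h)| <= e / 2 * `|h|.
  apply: le_trans (ler_normD _ _) _; rewrite !normrM.
  have P1 : `|p| * `|a - l1 * h| <= `|p| * (m * `|h|) by rewrite ler_wpM2l.
  have P2 : `|q| * `|b - l2 * h| <= `|q| * (m * `|h|) by rewrite ler_wpM2l.
  have P3 : B * (m * `|h|) <= e / 2 * `|h|.
    rewrite -[leRHS](_ : B * (e / 2 / B * `|h|) = _); last by field; rewrite gt_eqF.
    by rewrite ler_wpM2l ?ler_wpM2r// ltW.
  have : 0 <= m * `|h| by rewrite mulr_ge0// ltW.
  move: P3; rewrite /B !mulrDl mul1r; slra.
by apply: le_trans (ler_normD _ _) _; slra.
Qed.

Lemma differentiable_rder f z : differentiable f z ->
  rder f z ('D_(1, 0) f z) ('D_(0, 1) f z).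
Proof.
move=> df e e0.
have := diff_locally df => /eqaddoP/(_ _ e0)/nbhs_ballP[d /= d0 Hd].
exists d => // h k hd kd; rewrite !deriveE//.
have /= := Hd (h, k); rewrite /ball/= /prod_ball/= /ball/= !sub0r !normrN.
move=> /(_ (conj hd kd)).
have -> : (f \o shift z - (cst (f z) + 'd f z)) (h, k) =
   f (z.1 + h, z.2 + k) - f z - ('d f z (1, 0) * h + 'd f z (0, 1) * k).
  have -> : 'd f z (1, 0) * h + 'd f z (0, 1) * k = 'd f z (h, k).
    rewrite mulrC [X in _ + X]mulrC -[_ * _]/(h *: _) -[X in _ + X]/(k *: _).
    rewrite -!linearZ -linearD; congr ('d f z _).
    by rewrite -[LHS]/(h * 1 + k * 0, h * 0 + k * 1) !mulr1 !mulr0 addr0 add0r.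
  rewrite /= -[LHS]/(f ((h, k) + z) - (f z + 'd f z (h, k))) opprD addrA.
  by congr (f _ - _ - _); case: (z) => a b; rewrite addrC.
move=> /le_trans; apply; rewrite ler_pM2l//.
rewrite prod_normE/= ge_max; have := normr_ge0 h; have := normr_ge0 k => *.
by rewrite lerDl lerDr; apply/andP.
Qed.

Lemma plane_continuousP f z : {for z, continuous f} <->
  forall e : R, 0 < e -> exists2 d : R, 0 < d &
    forall h k : R, `|h| < d -> `|k| < d -> `|f (z.1 + h, z.2 + k) - f z| <= e.
Proof.
split=> [cf e e0|H].
  have /nbhs_ballP[d /= d0 Hd] : nbhs z (fun t => `|f z - f t| <= e).
    by move/cvgrPdist_le : cf => /(_ e e0).
  exists d => // h k hd kd; rewrite distrC; apply: Hd.
  by split; rewrite /ball/= opprD addrA subrr sub0r normrN.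
apply/cvgrPdist_le => e e0; have [d d0 Hd] := H e e0.
suff : nbhs z (fun t => `|f z - f t| <= e) by [].
apply/nbhs_ballP; exists d => //= -[x y] [/=]; rewrite /ball/= => xd yd.
rewrite distrC; have := Hd (x - z.1) (y - z.2); rewrite !subrKC.
by apply; rewrite distrC.
Qed.

Lemma rderD f g z p q p' q' : rder f z p q -> rder g z p' q' ->
  rder (fun w => f w + g w) z (p + p') (q + q').
Proof.
move=> Hf Hg e e0.
have e20 : 0 < e / 2 by rewrite divr_gt0.
have [d1 d10 H1] := Hf _ e20; have [d2 d20 H2] := Hg _ e20.
exists (Num.min d1 d2) => [|h k]; first by rewrite lt_min d10.
rewrite !lt_min => /andP[h1 h2] /andP[k1 k2].
have := ler_normD (f (z.1 + h, z.2 + k) - f z - (p * h + q * k))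
  (g (z.1 + h, z.2 + k) - g z - (p' * h + q' * k)).
have := H1 _ _ h1 k1; have := H2 _ _ h2 k2.
set a := (X in `|X| <= _ -> _); set b := (X in _ -> `|X| <= _ -> _).
move=> Ha Hb Hab; rewrite (_ : _ - _ - _ = b + a); last by rewrite /a /b; ring.
slra.
Qed.

Lemma rder_lin (a b c : R) z : rder (fun w => a * w.1 + b * w.2 + c) z a b.
Proof.
move=> e e0; exists 1 => // h k _ _ /=; rewrite (_ : _ - _ - _ = 0); last by ring.
by rewrite normr0; apply: mulr_ge0; [exact: ltW|exact: addr_ge0].
Qed.

Lemma rder_lip f z p q : rder f z p q -> exists2 d : R, 0 < d &
  forall h k : R, `|h| < d -> `|k| < d ->
   `|f (z.1 + h, z.2 + k) - f z| <= (`|p| + `|q| + 1) * (`|h| + `|k|).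
Proof.
move=> Hf; have [d d0 Hd] := Hf 1 ltr01; exists d => // h k hd kd.
have := Hd h k hd kd.
have := ler_normD (f (z.1 + h, z.2 + k) - f z - (p * h + q * k)) (p * h + q * k).
rewrite subrK; have := ler_normD (p * h) (q * k); rewrite !normrM.
have P3 := normr_ge0 h; have P4 := normr_ge0 k.
have P1 : 0 <= `|p| * `|k| by rewrite mulr_ge0.
have P2 : 0 <= `|q| * `|h| by rewrite mulr_ge0.
by rewrite mulrDr !mulrDl; slra.
Qed.

Lemma rder_continuous f z p q : rder f z p q -> {for z, continuous f}.
Proof.
move=> H; apply/plane_continuousP => e e0; have [d d0 Hd] := rder_lip H.
move: Hd; set B := _ + _ + 1 => Hd.
have B0 : 0 < B by rewrite /B; have := normr_ge0 p; have := normr_ge0 q; slra.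
exists (Num.min d (e / 2 / B)) => [|h k]; first by rewrite lt_min d0 !divr_gt0.
rewrite !lt_min => /andP[h1 h2] /andP[k1 k2].
apply: le_trans (Hd _ _ h1 k1) _.
by move: h2 k2; rewrite !ltr_pdivlMr// mulrDr ![B * _]mulrC; slra.
Qed.

Lemma rderM f g z p q p' q' : rder f z p q -> rder g z p' q' ->
  rder (fun w => f w * g w) z (p * g z + f z * p') (q * g z + f z * q').
Proof.
move=> Hf Hg e e0.
have [df df0 Lf] := rder_lip Hf; have [dg dg0 Lg] := rder_lip Hg.
set Kf := `|p| + _ + _ in Lf; set Kg := `|p'| + _ + _ in Lg.
have Kf0 : 0 < Kf by rewrite /Kf; have := normr_ge0 p; have := normr_ge0 q; slra.
have Kg0 : 0 < Kg by rewrite /Kg; have := normr_ge0 p'; have := normr_ge0 q'; slra.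
pose A := 3 * (`|f z| + `|g z| + 1).
have A0 : 0 < A by rewrite /A; have := normr_ge0 (f z); have := normr_ge0 (g z); slra.
have eA : 0 < e / A by rewrite divr_gt0.
have [d1 d10 H1] := Hf _ eA; have [d2 d20 H2] := Hg _ eA.
pose d3 := e / 6 / (Kf * Kg).
have d30 : 0 < d3 by rewrite /d3 !divr_gt0 ?mulr_gt0.
exists (Num.min (Num.min df dg) (Num.min (Num.min d1 d2) d3)) => [|h k].
  by rewrite !lt_min df0 dg0 d10 d20.
rewrite !lt_min => /andP[/andP[h1 h2] /andP[/andP[h3 h4] h5]].
move=> /andP[/andP[k1 k2] /andP[/andP[k3 k4] k5]].
have := Lf _ _ h1 k1; have := Lg _ _ h2 k2.
have := H1 _ _ h3 k3; have := H2 _ _ h4 k4.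
have P3 := normr_ge0 h; have P4 := normr_ge0 k.
set F := f (_, _); set G := g (_, _); set n := `|h| + `|k|.
have n0 : 0 <= n by rewrite /n; slra.
set a := F - f z - _; set b := G - g z - _ => Hb Ha HG HF.
have -> : F * G - f z * g z - ((p * g z + f z * p') * h + (q * g z + f z * q') * k) =
  a * g z + f z * b + (F - f z) * (G - g z) by rewrite /a /b; ring.
have Q1 : `|a * g z| <= e / 3 * n.
  rewrite normrM; apply: (@le_trans _ _ (e / A * n * (A / 3))).
    apply: ler_pM => //; rewrite /A; have := normr_ge0 (f z); slra.
  by rewrite le_eqVlt; apply/orP; left; apply/eqP; field; rewrite gt_eqF.
have Q2 : `|f z * b| <= e / 3 * n.
  rewrite normrM; apply: (@le_trans _ _ (A / 3 * (e / A * n))).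
    apply: ler_pM => //; rewrite /A; have := normr_ge0 (g z); slra.
  by rewrite le_eqVlt; apply/orP; left; apply/eqP; field; rewrite gt_eqF.
have Q3 : `|(F - f z) * (G - g z)| <= e / 3 * n.
  rewrite normrM; apply: (@le_trans _ _ (Kf * n * (Kg * n))).
    exact: ler_pM.
  have -> : Kf * n * (Kg * n) = Kf * Kg * n * n by ring.
  apply: ler_wpM2r => //; apply: (@le_trans _ _ (Kf * Kg * (2 * d3))).
    by rewrite ler_wpM2l ?mulr_ge0// ?ltW// /n; slra.
  by rewrite le_eqVlt; apply/orP; left; apply/eqP; rewrite /d3; field; rewrite !gt_eqF.
have := ler_normD (a * g z + f z * b) ((F - f z) * (G - g z)).
have := ler_normD (a * g z) (f z * b); slra.
Qed.

Lemma is_derive_comb (f g : R -> R) (p q t l m : R) : is_derive t 1 f l ->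
  is_derive t 1 g m -> is_derive t 1 (fun s => p * f s + q * g s) (p * l + q * m).
Proof.
move=> df dg; exact: (is_deriveD (is_deriveZ p df) (is_deriveZ q dg)).
Qed.

End plane_derivatives.

(** * Monotonicity of Sakai's map along lines *)

Section monotone_off_closed.
Variable R : realType.

Lemma lipschitz_within (A : set R) (f : R -> R) (C : R) :
  (forall x y, A x -> A y -> `|f x - f y| <= C * `|x - y|) ->
  {within A, continuous f}.
Proof.
move=> H; apply/subspace_continuousP => x Ax; apply/cvgrPdist_le => e e0.
suff : nbhs x (fun y => A y -> `|f x - f y| <= e) by [].
have C0 : 0 < `|C| + 1 by have := normr_ge0 C; slra.
apply/nbhs_ballP; exists (e / (`|C| + 1)); rewrite /= ?divr_gt0// => y.
rewrite /ball/= ltr_pdivlMr// => xy Ay; apply: le_trans (H _ _ Ax Ay) _.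
apply: le_trans (ltW xy); rewrite mulrC ler_wpM2l//.
by have := ler_norm C; slra.
Qed.

Lemma nondecreasing_off_closed (f : R -> R) (K : set R) (s t : R) : s <= t ->
  {within `[s, t], continuous f} -> closed K ->
  (forall x y, s <= x -> x <= y -> y <= t -> K x -> K y -> f x <= f y) ->
  (forall x, s < x < t -> ~ K x -> exists2 l, 0 <= l & is_derive x 1 f l) ->
  f s <= f t.
Proof.
move=> st cf cK mK dK.
have free x y : s <= x -> x <= y -> y <= t ->
    (forall w, x < w < y -> ~ K w) -> f x <= f y.
  move=> sx; rewrite le_eqVlt => /predU1P[->//|xy] yt Kf; rewrite -subr_ge0.
  have D w : w \in `]x, y[%R -> 0 <= 'D_1 f w /\ is_derive w 1 f ('D_1 f w).
    rewrite in_itv/= => /andP[xw wy].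
    have [||l l0 dl] := dK w; [slra|by apply: Kf; rewrite xw|].
    by have /= -> := @derive_val _ _ _ _ _ _ _ dl.
  have [| |w xwy ->] := @MVT R f (fun w => 'D_1 f w) x y xy.
  - by move=> w /D[].
  - apply: continuous_subspaceW cf => w /=; rewrite !in_itv/= => /andP[xw wy].
    by apply/andP; split; slra.
  - by apply: mulr_ge0; [have [] := D _ xwy|slra].
have [[k [Kk kst]]|nK] := pselect (exists k, K k /\ s <= k <= t); last first.
  by apply: free => // w wst Kw; apply: nK; exists w; split=> //; slra.
have A0 : (K `&` `[s, t]) !=set0 by exists k; split=> //=; rewrite in_itv.
have cA : compact (K `&` `[s, t]).
  by rewrite setIC; apply: compact_closedI => //; exact: segment_compact.
have cid : {within K `&` `[s, t], continuous (@id R)}.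
  by apply: continuous_subspaceT => x; exact: cvg_id.
have [p] := compact_EVT_min A0 cA cid; rewrite inE /= in_itv/= => -[Kp pst] minp.
have [q] := compact_EVT_max A0 cA cid; rewrite inE /= in_itv/= => -[Kq qst] maxq.
have pq : p <= q by apply: minp; rewrite inE/= in_itv.
have sp : f s <= f p.
  apply: free => //; [slra|slra|move=> w wsp Kw].
  have : p <= w by apply: minp; rewrite inE/= in_itv/=; split=> //; slra.
  slra.
have qt : f q <= f t.
  apply: free => //; [slra|slra|move=> w wsp Kw].
  have : w <= q by apply: maxq; rewrite inE/= in_itv/=; split=> //; slra.
  slra.
have : f p <= f q by apply: mK => //; slra.
by move=> pq'; rewrite (le_trans sp)// (le_trans pq').
Qed.

End monotone_off_closed.

Section sakai_map.
Variable R : realType.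

Definition insq (r : R) (z : R * R) := `|z.1| < r /\ `|z.2| < r.

Definition shiftv (z v : R * R) (t : R) : R * R := (z.1 + v.1 * t, z.2 + v.2 * t).

(* [T = T1 + i T2] has complex derivative [a + i b] on [O]; for the obstacle
   problem [T = (x - u_x) + i u_y] and [O = {u > 0}]. *)
Record sakai_map (T1 T2 a b : R * R -> R) (O : set (R * R)) (r c M L : R) : Prop :=
  SakaiMap {
  sm_r : 0 < r;
  sm_c : 0 < c <= 1;
  sm_M : 0 <= M;
  sm_L : 0 <= L;
  sm_open : open O;
  sm_lip1 : forall z z', insq r z -> insq r z' ->
    `|T1 z - T1 z'| <= L * (`|z.1 - z'.1| + `|z.2 - z'.2|);
  sm_lip2 : forall z z', insq r z -> insq r z' ->
    `|T2 z - T2 z'| <= L * (`|z.1 - z'.1| + `|z.2 - z'.2|);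
  sm_off : forall z, insq r z -> ~ O z -> T1 z = z.1 /\ T2 z = 0;
  sm_der1 : forall z, insq r z -> O z -> rder T1 z (a z) (- b z);
  sm_der2 : forall z, insq r z -> O z -> rder T2 z (b z) (a z);
  sm_a : forall z, insq r z -> O z -> c <= a z;
  sm_b : forall z, insq r z -> O z -> `|b z| <= M;
  sm_ca : forall z, insq r z -> O z -> {for z, continuous a};
  sm_cb : forall z, insq r z -> O z -> {for z, continuous b} }.

Lemma is_derive_affine (x y t : R) : is_derive t 1 (fun s : R => x + y * s) y.
Proof.
apply/is_derive_epsP => e e0; exists 1 => // h _.
rewrite (_ : _ - _ - _ = 0); last by ring.
by rewrite normr0 mulr_ge0// ltW.
Qed.

Lemma segment_lt (p v t m : R) : p < m -> p + v < m -> 0 <= t <= 1 -> p + v * t < m.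
Proof.
by move=> pm pvm t01; have [v0|v0] := leP 0 v; [have : v * t <= v by nra|
  have : v * t <= 0 by nra]; slra.
Qed.

Lemma insq_shiftv r z v t : insq r z -> insq r (z.1 + v.1, z.2 + v.2) ->
  0 <= t <= 1 -> insq r (shiftv z v t).
Proof.
rewrite /insq /= => -[z1 z2] [w1 w2] t01; rewrite !ltr_norml in z1 z2 w1 w2 *.
split; apply/andP; split.
- have /= := @segment_lt (- z.1) (- v.1) t r; rewrite mulNr; slra.
- by have /= := @segment_lt (z.1) (v.1) t r; slra.
- have /= := @segment_lt (- z.2) (- v.2) t r; rewrite mulNr; slra.
- by have /= := @segment_lt (z.2) (v.2) t r; slra.
Qed.

Lemma shiftv_continuous z v : continuous (shiftv z v).
Proof.
have lin (x y : R) : continuous (fun t : R => x + y * t).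
  move=> t; apply: cvgD; first exact: cvg_cst.
  by apply: cvgM; [exact: cvg_cst|exact: cvg_id].
by move=> t; rewrite /shiftv; exact: (cvg_pair (lin z.1 v.1 t) (lin z.2 v.2 t)).
Qed.

Variables (T1 T2 a b : R * R -> R) (O : set (R * R)) (r c M L : R).
Hypothesis S : sakai_map T1 T2 a b O r c M L.
Implicit Types z v w : R * R.

Lemma line_mono z v (p q m : R) :
  insq r z -> insq r (z.1 + v.1, z.2 + v.2) ->
  (m <= p * v.1 \/ forall t, 0 <= t <= 1 -> O (shiftv z v t)) ->
  (forall w, insq r w -> O w ->
    m <= p * (a w * v.1 - b w * v.2) + q * (b w * v.1 + a w * v.2)) ->
  p * T1 z + q * T2 z + m <=
  p * T1 (z.1 + v.1, z.2 + v.2) + q * T2 (z.1 + v.1, z.2 + v.2).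
Proof.
move=> zr wr offO inO.
have sr t : 0 <= t <= 1 -> insq r (shiftv z v t) by exact: insq_shiftv.
pose f t := p * T1 (shiftv z v t) + q * T2 (shiftv z v t) - m * t.
have s0 : shiftv z v 0 = z by rewrite /shiftv !mulr0 !addr0; case: (z).
have s1 : shiftv z v 1 = (z.1 + v.1, z.2 + v.2) by rewrite /shiftv !mulr1.
suff : f 0 <= f 1 by rewrite /f s0 s1 mulr0 mulr1; slra.
apply: (@nondecreasing_off_closed _ _ [set t | ~ O (shiftv z v t)]) => //.
- pose C := `|p| * (L * (`|v.1| + `|v.2|)) + `|q| * (L * (`|v.1| + `|v.2|)) + `|m|.
  apply: (@lipschitz_within _ _ _ C) => x y /=; rewrite !in_itv/= => x01 y01.
  have E : `|(shiftv z v x).1 - (shiftv z v y).1| + `|(shiftv z v x).2 - (shiftv z v y).2|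
     = (`|v.1| + `|v.2|) * `|x - y|.
    have e (i j : R) : i + j * x - (i + j * y) = j * (x - y) by ring.
    by rewrite /= !e !normrM mulrDl.
  have := sm_lip1 S (sr _ x01) (sr _ y01); have := sm_lip2 S (sr _ x01) (sr _ y01).
  rewrite E /f; move: (T1 _) (T1 _) (T2 _) (T2 _) => t1' t1 t2' t2 H2 H1.
  have -> : p * t1 + q * t2 - m * x - (p * t1' + q * t2' - m * y) =
    p * (t1 - t1') + q * (t2 - t2') + (- m) * (x - y) by ring.
  apply: (le_trans (ler_normD _ _)); rewrite /C 2!mulrDl; apply: lerD; last first.
    by rewrite normrM normrN.
  apply: (le_trans (ler_normD _ _)); rewrite !normrM -!mulrA.
  by apply: lerD; apply: ler_wpM2l.
- apply: (@closed_comp _ _ (shiftv z v) (~` O)) => //.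
    by move=> t _; exact: shiftv_continuous.
  by apply: open_closedC; exact: sm_open S.
- move=> x y x0 xy y1 /= Kx Ky; case: offO => [offO|/(_ x)]; last first.
    by rewrite x0 (le_trans xy)// => /(_ isT).
  rewrite /f; have [|-> ->] := sm_off S (sr x _) Kx; first slra.
  have [|-> ->] := sm_off S (sr y _) Ky; first slra.
  rewrite /= !mulr0 !addr0 !mulrDr.
  have : (p * v.1 - m) * x <= (p * v.1 - m) * y by rewrite ler_wpM2l// subr_ge0.
  by rewrite !mulrBl !mulrA; slra.
- move=> t t01 /= /contrapT Ot.
  have tr : insq r (shiftv z v t) by apply: sr; slra.
  have D1 := is_derive_affine z.1 v.1 t.
  have D2 := is_derive_affine z.2 v.2 t.
  have E1 := @rder_curve _ _ (fun s => z.1 + v.1 * s) (fun s => z.2 + v.2 * s) _ _ _ _ _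
    (sm_der1 S tr Ot) D1 D2.
  have E2 := @rder_curve _ _ (fun s => z.1 + v.1 * s) (fun s => z.2 + v.2 * s) _ _ _ _ _
    (sm_der2 S tr Ot) D1 D2.
  exists (p * (a (shiftv z v t) * v.1 - b (shiftv z v t) * v.2) +
       q * (b (shiftv z v t) * v.1 + a (shiftv z v t) * v.2) - m).
    by have := inO _ tr Ot; slra.
  have := is_derive_comb 1 (- m) (is_derive_comb p q E1 E2) (is_derive_id t 1).
  have -> : (fun s : R => 1 * (p * T1 (z.1 + v.1 * s, z.2 + v.2 * s) +
      q * T2 (z.1 + v.1 * s, z.2 + v.2 * s)) + - m * s) = f.
    by apply/funext => s; rewrite /f /shiftv /= mul1r mulNr.
  by congr is_derive; rewrite mul1r mulr1 !mulNr.
Qed.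

End sakai_map.

Section sakai_cone.
Variable R : realType.
Variables (T1 T2 a b : R * R -> R) (O : set (R * R)) (r c M L : R).
Hypothesis S : sakai_map T1 T2 a b O r c M L.
Implicit Types z v w : R * R.

Let c0 : 0 < c. Proof. by have := sm_c S; slra. Qed.
Let c1 : c <= 1. Proof. by have := sm_c S; slra. Qed.
Let M0 : 0 <= M. Proof. exact: sm_M S. Qed.

Lemma increment_pair z v w : z.1 + v.1 = w.1 -> z.2 + v.2 = w.2 ->
  (z.1 + v.1, z.2 + v.2) = w.
Proof. by move=> -> ->; case: w. Qed.

Lemma sakai_monotone z w : insq r z -> insq r w ->
  c * (w.1 - z.1) ^+ 2 <=
  (T1 w - T1 z) * (w.1 - z.1) + (T2 w - T2 z) * (w.2 - z.2).
Proof.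
move=> zr wr; pose v := (w.1 - z.1, w.2 - z.2).
have E : (z.1 + v.1, z.2 + v.2) = w.
  by apply: increment_pair; rewrite /v /= subrKC.
have H : c * v.1 ^+ 2 <= v.1 * v.1.
  by rewrite expr2 ler_piMl// -expr2 sqr_ge0.
have := @line_mono _ _ _ _ _ _ _ _ _ _ S z v v.1 v.2 (c * v.1 ^+ 2) zr.
rewrite E => /(_ wr (or_introl H)) G.
have {}G : v.1 * T1 z + v.2 * T2 z + c * v.1 ^+ 2 <= v.1 * T1 w + v.2 * T2 w.
  apply: G => x xr Ox; have ax := sm_a S xr Ox.
  rewrite [leRHS](_ : _ = a x * (v.1 ^+ 2 + v.2 ^+ 2)); last by ring.
  by apply: ler_pM => //; [exact: ltW|exact: sqr_ge0|rewrite lerDl sqr_ge0].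
move: G; rewrite /v /=; slra.
Qed.

Lemma sakai_cone z w : insq r z -> insq r w ->
  M * `|w.1 - z.1| <= c * (w.2 - z.2) -> T2 z <= T2 w.
Proof.
move=> zr wr st; pose v := (w.1 - z.1, w.2 - z.2).
have E : (z.1 + v.1, z.2 + v.2) = w.
  by apply: increment_pair; rewrite /v /= subrKC.
have := @line_mono _ _ _ _ _ _ _ _ _ _ S z v 0 1 0 zr.
rewrite E !mul0r => /(_ wr (or_introl (lexx _))) G.
have {}G : 0 + 1 * T2 z + 0 <= 0 + 1 * T2 w; last by slra.
apply: G => x xr Ox; have ax := sm_a S xr Ox; have bx := sm_b S xr Ox.
have : `|b x * v.1| <= M * `|v.1| by rewrite normrM ler_wpM2r.
rewrite ler_norml => /andP[N _].
have : 0 <= v.2.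
  by rewrite -(pmulr_rge0 _ c0); apply: le_trans st; rewrite mulr_ge0.
move: st N; rewrite -/v -/(v.1) -/(v.2) /= => st N v2.
have : c * v.2 <= a x * v.2 by rewrite ler_wpM2r.
rewrite /v /= in N v2 *; slra.
Qed.

Lemma sakai_cone_in z w : insq r z -> insq r w -> O z -> 0 <= T2 z ->
  M * `|w.1 - z.1| < c * (w.2 - z.2) ->
  (forall t, 0 <= t <= 1 -> O (shiftv z (w.1 - z.1, w.2 - z.2) t)) /\ T2 z < T2 w.
Proof.
move=> zr wr Oz T2z st; pose v := (w.1 - z.1, w.2 - z.2).
have E : (z.1 + v.1, z.2 + v.2) = w.
  by apply: increment_pair; rewrite /v /= subrKC.
have sr t : 0 <= t <= 1 -> insq r (shiftv z v t).
  by move=> t01; apply: insq_shiftv => //; rewrite E.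
have m0 : 0 < c * v.2 - M * `|v.1| by rewrite subr_gt0.
have inc t : 0 < t <= 1 -> (forall s, 0 <= s <= t -> O (shiftv z v s)) ->
    T2 z < T2 (shiftv z v t).
  move=> t01 Os; pose u := (v.1 * t, v.2 * t).
  have Eu s : shiftv z u s = shiftv z v (t * s).
    by rewrite /shiftv /u /= !mulrA.
  have := @line_mono _ _ _ _ _ _ _ _ _ _ S z u 0 1 ((c * v.2 - M * `|v.1|) * t) zr.
  move=> /(_ (sr t ltac:(slra))) G.
  have {}G : 0 * T1 z + 1 * T2 z + (c * v.2 - M * `|v.1|) * t <=
       0 * T1 (shiftv z v t) + 1 * T2 (shiftv z v t).
    apply: G.
      right=> s s01; rewrite Eu; apply: Os; nra.
    move=> x xr Ox; have ax := sm_a S xr Ox; have bx := sm_b S xr Ox.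
    have : `|b x * v.1| <= M * `|v.1| by rewrite normrM ler_wpM2r.
    rewrite ler_norml => /andP[N _].
    have v20 : 0 <= v.2.
      rewrite -(pmulr_rge0 _ c0); apply/ltW/le_lt_trans; last exact: st.
      by rewrite mulr_ge0.
    have N2 : c * v.2 <= a x * v.2 by rewrite ler_wpM2r.
    rewrite [leRHS](_ : _ = (b x * v.1 + a x * v.2) * t); last first.
      by rewrite -[u.1]/(v.1 * t) -[u.2]/(v.2 * t); ring.
    by apply: ler_wpM2r; slra.
  have : 0 < (c * v.2 - M * `|v.1|) * t by apply: mulr_gt0 => //; slra.
  move: G; rewrite !mul0r !mul1r; slra.
have s0 : shiftv z v 0 = z by rewrite /shiftv !mulr0 !addr0; case: (z).
have s1 : shiftv z v 1 = w by rewrite /shiftv !mulr1.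
suff H t : 0 <= t <= 1 -> O (shiftv z v t).
  by split=> //; rewrite -s1; apply: inc => //; rewrite ltr01 lexx.
move=> t01; apply: contrapT => Kt.
pose K := [set t | ~ O (shiftv z v t)].
have cK : closed K.
  apply: (@closed_comp _ _ (shiftv z v) (~` O)) => //.
    by move=> s _; exact: shiftv_continuous.
  by apply: open_closedC; exact: sm_open S.
have A0 : (`[0, 1] `&` K) !=set0 by exists t; split=> //=; rewrite in_itv.
have cA : compact (`[0, 1] `&` K).
  by apply: compact_closedI => //; exact: segment_compact.
have cid : {within `[0, 1] `&` K, continuous (@id R)}.
  by apply: continuous_subspaceT => x; exact: cvg_id.
have [p] := compact_EVT_min A0 cA cid; rewrite inE /= in_itv/= => -[p01 Kp] minp.
have p0 : 0 < p.
  rewrite lt_neqAle; apply/andP; split; last by slra.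
  by apply/eqP => p0; apply: Kp; rewrite -p0 s0.
have below s : 0 <= s < p -> O (shiftv z v s).
  move=> sp; apply: contrapT => Ks.
  have : p <= s by apply: minp; rewrite inE/= in_itv/=; split=> //; slra.
  slra.
have H1 : T2 z < T2 (shiftv z v (p / 2)).
  by apply: inc => [|s sp]; [slra|apply: below; slra].
have H2 : T2 (shiftv z v (p / 2)) <= T2 (shiftv z v p).
  apply: sakai_cone; [apply: sr; slra|apply: sr; slra|].
  have e i : i * p - i * (p / 2) = i * (p / 2) :> R by field.
  rewrite /shiftv /= !opprD !addrA ![_ + _ - z.1]addrAC ![_ + _ - z.2]addrAC.
  rewrite !subrr !add0r !e normrM (gtr0_norm (_ : 0 < p / 2)); last by slra.
  rewrite [leLHS]mulrA [leRHS]mulrA; apply: ler_wpM2r; last exact: ltW.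
  by rewrite divr_ge0// ltW.
have [_] := sm_off S (sr p ltac:(slra)) Kp; slra.
Qed.

Lemma sakai_pos_in z : insq r z -> T2 z != 0 -> O z.
Proof.
move=> zr T2z; apply: contrapT => Oz; have [_] := sm_off S zr Oz.
by move/eqP; rewrite (negbTE T2z).
Qed.

Lemma sakai_diamond z z' w : insq r z -> insq r z' -> insq r w ->
  T2 z = 0 -> T2 z' = 0 ->
  M * `|w.1 - z.1| < c * (w.2 - z.2) ->
  M * `|z'.1 - w.1| < c * (z'.2 - w.2) -> ~ O w.
Proof.
move=> zr zr' wr T2z T2z' s1 s2 Ow.
have := sakai_cone zr wr (ltW s1); rewrite T2z => T2w.
by have [_] := sakai_cone_in wr zr' Ow T2w s2; rewrite T2z'; slra.
Qed.

Definition sakai_modulus := c ^+ 3 / (c ^+ 2 + (M + 1) ^+ 2).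

Lemma sakai_modulus_gt0 : 0 < sakai_modulus.
Proof.
have M1 : 0 < M + 1 by have := M0; slra.
apply: divr_gt0; first exact: exprn_gt0.
by apply: addr_gt0; exact: exprn_gt0.
Qed.

Lemma sakai_strong z w : insq r z -> insq r w -> 0 < T2 z -> 0 < T2 w ->
  sakai_modulus * ((w.1 - z.1) ^+ 2 + (w.2 - z.2) ^+ 2) <=
  (T1 w - T1 z) * (w.1 - z.1) + (T2 w - T2 z) * (w.2 - z.2).
Proof.
wlog vv : z w / z.2 <= w.2.
  move=> H zr wr Tz Tw; have [zw|/ltW wz] := leP z.2 w.2; first exact: H.
  have := H _ _ wz wr zr Tw Tz; slra.
move=> zr wr Tz Tw; have Oz : O z by apply: sakai_pos_in => //; rewrite gt_eqF.
pose v := (w.1 - z.1, w.2 - z.2).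
have E : (z.1 + v.1, z.2 + v.2) = w.
  by apply: increment_pair; rewrite /v /= subrKC.
have M1 : 0 < M + 1 by have := M0; slra.
have D0 : 0 < c ^+ 2 + (M + 1) ^+ 2 by apply: addr_gt0; exact: exprn_gt0.
have kc : sakai_modulus <= c.
  rewrite /sakai_modulus ler_pdivrMr// exprS ler_pM2l//.
  by have := sqr_ge0 (M + 1); slra.
have S0 : 0 <= v.1 ^+ 2 + v.2 ^+ 2 by rewrite addr_ge0 ?sqr_ge0.
have [st|st] := ltP (M * `|w.1 - z.1|) (c * (w.2 - z.2)).
  have [Os _] := sakai_cone_in zr wr Oz (ltW Tz) st.
  have := @line_mono _ _ _ _ _ _ _ _ _ _ S z v v.1 v.2 (c * (v.1 ^+ 2 + v.2 ^+ 2)) zr.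
  rewrite E => /(_ wr (or_intror Os)) G.
  have {}G : v.1 * T1 z + v.2 * T2 z + c * (v.1 ^+ 2 + v.2 ^+ 2) <=
      v.1 * T1 w + v.2 * T2 w.
    apply: G => x xr Ox; have ax := sm_a S xr Ox.
    rewrite [leRHS](_ : _ = a x * (v.1 ^+ 2 + v.2 ^+ 2)); last by ring.
    by rewrite ler_wpM2r.
  have : sakai_modulus * (v.1 ^+ 2 + v.2 ^+ 2) <= c * (v.1 ^+ 2 + v.2 ^+ 2).
    by rewrite ler_wpM2r.
  move: G; rewrite /v /=; slra.
apply: le_trans (sakai_monotone zr wr); rewrite -/v -[w.1 - z.1]/(v.1) -[w.2 - z.2]/(v.2).
have st' : c * v.2 <= (M + 1) * `|v.1|.
  by apply: le_trans st _; rewrite ler_wpM2r//; slra.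
have v20 : 0 <= v.2 by rewrite /v/=; slra.
have : (c * v.2) ^+ 2 <= ((M + 1) * `|v.1|) ^+ 2.
  by rewrite lerXn2r ?nnegrE ?mulr_ge0//; [exact: ltW|slra].
rewrite !exprMn real_normK ?num_real// => Q.
rewrite /sakai_modulus mulrAC ler_pdivrMr// (_ : c ^+ 3 = c * c ^+ 2); last by ring.
rewrite -!mulrA ler_pM2l//; slra.
Qed.

End sakai_cone.

(** * The inverses of Sakai's map *)

Section sakai_inverse.
Variable R : realType.
Variables (T1 T2 a b : R * R -> R) (O : set (R * R)) (r c M L : R).
Hypothesis S : sakai_map T1 T2 a b O r c M L.
Implicit Types z v w : R * R.

Lemma quadratic_bound (k x y p q : R) : 0 < k -> 0 <= x -> 0 <= y -> 0 <= p -> 0 <= q ->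
  k * (x ^+ 2 + y ^+ 2) <= p * x + q * y -> x * k <= p + q /\ y * k <= p + q.
Proof.
wlog xy : x y p q / x <= y.
  move=> H k0 x0 y0 p0 q0 A; have [xy|/ltW yx] := leP x y; first exact: H.
  have A' : k * (y ^+ 2 + x ^+ 2) <= q * y + p * x by slra.
  by have [] := H y x q p yx k0 y0 x0 q0 p0 A'; rewrite addrC.
move=> k0 x0 y0 p0 q0 H.
suff yk : y * k <= p + q.
  by split=> //; apply: le_trans yk; apply: ler_wpM2r => //; exact: ltW.
move: (y0); rewrite le_eqVlt => /predU1P[<-|y1]; first by rewrite mul0r addr_ge0.
rewrite -(ler_pM2l y1).
have : 0 <= k * x ^+ 2 by apply: mulr_ge0; [exact: ltW|exact: sqr_ge0].
have : p * x <= p * y by exact: ler_wpM2l.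
slra.
Qed.

(* The points of the closure of [{T2 > 0}], described without a limit. *)
Definition above z := forall h : R, 0 < h -> insq r (z.1, z.2 + h) ->
  0 < T2 (z.1, z.2 + h).

Lemma insq_up z : insq r z -> exists2 e : R, 0 < e &
  forall h, 0 <= h < e -> insq r (z.1, z.2 + h).
Proof.
move=> [z1 z2]; exists (r - `|z.2|) => [|h he]; first by rewrite subr_gt0.
split=> //=; apply: le_lt_trans (ler_normD _ _) _; rewrite [`|h|]ger0_norm; slra.
Qed.

Lemma sakai_strong_above z w : insq r z -> insq r w -> above z -> above w ->
  sakai_modulus c M * ((w.1 - z.1) ^+ 2 + (w.2 - z.2) ^+ 2) <=
  (T1 w - T1 z) * (w.1 - z.1) + (T2 w - T2 z) * (w.2 - z.2).
Proof.
move=> zr wr az aw; have L0 := sm_L S.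
have [e1 e10 H1] := insq_up zr; have [e2 e20 H2] := insq_up wr.
set v1 := w.1 - z.1; set v2 := w.2 - z.2; set q := sakai_modulus c M * _.
rewrite leNgt; apply/negP => gap.
pose B := 2 * L * (`|v1| + `|v2|) + 1.
have B0 : 0 < B.
  by rewrite /B ltr_wpDl// mulr_ge0// ?addr_ge0// mulr_ge0.
pose g := q - ((T1 w - T1 z) * v1 + (T2 w - T2 z) * v2).
have g0 : 0 < g by rewrite /g; slra.
pose h := Num.min (Num.min (e1 / 2) (e2 / 2)) (g / B / 2).
have h0 : 0 < h.
  by rewrite /h !lt_min !divr_gt0.
have he1 : h < e1.
  by apply: (@le_lt_trans _ _ (e1 / 2)); [rewrite /h !ge_min lexx|slra].
have he2 : h < e2.
  by apply: (@le_lt_trans _ _ (e2 / 2)); [rewrite /h !ge_min lexx orbT|slra].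
have hB : h * B < g.
  apply: (@le_lt_trans _ _ (g / B / 2 * B)).
    by apply: ler_wpM2r; [exact: ltW|rewrite /h ge_min lexx orbT].
  by rewrite (_ : g / B / 2 * B = g / 2); [slra|field; rewrite gt_eqF].
have zh := H1 h ltac:(slra); have wh := H2 h ltac:(slra).
have := sakai_strong S zh wh (az _ h0 zh) (aw _ h0 wh).
have -> : (w.1, w.2 + h).2 - (z.1, z.2 + h).2 = v2 by rewrite /v2 /=; ring.
rewrite /= -/v1 -/q.
have := sm_lip1 S wh wr; have := sm_lip1 S zr zh.
have := sm_lip2 S wh wr; have := sm_lip2 S zr zh.
rewrite /= !subrr normr0 !add0r.
have -> : z.2 - (z.2 + h) = - h by ring.
have -> : w.2 + h - w.2 = h by ring.
rewrite normrN (gtr0_norm h0).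
move: (T1 (_, _)) (T1 (_, _)) (T2 (_, _)) (T2 (_, _)) => t1 t2 t3 t4 A1 A2 A3 A4.
rewrite /g in hB; rewrite /B in hB.
have C1 : `|(t1 - T1 w + (T1 z - t2)) * v1| <= 2 * L * h * `|v1|.
  by rewrite normrM ler_wpM2r// (le_trans (ler_normD _ _))//; slra.
have C2 : `|(t3 - T2 w + (T2 z - t4)) * v2| <= 2 * L * h * `|v2|.
  by rewrite normrM ler_wpM2r// (le_trans (ler_normD _ _))//; slra.
have := ler_norm ((t1 - T1 w + (T1 z - t2)) * v1).
have := ler_norm ((t3 - T2 w + (T2 z - t4)) * v2).
move=> D1 D2.
have : (t1 - t2) * v1 + (t3 - t4) * v2 <=
  (T1 w - T1 z) * v1 + (T2 w - T2 z) * v2 + h * (2 * L * (`|v1| + `|v2|)).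
  slra.
rewrite mulrDr mulr1 in hB; slra.
Qed.

Lemma sakai_inverse_lip z w : insq r z -> insq r w -> above z -> above w ->
  let D := (`|T1 w - T1 z| + `|T2 w - T2 z|) / sakai_modulus c M in
  `|w.1 - z.1| <= D /\ `|w.2 - z.2| <= D.
Proof.
move=> zr wr az aw D; have := sakai_strong_above zr wr az aw.
have k0 := sakai_modulus_gt0 S.
set v1 := w.1 - z.1; set v2 := w.2 - z.2; set d1 := T1 w - _; set d2 := T2 w - _.
rewrite -(real_normK (num_real v1)) -(real_normK (num_real v2)) => H.
have H' : sakai_modulus c M * (`|v1| ^+ 2 + `|v2| ^+ 2) <= `|d1| * `|v1| + `|d2| * `|v2|.
  by rewrite -!normrM (le_trans H)// (le_trans (ler_norm _))// ler_normD.
rewrite /D !ler_pdivlMr// -/d1 -/d2.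
have [] // := quadratic_bound k0 (normr_ge0 v1) (normr_ge0 v2) (normr_ge0 d1)
  (normr_ge0 d2) H'.
Qed.

End sakai_inverse.

Section sakai_existence.
Variable R : realType.
Variables (T1 T2 a b : R * R -> R) (O : set (R * R)) (r c M L : R).
Hypothesis S : sakai_map T1 T2 a b O r c M L.
Hypothesis off0 : ~ O (0, 0).
Hypothesis vert0 : forall y : R, `|y| < r -> y != 0 -> O (0, y).
Implicit Types z v w : R * R.

Let c0 : 0 < c. Proof. by have := sm_c S; slra. Qed.
Let M0 : 0 <= M. Proof. exact: sm_M S. Qed.
Let L0 : 0 <= L. Proof. exact: sm_L S. Qed.
Let r0 : 0 < r. Proof. exact: sm_r S. Qed.

Let in0 : insq r (0, 0). Proof. by rewrite /insq /= normr0. Qed.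

Let T00 : T1 (0, 0) = 0 /\ T2 (0, 0) = 0.
Proof. by have := sm_off S in0 off0. Qed.

Lemma T2_vert (y : R) : `|y| < r -> (0 < y -> 0 < T2 (0, y)) /\ (y < 0 -> T2 (0, y) < 0).
Proof.
move=> yr; have [_ T20] := T00; have iny t : `|t| <= `|y| -> insq r (0, t).
  by move=> ty; rewrite /insq /= normr0; split=> //; exact: le_lt_trans yr.
have M00 (t : R) : 0 < t -> M * `|0 - 0 : R| < c * t.
  by move=> t0; rewrite subrr normr0 mulr0 mulr_gt0.
split=> y0.
  have ny : `|y / 2| <= `|y| by rewrite !gtr0_norm; slra.
  have h0 : O (0, y / 2) by apply: vert0; [exact: le_lt_trans yr|rewrite gt_eqF; slra].
  have H : 0 <= T2 (0, y / 2).
    rewrite -[leLHS]T20; apply: (sakai_cone S) => //; first exact: iny.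
    by apply: ltW; apply: M00 => /=; slra.
  have [|||_] := @sakai_cone_in _ _ _ _ _ _ _ _ _ _ S (0, y / 2) (0, y) _ _ h0 H.
  - exact: iny.
  - exact: iny.
  - by apply: M00 => /=; slra.
  - by slra.
rewrite ltNge; apply/negP => H.
have Oy : O (0, y) by apply: vert0 => //; rewrite lt_eqF.
have [|||_] := @sakai_cone_in _ _ _ _ _ _ _ _ _ _ S (0, y) (0, 0) _ _ Oy H => //.
- exact: iny.
- by apply: M00 => /=; slra.
- by rewrite T20; slra.
Qed.

Lemma horizontal_solution : exists rho eta d : R,
  [/\ [/\ 0 < rho, rho < r, 0 < eta & eta < r], 0 < d &
   forall s y : R, `|s| <= d -> `|y| <= eta -> exists2 x : R, `|x| <= rho & T1 (x, y) = s].
Proof.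
pose rho := r / 2; pose d := c * rho / 2.
have cr : 0 < c * rho by apply: mulr_gt0 => //; rewrite /rho; have := r0; slra.
pose eta := Num.min (r / 2) (d / (L + 1)).
have L1 : 0 < L + 1 by have := L0; slra.
have eta0 : 0 < eta by rewrite /eta lt_min !divr_gt0.
have eta1 : eta <= r / 2 by rewrite /eta ge_min lexx.
have eta2 : L * eta <= d.
  have : eta * (L + 1) <= d by rewrite -ler_pdivlMr// /eta ge_min lexx orbT.
  have := eta0; slra.
exists rho, eta, d; split; [split|by rewrite /d; slra|] => //.
- by rewrite /rho; have := r0; slra.
- by rewrite /rho; have := r0; slra.
- by have := r0; slra.
move=> s y sd yeta.
have inxy x : `|x| <= rho -> insq r (x, y).
  by move=> xr; split=> /=; [apply: (le_lt_trans xr)|apply: (le_lt_trans yeta)];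
    rewrite ?/rho; have := r0; slra.
have rho0 : 0 < rho by rewrite /rho; have := r0; slra.
have i0 := inxy 0 ltac:(rewrite normr0; slra).
have ir := inxy rho ltac:(rewrite gtr0_norm; slra).
have imr := inxy (- rho) ltac:(rewrite normrN gtr0_norm; slra).
have T0 : `|T1 (0, y)| <= d.
  have := sm_lip1 S i0 in0; have [-> _] := T00; rewrite /= !subr0 normr0 add0r.
  move=> /le_trans; apply; apply: le_trans eta2; exact: ler_wpM2l.
have up : s <= T1 (rho, y).
  have := sakai_monotone S i0 ir; rewrite /= !subrr subr0 mulr0 addr0 expr2 mulrA.
  rewrite ler_pM2r//; move: T0 sd; rewrite !ler_norml /d; slra.
have dn : T1 (- rho, y) <= s.
  have := sakai_monotone S imr i0; rewrite /= !subrr sub0r opprK mulr0 addr0 expr2 mulrA.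
  rewrite ler_pM2r//; move: T0 sd; rewrite !ler_norml /d; slra.
have [|||x] := @IVT R (fun x => T1 (x, y)) (- rho) rho s.
- by slra.
- apply: (@lipschitz_within _ _ _ L) => x x' /=; rewrite !in_itv/= -!ler_norml.
  move=> /inxy ix /inxy ix'; have := sm_lip1 S ix ix'.
  by rewrite /= subrr normr0 addr0.
- by rewrite ge_min dn le_max up orbT.
- by rewrite in_itv/= -ler_norml => xr; exists x.
Qed.

Lemma sakai_exists : exists2 d : R, 0 < d & forall s t : R, `|s| < d -> 0 <= t < d ->
  exists z, [/\ insq r z, T1 z = s, T2 z = t & above T2 r z].
Proof.
have [rho [eta [d1 [[rho0 rhor eta0 etar] d10 HX]]]] := horizontal_solution.
have [X HX'] : exists X : R -> R -> R, forall s y, `|s| <= d1 -> `|y| <= eta ->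
    `|X s y| <= rho /\ T1 (X s y, y) = s.
  have /choice[X HX'] (p : R * R) : exists x : R, `|p.1| <= d1 -> `|p.2| <= eta ->
      `|x| <= rho /\ T1 (x, p.2) = p.1.
    have [H|nH] := pselect (`|p.1| <= d1 /\ `|p.2| <= eta).
      by have [x x1 x2] := HX _ _ H.1 H.2; exists x.
    by exists 0 => H1 H2; case: nH.
  by exists (fun s y => X (s, y)) => s y; exact: (HX' (s, y)).
have inX s y : `|s| <= d1 -> `|y| <= eta -> insq r (X s y, y).
  move=> sd ye; have [xr _] := HX' s y sd ye.
  by split; [exact: le_lt_trans rhor|exact: le_lt_trans etar].
have lipX s s' y y' : `|s| <= d1 -> `|s'| <= d1 -> `|y| <= eta -> `|y'| <= eta ->
    c * `|X s y - X s' y'| <= `|s - s'| + L * `|y - y'|.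
  move=> sd sd' ye ye'.
  have [xr Ts] := HX' s y sd ye; have [xr' Ts'] := HX' s' y' sd' ye'.
  have i1 := inX _ _ sd ye; have i2 := inX _ _ sd' ye'.
  have i3 : insq r (X s' y', y) by split; [exact: i2.1|exact: i1.2].
  have := sakai_monotone S i3 i1; rewrite /= Ts subrr mulr0 addr0.
  have := sm_lip1 S i3 i2; rewrite /= Ts' subrr normr0 add0r.
  move: (T1 (_, _)) => t1; move: (X s y - X s' y') => D H1 H2.
  have H3 : c * `|D| <= `|s - t1|.
    have [->|D0] := eqVneq D 0; first by rewrite normr0 mulr0.
    rewrite -(@ler_pM2r _ `|D|) ?normr_gt0// -mulrA -normrM -expr2 ger0_norm ?sqr_ge0//.
    by rewrite -normrM (le_trans H2)// ler_norm.
  apply: le_trans H3 _.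
  have -> : s - t1 = (s - s') + (s' - t1) by ring.
  by apply: le_trans (ler_normD _ _) _; rewrite lerD2l distrC.
pose G s y := T2 (X s y, y).
have lipG s s' y y' : `|s| <= d1 -> `|s'| <= d1 -> `|y| <= eta -> `|y'| <= eta ->
    `|G s y - G s' y'| <= L / c * `|s - s'| + L * (L / c + 1) * `|y - y'|.
  move=> sd sd' ye ye'.
  have := sm_lip2 S (inX _ _ sd ye) (inX _ _ sd' ye') => /= /le_trans; apply.
  have : `|X s y - X s' y'| <= (`|s - s'| + L * `|y - y'|) / c.
    by rewrite ler_pdivlMr// mulrC lipX.
  move=> H; apply: (@le_trans _ _ (L * ((`|s - s'| + L * `|y - y'|) / c + `|y - y'|))).
    by apply: ler_wpM2l => //; rewrite lerD2r.
  by rewrite le_eqVlt; apply/orP; left; apply/eqP; field; rewrite gt_eqF.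
have nd : `|0 : R| <= d1 by rewrite normr0 ltW.
have ne : `|eta| <= eta by rewrite gtr0_norm.
have nme : `|- eta| <= eta by rewrite normrN gtr0_norm.
have Gup : 0 < G 0 eta.
  have [_ T1X] := HX' 0 eta nd ne; have := sakai_monotone S in0 (inX _ _ nd ne).
  have [-> ->] := T00; rewrite /= T1X !subr0 mul0r add0r -/(G 0 eta) => H.
  have G0 : 0 <= G 0 eta.
    rewrite -(pmulr_lge0 _ eta0); apply: le_trans H.
    by apply: mulr_ge0; [exact: ltW|exact: sqr_ge0].
  rewrite lt_neqAle G0 andbT; apply/eqP => G1; move: H; rewrite -G1 mul0r.
  rewrite pmulr_rle0// => X0; have {}X0 : X 0 eta = 0.
    by apply/eqP; rewrite -sqrf_eq0 eq_le X0 sqr_ge0.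
  have [H _] := @T2_vert eta ltac:(by rewrite gtr0_norm).
  by move: G1; rewrite /G X0 => G1; have := H eta0; rewrite -G1 ltxx.
have Gdn : G 0 (- eta) < 0.
  have [_ T1X] := HX' 0 (- eta) nd nme; have := sakai_monotone S in0 (inX _ _ nd nme).
  have [-> ->] := T00; rewrite /= T1X !subr0 mul0r add0r -/(G 0 (- eta)) mulrN => H.
  have G0 : G 0 (- eta) <= 0.
    rewrite -oppr_ge0 -(pmulr_lge0 _ eta0) mulNr; apply: le_trans H.
    by apply: mulr_ge0; [exact: ltW|exact: sqr_ge0].
  rewrite lt_neqAle G0 andbT; apply/eqP => G1; move: H; rewrite G1 mul0r oppr0.
  rewrite pmulr_rle0// => X0; have {}X0 : X 0 (- eta) = 0.
    by apply/eqP; rewrite -sqrf_eq0 eq_le X0 sqr_ge0.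
  have [_ H] := @T2_vert (- eta) ltac:(by rewrite normrN gtr0_norm).
  by move: G1; rewrite /G X0 => G1; have := H ltac:(slra); rewrite G1 ltxx.
pose m := Num.min (G 0 eta) (- G 0 (- eta)).
have m0 : 0 < m by rewrite /m lt_min Gup oppr_gt0.
have mu : m <= G 0 eta by rewrite /m ge_min lexx.
have md : m <= - G 0 (- eta) by rewrite /m ge_min lexx orbT.
have K0 : 0 < L / c + 1 by rewrite ltr_wpDl// divr_ge0// ltW.
pose d := Num.min (Num.min d1 (m / 2)) (m / 2 / (L / c + 1)).
exists d; first by rewrite /d !lt_min d10 !divr_gt0.
move=> s t; rewrite /d !lt_min => /andP[/andP[sd1 sm] sm2] /andP[t0 /andP[/andP[_ tm] _]].
have sd := ltW sd1.
have Ls : L / c * `|s - 0| <= m / 2.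
  move: sm2; rewrite ltr_pdivlMr// subr0 mulrDr mulr1 mulrC.
  by have := normr_ge0 s; slra.
have Gsu : t < G s eta.
  have := lipG s 0 eta eta sd nd ne ne; rewrite subrr normr0 mulr0 addr0 ler_norml; slra.
have Gsd : G s (- eta) <= t.
  have := lipG s 0 _ _ sd nd nme nme; rewrite subrr normr0 mulr0 addr0 ler_norml; slra.
have Gcont y : `|y| <= eta -> {within `[y, eta], continuous (G s)}.
  move=> ye; apply: (@lipschitz_within _ _ _ (L * (L / c + 1))) => x x' /=.
  rewrite !in_itv/= => xI x'I; move: ye; rewrite ler_norml => ye.
  have := lipG s s x x' sd sd; rewrite subrr normr0 mulr0 add0r.
  by apply; rewrite ler_norml; slra.
have ivt y : `|y| <= eta -> G s y <= t ->
    exists2 y', `|y'| <= eta & y <= y' /\ G s y' = t.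
  move=> ye Gy; have [|||y' + Gy'] := @IVT R (G s) y eta t.
  - by move: ye; rewrite ler_norml; slra.
  - exact: Gcont.
  - by rewrite ge_min Gy le_max (ltW Gsu) orbT.
  rewrite in_itv/= => yI; exists y'; last by split=> //; slra.
  by move: ye; rewrite !ler_norml; slra.
pose A := [set y | `|y| <= eta /\ G s y = t].
have [y1 y1e [_ Gy1]] := ivt _ nme Gsd.
have supA : has_sup A.
  split; first by exists y1.
  by exists eta => y [/=]; rewrite ler_norml; slra.
pose Y := sup A.
have Ay y : A y -> y <= Y by move=> ay; apply: ub_le_sup => //; exact: supA.2.
have Ye : `|Y| <= eta.
  rewrite ler_norml; apply/andP; split.
    by apply: le_trans (Ay y1 _); [move: y1e; rewrite ler_norml; slra|].
  by apply: ge_sup => [|y [/=]]; [exact: supA.1|rewrite ler_norml; slra].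
have KL : 0 <= L * (L / c + 1) by apply: mulr_ge0 => //; exact: ltW.
have GY : G s Y = t.
  apply/eqP; rewrite -subr_eq0 -normr_eq0 eq_le normr_ge0 andbT.
  apply/ler_addgt0Pr => e e0; rewrite add0r.
  have e1 : 0 < e / (L * (L / c + 1) + 1) by rewrite divr_gt0// ltr_wpDl.
  have [y [ye Gy] Yy] := sup_adherent e1 supA.
  have := lipG s s Y y sd sd Ye ye; rewrite Gy subrr normr0 mulr0 add0r.
  move=> /le_trans; apply.
  have yY : y <= Y by apply: Ay; split.
  rewrite ger0_norm ?subr_ge0//.
  have : (Y - y) * (L * (L / c + 1) + 1) <= e.
    by rewrite -ler_pdivlMr ?ltr_wpDl//; rewrite -/Y in Yy; slra.
  have : 0 <= Y - y by slra.
  slra.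
have gtY y : `|y| <= eta -> Y < y -> t < G s y.
  move=> ye Yy; rewrite ltNge; apply/negP => /(ivt _ ye)[y' y'e [yy' Gy']].
  have : y' <= Y by apply: Ay; split.
  slra.
have Yeta : Y < eta.
  rewrite lt_neqAle; apply/andP; split; last by move: Ye; rewrite ler_norml; slra.
  by apply/eqP => YE; move: Gsu; rewrite -YE GY ltxx.
have [XY T1Y] := HX' s Y sd Ye.
exists (X s Y, Y); split=> //; first exact: inX.
move=> h h0 hr /=.
pose D := 2 * (c ^+ 2 + M * L).
have c2 : 0 < c ^+ 2 by rewrite exprn_gt0.
have ML : 0 <= M * L by exact: mulr_ge0.
have D0 : 0 < D by rewrite /D; slra.
pose k := Num.min (eta - Y) (h * c ^+ 2 / D).
have k0 : 0 < k.
  by rewrite /k lt_min subr_gt0 Yeta divr_gt0// mulr_gt0.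
have k1 : k <= eta - Y by rewrite /k ge_min lexx.
have k2 : k * D <= h * c ^+ 2 by rewrite -ler_pdivlMr// /k ge_min lexx orbT.
have Yk : `|Y + k| <= eta by move: Ye; rewrite !ler_norml; slra.
have Gk := gtY _ Yk ltac:(slra).
have ik := inX _ _ sd Yk.
have Ok : O (X s (Y + k), Y + k).
  by apply: (sakai_pos_in S) => //; rewrite gt_eqF// -/(G s (Y + k)); slra.
have st : M * `|X s Y - X s (Y + k)| < c * (Y + h - (Y + k)).
  have := lipX s s Y (Y + k) sd sd Ye Yk; rewrite subrr normr0 add0r.
  have -> : Y - (Y + k) = - k by ring.
  rewrite normrN (gtr0_norm k0) => H.
  have {}H : M * (c * `|X s Y - X s (Y + k)|) <= M * (L * k) by exact: ler_wpM2l.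
  rewrite -(ltr_pM2l c0) mulrCA; apply: le_lt_trans H _.
  have -> : Y + h - (Y + k) = h - k by ring.
  have kD : k * (c ^+ 2 + M * L) < h * c ^+ 2.
    have : 0 < k * (c ^+ 2 + M * L) by apply: mulr_gt0 => //; slra.
    move: k2; rewrite /D; slra.
  slra.
have [|_] := sakai_cone_in S ik hr Ok _ st; rewrite /= -/(G s (Y + k)); slra.
Qed.

End sakai_existence.

(** * Integrals over segments *)

Section segment_integral.
Variable R : realType.
Local Notation mu := (@lebesgue_measure R).
Implicit Types f g : R -> R.

Lemma continuous_pair f g : continuous f -> continuous g ->
  continuous (fun t => (f t, g t) : R * R).
Proof. by move=> cf cg t; exact: (cvg_pair (cf t) (cg t)). Qed.

Lemma within_continuousM (A : set R) f g : {within A, continuous f} ->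
  {within A, continuous g} -> {within A, continuous (fun x => f x * g x)}.
Proof. by move=> cf cg x; apply: continuousM; [exact: cf|exact: cg]. Qed.

Lemma within_dominated (A : set R) (f g h : R -> R) (L : R) :
  (forall x y, A x -> A y -> `|f x - f y| <= L * (`|g x - g y| + `|h x - h y|)) ->
  continuous g -> continuous h -> {within A, continuous f}.
Proof.
move=> H cg ch; apply/subspace_continuousP => x Ax; apply/cvgrPdist_le => e e0.
suff : nbhs x (fun y => A y -> `|f x - f y| <= e) by [].
have L1 : 0 < `|L| + 1 by have := normr_ge0 L; slra.
have e1 : 0 < e / 2 / (`|L| + 1) by rewrite !divr_gt0.
have /cvgrPdist_lt/(_ _ e1) Hg := cg x; have /cvgrPdist_lt/(_ _ e1) Hh := ch x.
near=> y => Ay; apply: le_trans (H _ _ Ax Ay) _.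
have h1 : `|g x - g y| < e / 2 / (`|L| + 1) by near: y.
have h2 : `|h x - h y| < e / 2 / (`|L| + 1) by near: y.
apply: (@le_trans _ _ ((`|L| + 1) * (e / 2 / (`|L| + 1) + e / 2 / (`|L| + 1)))).
  apply: (@le_trans _ _ ((`|L| + 1) * (`|g x - g y| + `|h x - h y|))).
    by apply: ler_wpM2r; [exact: addr_ge0|have := ler_norm L; slra].
  by apply: ler_wpM2l; [exact: ltW|apply: lerD; exact: ltW].
by rewrite le_eqVlt; apply/orP; left; apply/eqP; field; rewrite gt_eqF.
Unshelve. all: by end_near. Qed.

Lemma seg_integrable (p q : R) f : {within `[p, q], continuous f} ->
  mu.-integrable `[p, q] (EFin \o f).
Proof. by move=> cf; apply: continuous_compact_integrable => //; exact: segment_compact. Qed.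

Lemma seg_cst (p q m : R) : p <= q -> \int[mu]_(x in `[p, q]) m = m * (q - p).
Proof.
move=> pq; rewrite Rintegral_cst//; congr (_ * _).
suff H : mu `[p, q]%classic = (q - p)%:E by exact: (congr1 fine H).
rewrite lebesgue_measure_itv/= lte_fin.
move: pq; rewrite le_eqVlt => /predU1P[->|pq]; first by rewrite ltxx subrr.
by rewrite pq EFinB.
Qed.

Lemma seg_cont_cst (p q m : R) : {within `[p, q], continuous (fun=> m)}.
Proof. by apply: continuous_subspaceT => x; exact: cvg_cst. Qed.

Lemma seg_ge (p q m : R) f : p <= q -> {within `[p, q], continuous f} ->
  (forall x, p <= x <= q -> m <= f x) -> m * (q - p) <= \int[mu]_(x in `[p, q]) f x.
Proof.
move=> pq cf mf; rewrite -(seg_cst m pq); apply: le_Rintegral => //.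
- by apply: seg_integrable; exact: seg_cont_cst.
- exact: seg_integrable.
Qed.

Lemma seg_bound (p q B : R) f : p <= q -> {within `[p, q], continuous f} ->
  (forall x, p <= x <= q -> `|f x| <= B) ->
  `|\int[mu]_(x in `[p, q]) f x| <= B * (q - p).
Proof.
move=> pq cf Bf; rewrite ler_norml; apply/andP; split.
  rewrite -mulNr; apply: seg_ge => // x /Bf; rewrite ler_norml; slra.
rewrite -(seg_cst B pq); apply: le_Rintegral => //.
- exact: seg_integrable.
- by apply: seg_integrable; exact: seg_cont_cst.
- by move=> x /=; rewrite in_itv/= => /Bf; rewrite ler_norml; slra.
Qed.

Lemma seg_split (p q x : R) f : p <= x <= q -> {within `[p, q], continuous f} ->
  \int[mu]_(t in `[p, q]) f t =
  \int[mu]_(t in `[p, x]) f t + \int[mu]_(t in `[x, q]) f t.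
Proof.
move=> pxq cf; have := @Rintegral_itvB R f (BLeft p) (BRight q) x.
move=> /(_ (seg_integrable cf)); rewrite !bnd_simp => H.
rewrite -(Rintegral_itv_obnd_cbnd (r := x)); last first.
  apply: (@integrableS _ _ _ mu `[p, q]) => //; last exact: seg_integrable.
  by apply: subset_itv; rewrite bnd_simp; slra.
rewrite -H; [ring|slra|slra].
Qed.

Lemma seg_cont_sub (p q x y : R) f : p <= x -> y <= q ->
  {within `[p, q], continuous f} -> {within `[x, y], continuous f}.
Proof.
move=> px yq; apply: continuous_subspaceW => t /=; rewrite !in_itv/= => txy.
by apply/andP; split; slra.
Qed.

Lemma seg_trim (p q e B : R) f : 0 <= e -> p + e <= q - e ->
  {within `[p, q], continuous f} -> (forall x, p <= x <= q -> `|f x| <= B) ->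
  `|\int[mu]_(x in `[p, q]) f x - \int[mu]_(x in `[p + e, q - e]) f x| <= 2 * B * e.
Proof.
move=> e0 peq cf Bf.
rewrite (@seg_split p q (p + e))//; last by slra.
have cf' : {within `[p + e, q], continuous f} by apply: seg_cont_sub cf; slra.
rewrite (@seg_split (p + e) q (q - e))//; last by slra.
have := @seg_bound p (p + e) B f ltac:(slra).
have := @seg_bound (q - e) q B f ltac:(slra).
set i1 := Rintegral _ _ _; set i2 := Rintegral _ _ _; set i3 := Rintegral _ _ _.
move=> H1 H2.
have {}H1 : `|i1| <= B * (q - (q - e)).
  by apply: H1 => [|x x1]; [apply: seg_cont_sub cf; slra|apply: Bf; slra].
have {}H2 : `|i2| <= B * (p + e - p).
  by apply: H2 => [|x x1]; [apply: seg_cont_sub cf; slra|apply: Bf; slra].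
rewrite (_ : i2 + (i3 + i1) - i3 = i2 + i1); last by ring.
by apply: le_trans (ler_normD _ _) _; slra.
Qed.

Lemma seg_FTC (p q : R) f (F : R -> R) : p < q -> {within `[p, q], continuous f} ->
  (forall x, p <= x <= q -> is_derive x 1 F (f x)) ->
  \int[mu]_(x in `[p, q]) f x = F q - F p.
Proof.
move=> pq cf dF; rewrite /Rintegral (@continuous_FTC2 _ f F)//.
  have cF x : p <= x <= q -> {for x, continuous F}.
    move=> xpq; apply/differentiable_continuous/derivable1_diffP.
    exact: (@ex_derive _ _ _ _ _ _ _ (dF x xpq)).
  split.
  - move=> x; rewrite in_itv/= => xpq.
    by apply: (@ex_derive _ _ _ _ _ _ _ (dF x _)); slra.
  - by apply: cvg_at_right_filter; apply: cF; slra.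
  - by apply: cvg_at_left_filter; apply: cF; slra.
move=> x; rewrite in_itv/= => xpq; rewrite derive1E.
by apply: (@derive_val _ _ _ _ _ _ _ (dF x _)); slra.
Qed.

Lemma is_derive_lip (f : R -> R) (x l C d : R) : 0 < d -> is_derive x 1 f l ->
  (forall y, `|y - x| < d -> `|f y - f x| <= C * `|y - x|) -> `|l| <= C.
Proof.
move=> d0 /is_derive_epsP H Hf; apply/ler_addgt0Pr => e e0.
have [d1 d10 Hd] := H e e0.
pose h := Num.min d d1 / 2.
have m0 : 0 < Num.min d d1 by rewrite lt_min d0.
have h0 : 0 < h by rewrite /h; slra.
have hd : `|h| < d.
  by rewrite gtr0_norm// (@lt_le_trans _ _ (Num.min d d1))//; [rewrite /h; slra|rewrite ge_min lexx].
have hd1 : `|h| < d1.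
  by rewrite gtr0_norm// (@lt_le_trans _ _ (Num.min d d1))//; [rewrite /h; slra|rewrite ge_min lexx orbT].
have := Hd h hd1; have := Hf (x + h); rewrite addrAC subrr add0r => /(_ hd).
move=> H1 H2; rewrite -(@ler_pM2r _ h)// -{1}(gtr0_norm h0) -normrM.
rewrite (gtr0_norm h0) in H1 H2.
have -> : l * h = (f (x + h) - f x) - (f (x + h) - f x - l * h) by ring.
by apply: le_trans (ler_normB _ _) _; slra.
Qed.

End segment_integral.

(** * Cauchy's formula on a half disc *)

Section half_plane_cauchy.
Variable R : realType.
Local Notation mu := (@lebesgue_measure R).
Implicit Types (w : R * R) (s t : R).

Definition inhalf (d : R) w := `|w.1| < d /\ 0 <= w.2 < d.

Variables (F1 F2 D1 D2 : R * R -> R) (d L : R).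
Hypothesis d0 : 0 < d.
Hypothesis L0 : 0 <= L.
Hypothesis lip1 : forall w w', inhalf d w -> inhalf d w' ->
  `|F1 w - F1 w'| <= L * (`|w.1 - w'.1| + `|w.2 - w'.2|).
Hypothesis lip2 : forall w w', inhalf d w -> inhalf d w' ->
  `|F2 w - F2 w'| <= L * (`|w.1 - w'.1| + `|w.2 - w'.2|).
Hypothesis der1 : forall w, inhalf d w -> 0 < w.2 -> rder F1 w (D1 w) (- D2 w).
Hypothesis der2 : forall w, inhalf d w -> 0 < w.2 -> rder F2 w (D2 w) (D1 w).
Hypothesis cD1 : forall w, inhalf d w -> 0 < w.2 -> {for w, continuous D1}.
Hypothesis cD2 : forall w, inhalf d w -> 0 < w.2 -> {for w, continuous D2}.
Hypothesis axis : forall x, `|x| < d -> F2 (x, 0) = 0.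

Let rho := d / 2.
Let rho0 : 0 < rho. Proof. by rewrite /rho divr_gt0. Qed.
Let rhod : rho < d. Proof. by rewrite /rho; move: d0; lra. Qed.

Let X t := rho * cos t.
Let Y t := rho * sin t.

Let XY t : X t ^+ 2 + Y t ^+ 2 = rho ^+ 2.
Proof. by rewrite /X /Y !exprMn -mulrDr cos2Dsin2 mulr1. Qed.

Let Xle t : `|X t| <= rho.
Proof.
rewrite /X normrM (gtr0_norm rho0) ler_piMr ?(ltW rho0)// ler_norml.
by rewrite cos_geN1 cos_le1.
Qed.

Let Yle t : `|Y t| <= rho.
Proof.
rewrite /Y normrM (gtr0_norm rho0) ler_piMr ?(ltW rho0)// ler_norml.
by rewrite sin_geN1 sin_le1.
Qed.

Let Y0 t : 0 <= t <= pi -> 0 <= Y t.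
Proof. by move=> tpi; rewrite /Y mulr_ge0 ?(ltW rho0)// sin_ge0_pi. Qed.

Let cX : continuous X.
Proof. by move=> t; apply: cvgM; [exact: cvg_cst|exact: continuous_cos]. Qed.
Let cY : continuous Y.
Proof. by move=> t; apply: cvgM; [exact: cvg_cst|exact: continuous_sin]. Qed.

Let B := `|F1 (0, 0)| + `|F2 (0, 0)| + 2 * d * L.

Let in00 : inhalf d (0, 0). Proof. by rewrite /inhalf /= normr0 lexx. Qed.

Let F1_le w : inhalf d w -> `|F1 w| <= B.
Proof.
move=> wd; have := lip1 wd in00; rewrite /= !subr0 => H.
have := ler_normD (F1 w - F1 (0, 0)) (F1 (0, 0)); rewrite subrK /B.
have : L * (`|w.1| + `|w.2|) <= L * (2 * d).
  apply: ler_wpM2l => //; case: wd => w1 w2; rewrite [`|w.2|]ger0_norm; lra.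
by have := normr_ge0 (F2 (0, 0)); lra.
Qed.

Let F2_le w : inhalf d w -> `|F2 w| <= B.
Proof.
move=> wd; have := lip2 wd in00; rewrite /= !subr0 => H.
have := ler_normD (F2 w - F2 (0, 0)) (F2 (0, 0)); rewrite subrK /B.
have : L * (`|w.1| + `|w.2|) <= L * (2 * d).
  apply: ler_wpM2l => //; case: wd => w1 w2; rewrite [`|w.2|]ger0_norm; lra.
by have := normr_ge0 (F1 (0, 0)); lra.
Qed.

Let B0 : 0 <= B. Proof. by apply: le_trans (F1_le in00). Qed.

Let cn (n : nat) := \int[mu]_(t in `[0, pi])
  ((F1 (X t, Y t) * cos (n%:R * t) + F2 (X t, Y t) * sin (n%:R * t)) / rho ^+ n).

Let ccos (n : nat) : continuous (fun t : R => cos (n%:R * t)).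
Proof.
move=> t; apply: (@continuous_comp _ _ _ (fun t : R => n%:R * t) (@cos R)).
  by apply: cvgM; [exact: cvg_cst|exact: cvg_id].
exact: continuous_cos.
Qed.

Let csin (n : nat) : continuous (fun t : R => sin (n%:R * t)).
Proof.
move=> t; apply: (@continuous_comp _ _ _ (fun t : R => n%:R * t) (@sin R)).
  by apply: cvgM; [exact: cvg_cst|exact: cvg_id].
exact: continuous_sin.
Qed.

Section kernel.
Variable a : R.
Hypothesis ale : `|a| <= rho / 2.

Let N t := (X t - a) ^+ 2 + Y t ^+ 2.
Let k1 t := (X t * (X t - a) + Y t * Y t) / N t.
Let k2 t := (Y t * (X t - a) - X t * Y t) / N t.

Let aX t : `|a * X t| <= rho ^+ 2 / 2.
Proof.
rewrite normrM (_ : rho ^+ 2 / 2 = rho / 2 * rho); last by field.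
exact: ler_pM.
Qed.

Let NE t : N t = rho ^+ 2 - 2 * (a * X t) + a ^+ 2.
Proof. by rewrite /N -(XY t); ring. Qed.

Let Nge t : rho ^+ 2 / 4 <= N t.
Proof.
have H : a * X t <= `|a| * rho.
  by apply: le_trans (ler_norm _) _; rewrite normrM; exact: ler_pM.
have H2 : (rho / 2) ^+ 2 <= (rho - `|a|) ^+ 2.
  have ar : rho / 2 <= rho - `|a| by move: ale; lra.
  have r2 : 0 <= rho / 2 by move: rho0; lra.
  by rewrite lerXn2r// ?nnegrE//; exact: le_trans ar.
rewrite NE -(real_normK (num_real a)).
have -> : rho ^+ 2 / 4 = (rho / 2) ^+ 2 by field.
apply: le_trans H2 _; rewrite sqrrB -mulr_natl; move: H; lra.
Qed.

Let rho2 : 0 < rho ^+ 2. Proof. exact: exprn_gt0. Qed.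

Let N0 t : 0 < N t.
Proof. by apply: lt_le_trans (Nge t); move: rho2; lra. Qed.

Let a2 : a ^+ 2 <= rho ^+ 2 / 4.
Proof.
rewrite -(real_normK (num_real a)) (_ : rho ^+ 2 / 4 = (rho / 2) ^+ 2); last by field.
by rewrite lerXn2r// ?nnegrE//; move: rho0; lra.
Qed.

Let k1E t : k1 t = (rho ^+ 2 - a * X t) / N t.
Proof. by rewrite /k1 -(XY t); congr (_ / _); ring. Qed.

Let k1_ge t : 2 / 9 <= k1 t.
Proof.
rewrite k1E ler_pdivlMr// NE; have := aX t; rewrite ler_norml; move: a2; lra.
Qed.

Let k1_le t : `|k1 t| <= 6.
Proof.
rewrite ger0_norm; last by apply: le_trans (k1_ge t); lra.
rewrite k1E ler_pdivrMr//; have := aX t; rewrite ler_norml; have := Nge t; lra.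
Qed.

Let k2_le t : `|k2 t| <= 6.
Proof.
rewrite /k2 (_ : _ - _ = - (a * Y t)); last by ring.
rewrite normrM normfV (gtr0_norm (N0 t)) ler_pdivrMr// normrN normrM.
have : `|a| * `|Y t| <= rho / 2 * rho by exact: ler_pM.
have := Nge t; have := rho2; rewrite (_ : rho / 2 * rho = rho ^+ 2 / 2); last by field.
lra.
Qed.

Let cN : continuous N.
Proof.
have -> : N = fun t => (X t - a) * (X t - a) + Y t * Y t.
  by apply/funext => t; rewrite /N !expr2.
move=> t; apply: cvgD; apply: cvgM; try exact: cY.
  by apply: cvgB; [exact: cX|exact: cvg_cst].
by apply: cvgB; [exact: cX|exact: cvg_cst].
Qed.

Let ck1 : continuous k1.
Proof.
move=> t; apply: cvgM; last by apply: cvgV; [rewrite gt_eqF|exact: cN].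
apply: cvgD; apply: cvgM; try exact: cY; first exact: cX.
by apply: cvgB; [exact: cX|exact: cvg_cst].
Qed.

Let ck2 : continuous k2.
Proof.
move=> t; apply: cvgM; last by apply: cvgV; [rewrite gt_eqF|exact: cN].
apply: cvgB; apply: cvgM; try exact: cY; last exact: cX.
by apply: cvgB; [exact: cX|exact: cvg_cst].
Qed.

Let g1 s t := a + (X t - a) * s.
Let g2 s t := 0 + Y t * s.
Let g s t := (g1 s t, g2 s t).

Let g_in s t : 0 <= s <= 1 -> 0 <= t <= pi -> inhalf d (g s t).
Proof.
move=> s01 tpi; split=> /=; last first.
  have := Yle t; have := Y0 tpi; rewrite /g2 ler_norml => y0 y1.
  have ys0 : 0 <= Y t * s by apply: mulr_ge0 => //; lra.
  have ys1 : Y t * s <= Y t by apply: ler_piMr => //; lra.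
  by rewrite add0r ys0/=; apply: (le_lt_trans ys1); apply: le_lt_trans rhod; lra.
have -> : g1 s t = a * (1 - s) + X t * s by rewrite /g1; ring.
apply: le_lt_trans rhod; apply: le_trans (ler_normD _ _) _.
rewrite normrM [`|X t * s|]normrM.
have -> : `|s| = s by rewrite ger0_norm; lra.
have -> : `|1 - s| = 1 - s by rewrite ger0_norm; lra.
have -> : rho = rho * (1 - s) + rho * s by ring.
have ar : `|a| <= rho by move: ale rho0; lra.
by apply: lerD; apply: ler_wpM2r; rewrite ?ar ?Xle//; lra.
Qed.

Let dPhi s t := D1 (g s t) * X t - D2 (g s t) * Y t.
Let Phi s t := F1 (g s t) * k1 t - F2 (g s t) * k2 t.

Let Phi_derive s t : 0 < s < 1 -> 0 < Y t -> 0 <= t <= pi ->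
  is_derive s 1 (Phi^~ t) (dPhi s t).
Proof.
move=> s01 yt tpi; have gi : inhalf d (g s t) by apply: g_in => //; lra.
have g20 : 0 < (g s t).2 by rewrite /g /g2 /= add0r mulr_gt0//; lra.
have A1 := is_derive_affine a (X t - a) s; have A2 := is_derive_affine 0 (Y t) s.
have E1 := @rder_curve _ _ (g1^~ t) (g2^~ t) _ _ _ _ _ (der1 gi g20) A1 A2.
have E2 := @rder_curve _ _ (g1^~ t) (g2^~ t) _ _ _ _ _ (der2 gi g20) A1 A2.
have := is_derive_comb (k1 t) (- k2 t) E1 E2.
have -> : (fun s => k1 t * F1 (g1 s t, g2 s t) + - k2 t * F2 (g1 s t, g2 s t)) = Phi^~ t.
  by apply/funext => v; rewrite /Phi /g; ring.
congr is_derive; rewrite /dPhi /k1 /k2 /N -/(g s t).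
by field; rewrite -/(N t) gt_eqF.
Qed.

Let F2_derive s t : 0 < s < 1 -> 0 < Y t -> 0 <= t <= pi ->
  is_derive t 1 (fun t => F2 (g s t) / s) (dPhi s t).
Proof.
move=> s01 yt tpi; have gi : inhalf d (g s t) by apply: g_in => //; lra.
have g20 : 0 < (g s t).2 by rewrite /g /g2 /= add0r mulr_gt0//; lra.
have A1 : is_derive t 1 (g1 s) (- Y t * s).
  have := is_derive_comb (s * rho) 1 (is_derive_cos t) (is_derive_cst (a - a * s) t 1).
  have -> : (fun v => s * rho * cos v + 1 * cst (a - a * s) v) = g1 s.
    by apply/funext => v; rewrite /g1 /X /=; ring.
  by congr is_derive; rewrite /Y; ring.
have A2 : is_derive t 1 (g2 s) (X t * s).
  have := is_derive_comb (s * rho) 1 (is_derive_sin t) (is_derive_cst 0 t 1).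
  have -> : (fun v => s * rho * sin v + 1 * cst 0 v) = g2 s.
    by apply/funext => v; rewrite /g2 /Y /=; ring.
  by congr is_derive; rewrite /X; ring.
have E2 := @rder_curve _ _ (g1 s) (g2 s) _ _ _ _ _ (der2 gi g20) A1 A2.
have := is_derive_comb s^-1 0 E2 (is_derive_id t 1).
have -> : (fun v => s^-1 * F2 (g1 s v, g2 s v) + 0 * v) = (fun t => F2 (g s t) / s).
  by apply/funext => v; rewrite mul0r addr0 mulrC.
congr is_derive; rewrite /dPhi -/(g s t).
by field; rewrite gt_eqF//; lra.
Qed.

Let cg1 s : continuous (g1 s).
Proof.
move=> t; apply: cvgD; first exact: cvg_cst.
by apply: cvgM; [apply: cvgB; [exact: cX|exact: cvg_cst]|exact: cvg_cst].
Qed.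

Let cg2 s : continuous (g2 s).
Proof.
move=> t; apply: cvgD; first exact: cvg_cst.
by apply: cvgM; [exact: cY|exact: cvg_cst].
Qed.

Let cg s : continuous (g s).
Proof.
by apply: (@continuous_pair _ (g1 s) (g2 s)) => t; [exact: cg1|exact: cg2].
Qed.

Let cF1 s : 0 <= s <= 1 -> {within `[0, pi], continuous (fun t => F1 (g s t))}.
Proof.
move=> s01; apply: (@within_dominated _ _ _ (g1 s) (g2 s) L) => [x y|//|//].
by rewrite /= !in_itv/= => x0 y0; exact: (lip1 (g_in s01 x0) (g_in s01 y0)).
Qed.

Let cF2 s : 0 <= s <= 1 -> {within `[0, pi], continuous (fun t => F2 (g s t))}.
Proof.
move=> s01; apply: (@within_dominated _ _ _ (g1 s) (g2 s) L) => [x y|//|//].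
by rewrite /= !in_itv/= => x0 y0; exact: (lip2 (g_in s01 x0) (g_in s01 y0)).
Qed.

Let cPhi s : 0 <= s <= 1 -> {within `[0, pi], continuous (Phi s)}.
Proof.
move=> s01; apply: within_continuousB; apply: within_continuousM.
- exact: cF1.
- exact: continuous_subspaceT.
- exact: cF2.
- exact: continuous_subspaceT.
Qed.

Let C := 36 * L * rho.

Let Phi_lip s s' t : 0 <= s <= 1 -> 0 <= s' <= 1 -> 0 <= t <= pi ->
  `|Phi s t - Phi s' t| <= C * `|s - s'|.
Proof.
move=> s01 s01' tpi; have gi := g_in s01 tpi; have gi' := g_in s01' tpi.
have H : `|g1 s t - g1 s' t| + `|g2 s t - g2 s' t| <= 3 * rho * `|s - s'|.
  have -> : g1 s t - g1 s' t = (X t - a) * (s - s') by rewrite /g1; ring.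
  have -> : g2 s t - g2 s' t = Y t * (s - s') by rewrite /g2; ring.
  rewrite [`|(X t - a) * _|]normrM [`|Y t * _|]normrM -mulrDl; apply: ler_wpM2r => //.
  by have := ler_normB (X t) a; have := Xle t; have := Yle t; move: ale rho0; lra.
have H1 := lip1 gi gi'; have H2 := lip2 gi gi'.
have LH : L * (`|g1 s t - g1 s' t| + `|g2 s t - g2 s' t|) <= L * (3 * rho * `|s - s'|).
  exact: ler_wpM2l.
have {}H1 := le_trans H1 LH; have {}H2 := le_trans H2 LH.
rewrite (_ : Phi s t - Phi s' t =
  (F1 (g s t) - F1 (g s' t)) * k1 t - (F2 (g s t) - F2 (g s' t)) * k2 t); last first.
  by rewrite /Phi; ring.
apply: le_trans (ler_normB _ _) _; rewrite [`|_ * k1 t|]normrM [`|_ * k2 t|]normrM.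
have -> : C * `|s - s'| = L * (3 * rho * `|s - s'|) * 6 + L * (3 * rho * `|s - s'|) * 6.
  by rewrite /C; ring.
by apply: lerD; apply: ler_pM.
Qed.

Let Yint e t : 0 < e -> e <= t <= pi - e -> 0 <= t <= pi /\ 0 < Y t.
Proof.
move=> e0 te; split; first by lra.
by rewrite /Y mulr_gt0// sin_gt0_pi//; lra.
Qed.

Let cdPhi s e : 0 < s < 1 -> 0 < e -> {within `[e, pi - e], continuous (dPhi s)}.
Proof.
move=> s01 e0; apply: continuous_in_subspaceT => t; rewrite inE/= in_itv/= => te.
have [tpi yt] := Yint e0 te; have gi : inhalf d (g s t) by apply: g_in => //; lra.
have g20 : 0 < (g s t).2 by rewrite /g /g2 /= add0r mulr_gt0//; lra.
apply: cvgB; apply: cvgM.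
- by apply: (@continuous_comp _ _ _ (g s) D1); [exact: cg|exact: cD1].
- exact: cX.
- by apply: (@continuous_comp _ _ _ (g s) D2); [exact: cg|exact: cD2].
- exact: cY.
Qed.

Let Ie e s := \int[mu]_(t in `[e, pi - e]) Phi s t.

Let C0 : 0 <= C. Proof. by rewrite /C !mulr_ge0// ltW. Qed.

Let sub_cont s e : 0 < e -> 0 <= s <= 1 -> {within `[e, pi - e], continuous (Phi s)}.
Proof. by move=> e0 s01; apply: seg_cont_sub (cPhi s01); lra. Qed.

Let Ie_derive e s : 0 < e -> e < pi - e -> 0 < s < 1 ->
  is_derive s 1 (Ie e) (\int[mu]_(t in `[e, pi - e]) dPhi s t).
Proof.
move=> e0 epi s01.
have mB : measurable (`[e, pi - e]%classic : set (measurableTypeR R)) by [].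
have Ia : `]0, 1[%classic s by rewrite /= in_itv/=; lra.
have intf (x : R) : `]0, 1[%classic x -> mu.-integrable `[e, pi - e] (EFin \o Phi x).
  rewrite /= in_itv/= => x01; apply: seg_integrable; apply: sub_cont => //; lra.
have dPx (x y : R) : `]0, 1[%classic x -> `[e, pi - e]%classic y ->
    is_derive x 1 (Phi^~ y) (dPhi x y).
  rewrite /= !in_itv/= => x01 /(Yint e0)[ypi yt].
  by apply: Phi_derive => //; lra.
have derf (x y : R) : `]0, 1[%classic x -> `[e, pi - e]%classic y ->
    derivable (Phi^~ y) x 1.
  by move=> x01 ye; exact: (@ex_derive _ _ _ _ _ _ _ (dPx x y x01 ye)).
have pE (x y : R) : `]0, 1[%classic x -> `[e, pi - e]%classic y ->
    partial1of2 Phi x y = dPhi x y.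
  move=> x01 ye; rewrite partial1of2E.
  exact: (@derive_val _ _ _ _ _ _ _ (dPx x y x01 ye)).
have intG : mu.-integrable `[e, pi - e] (EFin \o (fun=> C : R)).
  by apply: seg_integrable; exact: seg_cont_cst.
have Gub (x y : R) : `]0, 1[%classic x -> `[e, pi - e]%classic y ->
    `|partial1of2 Phi x y| <= (fun=> C) y.
  move=> x01 ye; rewrite pE//; have := dPx x y x01 ye.
  move: x01 ye; rewrite /= !in_itv/= => x01 /(Yint e0)[ypi yt] dx.
  apply: (@is_derive_lip _ _ x _ C (Num.min x (1 - x))) dx _.
    by rewrite lt_min; lra.
  move=> z; rewrite lt_min !ltr_norml => zx; apply: Phi_lip => //; lra.
have G0 (y : R) : 0 <= (fun=> C) y by [].
have DI := derivable_under_integral mB Ia intf derf G0 intG Gub.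
have VI := differentiation_under_integral mB Ia intf derf G0 intG Gub.
apply: DeriveDef; first exact: DI.
rewrite -derive1E [LHS]VI; apply: eq_Rintegral => y; rewrite inE => ye.
exact: pE.
Qed.

Let F2_small s t : 0 < s < 1 -> 0 <= t <= pi -> `|F2 (g s t) / s| <= L * Y t.
Proof.
move=> s01 tpi; have s01' : 0 <= s <= 1 by lra.
have gi := g_in s01' tpi; have := Y0 tpi => yt.
have gi0 : inhalf d (g1 s t, 0) by split; [exact: gi.1|rewrite /= lexx].
have := lip2 gi gi0; rewrite axis; last exact: gi.1.
rewrite /= subrr normr0 add0r !subr0 /g2 add0r [`|Y t * s|]normrM.
rewrite [`|F2 _ / s|]normrM normfV (gtr0_norm (_ : 0 < s)); last by lra.
by rewrite (ger0_norm yt) ler_pdivrMr ?mulrA//; lra.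
Qed.

Let Ie_bound e : 0 < e -> e < pi - e -> `|Ie e 1 - Ie e 0| <= 2 * L * Y e.
Proof.
move=> e0 epi; have [||s] := @MVT R (Ie e)
  (fun s => \int[mu]_(t in `[e, pi - e]) dPhi s t) 0 1 ltr01.
- by move=> s; rewrite in_itv/= => s01; exact: Ie_derive.
- apply: (@lipschitz_within _ _ _ (C * (pi - e - e))) => s s' /=.
  rewrite !in_itv/= => s01 s01'; rewrite /Ie -RintegralB//; last 2 first.
  + by apply: seg_integrable; exact: sub_cont.
  + by apply: seg_integrable; exact: sub_cont.
  rewrite mulrAC; apply: seg_bound; first by lra.
    by apply: within_continuousB; exact: sub_cont.
  by move=> t te; apply: Phi_lip => //; lra.
- rewrite in_itv/= => s01; rewrite subr0 mulr1 => ->.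
  have dF t : e <= t <= pi - e -> is_derive t 1 (fun t => F2 (g s t) / s) (dPhi s t).
    by move=> /(Yint e0)[tpi yt]; exact: F2_derive.
  have -> := @seg_FTC _ e (pi - e) (dPhi s) (fun t => F2 (g s t) / s) epi (cdPhi s01 e0) dF.
  apply: le_trans (ler_normB _ _) _.
  have e1 := F2_small s01 (_ : 0 <= e <= pi).
  have e2 := F2_small s01 (_ : 0 <= pi - e <= pi).
  have Ye : Y (pi - e) = Y e by rewrite /Y sinB sinpi cospi; ring.
  rewrite Ye in e2; have := e1 ltac:(lra); have := e2 ltac:(lra); lra.
Qed.

Let comb_le (x y x' y' : R) : `|x| <= B -> `|y| <= B -> `|x'| <= 6 -> `|y'| <= 6 ->
  `|x * x'| + `|y * y'| <= 12 * B.
Proof.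
move=> H1 H2 H3 H4; rewrite !normrM (_ : 12 * B = B * 6 + B * 6); last by ring.
by apply: lerD; exact: ler_pM.
Qed.

Let Phi_le s t : 0 <= s <= 1 -> 0 <= t <= pi -> `|Phi s t| <= 12 * B.
Proof.
move=> s01 tpi; have gi := g_in s01 tpi; apply: le_trans (ler_normB _ _) _.
by apply: comb_le; [exact: F1_le|exact: F2_le|exact: k1_le|exact: k2_le].
Qed.

Let pi0 : 0 < pi :> R. Proof. exact: pi_gt0. Qed.

(* Cauchy's formula at [a] for the half disc, up to the positive factor [int k1]. *)
Let V0E : \int[mu]_(t in `[0, pi]) Phi 1 t =
  \int[mu]_(t in `[0, pi]) k1 t * F1 (a, 0).
Proof.
have s0 : 0 <= (0 : R) <= 1 by rewrite lexx ler01.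
have s1 : 0 <= (1 : R) <= 1 by rewrite lexx ler01.
have ad : `|a| < d.
  by apply: le_lt_trans ale _; apply: lt_trans rhod; move: rho0; lra.
have -> : \int[mu]_(t in `[0, pi]) k1 t * F1 (a, 0) = \int[mu]_(t in `[0, pi]) Phi 0 t.
  rewrite mulrC -RintegralZl//; last first.
    by apply: seg_integrable; exact: continuous_subspaceT.
  apply: eq_Rintegral => t _; rewrite /Phi /g /g1 /g2 !mulr0 !addr0 axis//.
  by rewrite mul0r subr0.
apply/eqP; rewrite -subr_eq0 -normr_eq0 eq_le normr_ge0 andbT.
apply/ler_addgt0Pr => e e0; rewrite add0r.
pose m := e / 2 / (2 * L + 1).
have m0 : 0 < m by rewrite /m !divr_gt0// ltr_wpDl// mulr_ge0.
have Yz : Y 0 = 0 by rewrite /Y sin0 mulr0.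
have := cY (x := 0); rewrite /continuous_at Yz => /cvgrPdist_lt/(_ _ m0)/nbhs_ballP[d1 /= d10 Hd].
pose h := Num.min (Num.min (d1 / 2) (pi / 4)) (e / 2 / (48 * B + 1)).
have h0 : 0 < h.
  by rewrite /h !lt_min !divr_gt0// ltr_wpDl// mulr_ge0.
have hd : h < d1.
  by apply: (@le_lt_trans _ _ (d1 / 2)); [rewrite /h !ge_min lexx|lra].
have hpi : h <= pi / 4 by rewrite /h !ge_min lexx orbT.
have hB : h * (48 * B + 1) <= e / 2.
  by rewrite -ler_pdivlMr ?ltr_wpDl ?mulr_ge0// /h ge_min lexx orbT.
have Yh : 2 * L * Y h <= e / 2.
  have : `|0 - Y h| < m by apply: Hd; rewrite /ball/= sub0r normrN gtr0_norm.
  rewrite sub0r normrN => /ltW yh; have := le_trans (ler_norm _) yh.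
  have y0 : 0 <= Y h by apply: Y0; move: pi0; lra.
  rewrite /m ler_pdivlMr; last by rewrite ltr_wpDl// mulr_ge0.
  lra.
have hh : 0 + h <= pi - h by move: pi0; lra.
have := @seg_trim _ 0 pi h (12 * B) (Phi 1) (ltW h0) hh (cPhi s1)
  (fun t => Phi_le s1 (t := t)).
have := @seg_trim _ 0 pi h (12 * B) (Phi 0) (ltW h0) hh (cPhi s0)
  (fun t => Phi_le s0 (t := t)).
have := @Ie_bound h h0 ltac:(move: pi0; lra).
rewrite add0r /Ie.
move: (Rintegral _ _ _) (Rintegral _ _ _) (Rintegral _ _ _) (Rintegral _ _ _).
move=> i1 i2 i3 i4 H1 H2 H3.
rewrite (_ : i1 - i2 = (i1 - i4) + (i4 - i3) - (i2 - i3)); last by ring.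
apply: le_trans (ler_normB _ _) _.
have := ler_normD (i1 - i4) (i4 - i3); lra.
Qed.

Let G1 t := F1 (X t, Y t) * k1 t - F2 (X t, Y t) * k2 t.
Let G2 t := F1 (X t, Y t) * k2 t + F2 (X t, Y t) * k1 t.
Let V (n : nat) := \int[mu]_(t in `[0, pi])
  ((G1 t * cos (n%:R * t) + G2 t * sin (n%:R * t)) / rho ^+ n).

Let g1E t : g 1 t = (X t, Y t).
Proof. by rewrite /g /g1 /g2 !mulr1 subrKC add0r. Qed.

Let s1 : 0 <= (1 : R) <= 1. Proof. by rewrite lexx ler01. Qed.

Let cF1z : {within `[0, pi], continuous (fun t => F1 (X t, Y t))}.
Proof.
have <- : (fun t => F1 (g 1 t)) = (fun t => F1 (X t, Y t)).
  by apply/funext => t; rewrite g1E.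
by apply: cF1; exact: s1.
Qed.

Let cF2z : {within `[0, pi], continuous (fun t => F2 (X t, Y t))}.
Proof.
have <- : (fun t => F2 (g 1 t)) = (fun t => F2 (X t, Y t)).
  by apply/funext => t; rewrite g1E.
by apply: cF2; exact: s1.
Qed.

Let cG1 : {within `[0, pi], continuous G1}.
Proof.
by apply: within_continuousB; apply: within_continuousM => //; exact: continuous_subspaceT.
Qed.

Let cG2 : {within `[0, pi], continuous G2}.
Proof.
by apply: within_continuousD; apply: within_continuousM => //; exact: continuous_subspaceT.
Qed.

Let cV (n : nat) (H1 H2 : R -> R) : {within `[0, pi], continuous H1} ->
  {within `[0, pi], continuous H2} -> {within `[0, pi], continuous
   (fun t => (H1 t * cos (n%:R * t) + H2 t * sin (n%:R * t)) / rho ^+ n)}.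
Proof.
move=> c1 c2; apply: within_continuousM; last exact: seg_cont_cst.
apply: within_continuousD; apply: within_continuousM => //; apply: continuous_subspaceT.
  exact: ccos.
exact: csin.
Qed.

Let zd t : 0 <= t <= pi -> inhalf d (X t, Y t).
Proof. by move=> tpi; rewrite -g1E; exact: g_in. Qed.

(* [G1 + i G2 = F z / (z - a)], and [z / (z - a) = 1 + (a / z) (z / (z - a))] gives
   the recurrence. *)
Lemma kernel_expansion : exists V : nat -> R, exists2 k : R, 0 < k &
  [/\ V 0 = k * F1 (a, 0), forall n, V n = cn n + a * V n.+1 &
    forall n, `|V n| <= 24 * B * pi / rho ^+ n].
Proof.
exists V, (\int[mu]_(t in `[0, pi]) k1 t); [|split].
- apply: (@lt_le_trans _ _ (2 / 9 * (pi - 0))).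
    by rewrite subr0 mulr_gt0// divr_gt0.
  apply: seg_ge; [exact: ltW|exact: continuous_subspaceT|].
  by move=> t _; exact: k1_ge.
- rewrite -V0E; apply: eq_Rintegral => t _; rewrite /Phi g1E -/(G1 t).
  by rewrite mul0r cos0 sin0 mulr0 mulr1 addr0 expr0 divr1.
- move=> n; apply/eqP; rewrite -subr_eq; apply/eqP.
  rewrite -RintegralZl//; last by apply: seg_integrable; exact: cV.
  rewrite -RintegralB//; last 2 first.
  + by apply: seg_integrable; exact: cV.
  + apply: seg_integrable; apply: within_continuousM; last exact: cV.
    exact: seg_cont_cst.
  apply: eq_Rintegral => t _.
  have -> : n.+1%:R * t = n%:R * t + t by rewrite -natr1 mulrDl mul1r.
  rewrite cosD sinD exprS.
  have -> : cos t = X t / rho by rewrite /X; field; rewrite gt_eqF.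
  have -> : sin t = Y t / rho by rewrite /Y; field; rewrite gt_eqF.
  have P0 : rho ^+ n != 0 by rewrite gt_eqF// exprn_gt0.
  have r0 : rho != 0 by rewrite gt_eqF.
  have Nt : N t != 0 by rewrite gt_eqF.
  have XYt := XY t.
  have e1 : G1 t - a / rho ^+ 2 * (X t * G1 t + Y t * G2 t) = F1 (X t, Y t).
    rewrite -XYt /G1 /G2 /k1 /k2 /N; field.
    by rewrite -/(N t) Nt XYt expf_neq0.
  have e2 : G2 t - a / rho ^+ 2 * (X t * G2 t - Y t * G1 t) = F2 (X t, Y t).
    rewrite -XYt /G1 /G2 /k1 /k2 /N; field.
    by rewrite -/(N t) Nt XYt expf_neq0.
  by rewrite -e1 -e2; field; rewrite P0 r0.
- move=> n; have -> : 24 * B * pi / rho ^+ n = 24 * B / rho ^+ n * (pi - 0) by ring.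
  apply: seg_bound; [exact: ltW|exact: cV|].
  move=> t tpi; have zdt := zd tpi.
  rewrite normrM normfV (gtr0_norm (exprn_gt0 n rho0)).
  apply: ler_wpM2r; first by rewrite invr_ge0 exprn_ge0// ltW.
  apply: le_trans (ler_normD _ _) _; rewrite [`|G1 t * _|]normrM [`|G2 t * _|]normrM.
  have -> : 24 * B = 12 * B * 1 + 12 * B * 1 by ring.
  apply: lerD; apply: ler_pM => //.
  + apply: le_trans (ler_normB _ _) _.
    by apply: comb_le; [exact: F1_le|exact: F2_le|exact: k1_le|exact: k2_le].
  + by rewrite ler_norml cos_geN1 cos_le1.
  + apply: le_trans (ler_normD _ _) _.
    by apply: comb_le; [exact: F1_le|exact: F2_le|exact: k2_le|exact: k1_le].
  + by rewrite ler_norml sin_geN1 sin_le1.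
Qed.

End kernel.

Lemma half_plane_identity :
  (forall e, 0 < e -> exists2 t, 0 < `|t| < e & F1 (t, 0) = 0) ->
  forall t, `|t| <= d / 4 -> F1 (t, 0) = 0.
Proof.
move=> zeros.
have E a : `|a| <= d / 4 -> `|a| <= rho / 2 by rewrite /rho; lra.
have BP : 0 <= 24 * B * pi by rewrite !mulr_ge0// ltW// pi_gt0.
have /choice[V HV] (a : R) : exists V : nat -> R, `|a| <= rho / 2 -> exists2 k : R, 0 < k &
    [/\ V 0%N = k * F1 (a, 0), forall n, V n = cn n + a * V n.+1 &
    forall n, `|V n| <= 24 * B * pi / rho ^+ n].
  have [/kernel_expansion[V HV]|] := boolP (`|a| <= rho / 2); first by exists V.
  by exists (fun=> 0).
pose Z t := 0 < `|t| <= rho / 2 /\ F1 (t, 0) = 0.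
have cn_lim n : (forall t, Z t -> V t n = 0) -> cn n = 0.
  move=> V0; apply/eqP; rewrite -normr_eq0 eq_le normr_ge0 andbT.
  apply/ler_addgt0Pr => e e0; rewrite add0r.
  pose D := 24 * B * pi / rho ^+ n.+1 + 1.
  have D0 : 0 < D by rewrite /D ltr_wpDl// divr_ge0// exprn_ge0// ltW.
  have [|t te Ft] := zeros (Num.min (rho / 2) (e / D)).
    by rewrite lt_min !divr_gt0.
  move: te; rewrite lt_min => /andP[t0 /andP[tr te]].
  have Zt : Z t by split=> //; rewrite t0 ltW.
  have [k k0 [_ VE Vb]] := HV t (ltW tr).
  have := VE n; rewrite V0// => /esym/eqP; rewrite addr_eq0 => /eqP ->.
  rewrite normrN normrM; move: te; rewrite ltr_pdivlMr// => /ltW; apply: le_trans.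
  by apply: ler_wpM2l => //; apply: le_trans (Vb _) _; rewrite /D lerDl.
have VZ n : forall t, Z t -> V t n = 0.
  elim: n => [|n IH] t [tr Ft].
    have [|k k0 [-> _ _]] := HV t; first by lra.
    by rewrite Ft mulr0.
  have [|k k0 [_ VE _]] := HV t; first by lra.
  have := VE n; rewrite cn_lim// IH// add0r => /esym/eqP; rewrite mulf_eq0.
  by move=> /orP[/eqP t0|/eqP//]; move: tr; rewrite t0 normr0 ltxx.
move=> a /E ar; have [k k0 [V0 VE Vb]] := HV a ar.
have Van n : V a 0%N = a ^+ n * V a n.
  elim: n => [|n ->]; first by rewrite expr0 mul1r.
  by rewrite VE (cn_lim _ (VZ n)) add0r mulrA exprSr.
have Vn n : `|V a 0%N| * 2 ^+ n <= 24 * B * pi.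
  rewrite (Van n) normrM normrX.
  have rn : 0 < rho ^+ n by exact: exprn_gt0.
  have H : `|a| ^+ n <= (rho / 2) ^+ n by rewrite lerXn2r ?nnegrE// divr_ge0// ltW.
  have V2 : `|V a n| * rho ^+ n <= 24 * B * pi by rewrite -ler_pdivlMr.
  apply: le_trans V2; rewrite mulrAC [leRHS]mulrC; apply: ler_wpM2r => //.
  have -> : rho ^+ n = (rho / 2) ^+ n * 2 ^+ n.
    by rewrite -exprMn mulfVK.
  by apply: ler_wpM2r => //; exact: exprn_ge0.
suff V00 : V a 0%N = 0.
  by move: V0; rewrite V00 => /esym/eqP; rewrite mulf_eq0 gt_eqF//= => /eqP.
apply/eqP; apply/negP => /negP Va; rewrite -normr_gt0 in Va.
have := archi_boundP (divr_ge0 BP (ltW Va)); set n := Num.bound _.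
rewrite ltr_pdivrMr// => H.
have := Vn n; rewrite leNgt => /negP; apply; apply: lt_le_trans H _.
rewrite mulrC; apply: ler_wpM2l => //.
by rewrite -natrX ler_nat ltnW// ltn_expl.
Qed.

End half_plane_cauchy.

(** * Reflection *)

Section sakai_reflection.
Variable R : realType.
Implicit Types z v w : R * R.

Definition cj (z : R * R) : R * R := (z.1, - z.2).

Lemma cjK : involutive cj.
Proof. by case=> x y; rewrite /cj /= opprK. Qed.

Lemma insq_cj r z : insq r (cj z) <-> insq r z.
Proof. by rewrite /insq /= normrN. Qed.

Lemma cj_continuous : continuous cj.
Proof.
move=> z; have c1 : {for z, continuous (fun w : R * R => w.1)} by exact: cvg_fst.
have c2 : {for z, continuous (fun w : R * R => - w.2)}.
  by apply: cvgN; exact: cvg_snd.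
exact: (cvg_pair c1 c2).
Qed.

Lemma rder_cj (f : R * R -> R) z p q : rder f (cj z) p q -> rder (f \o cj) z p (- q).
Proof.
move=> H e e0; have [d d0 Hd] := H e e0; exists d => // h k hd kd.
have := Hd h (- k) hd; rewrite !normrN mulrN -mulNr => /(_ kd).
suff -> : (f \o cj) (z.1 + h, z.2 + k) = f ((cj z).1 + h, (cj z).2 - k) by [].
by rewrite /cj /= opprD.
Qed.

Lemma rderN (f : R * R -> R) z p q : rder f z p q -> rder (fun w => - f w) z (- p) (- q).
Proof.
move=> H e e0; have [d d0 Hd] := H e e0; exists d => // h k hd kd.
have := Hd h k hd kd; rewrite -normrN; congr (`|_| <= _); ring.
Qed.

Lemma sakai_conj T1 T2 a b O r c M L : @sakai_map R T1 T2 a b O r c M L ->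
  sakai_map (T1 \o cj) (fun z => - T2 (cj z)) (a \o cj) (fun z => - b (cj z))
    (cj @^-1` O) r c M L.
Proof.
move=> S; have icj z : insq r z -> insq r (cj z) by move/insq_cj.
split.
- exact: sm_r S.
- exact: sm_c S.
- exact: sm_M S.
- exact: sm_L S.
- by apply: open_comp; [move=> z _; exact: cj_continuous|exact: sm_open S].
- move=> z z' /icj zr /icj zr'; have := sm_lip1 S zr zr'.
  have -> : (cj z).2 - (cj z').2 = - (z.2 - z'.2) by rewrite /cj /=; ring.
  by rewrite normrN.
- move=> z z' /icj zr /icj zr'; have := sm_lip2 S zr zr'.
  have -> : (cj z).2 - (cj z').2 = - (z.2 - z'.2) by rewrite /cj /=; ring.
  by rewrite normrN -[X in X <= _ -> _]normrN opprB opprK addrC.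
- by move=> z /icj zr Oz; have [/= -> ->] := sm_off S zr Oz; rewrite oppr0.
- by move=> z /icj zr Oz; apply: rder_cj; exact: sm_der1 S _ zr Oz.
- move=> z /icj zr Oz; rewrite -[X in rder _ _ _ X]opprK; apply: rderN.
  by apply: rder_cj; exact: sm_der2 S _ zr Oz.
- by move=> z /icj zr Oz; exact: sm_a S _ zr Oz.
- by move=> z /icj zr Oz; rewrite normrN; exact: sm_b S _ zr Oz.
- move=> z /icj zr Oz; apply: continuous_comp; first exact: cj_continuous.
  exact: sm_ca S _ zr Oz.
- move=> z /icj zr Oz; apply: (@continuous_comp _ _ _ cj (fun w => - b w)).
    exact: cj_continuous.
  by apply: cvgN; exact: sm_cb S _ zr Oz.
Qed.

End sakai_reflection.

Section sakai_psi.
Variable R : realType.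
Implicit Types z v w : R * R.

Variables (T1 T2 a b : R * R -> R) (O : set (R * R)) (r c M L d : R).
Hypothesis S : sakai_map T1 T2 a b O r c M L.
Variable psi : R * R -> R * R.
Hypothesis psiP : forall w, inhalf d w ->
  [/\ insq r (psi w), T1 (psi w) = w.1, T2 (psi w) = w.2 & above T2 r (psi w)].

Lemma psi_lip w w' : inhalf d w -> inhalf d w' ->
  let D := (`|w.1 - w'.1| + `|w.2 - w'.2|) / sakai_modulus c M in
  `|(psi w).1 - (psi w').1| <= D /\ `|(psi w).2 - (psi w').2| <= D.
Proof.
move=> /psiP[i1 e1 e2 u1] /psiP[i1' e1' e2' u1'].
by have := sakai_inverse_lip S i1' i1 u1' u1; rewrite e1 e2 e1' e2'.
Qed.

Lemma psi_in w : inhalf d w -> 0 < w.2 -> O (psi w).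
Proof.
move=> /psiP[i1 _ e2 _] w2; apply: (sakai_pos_in S) => //.
by rewrite e2 gt_eqF.
Qed.

Definition psi_n w := a (psi w) ^+ 2 + b (psi w) ^+ 2.

Lemma psi_n_gt0 w : inhalf d w -> 0 < w.2 -> 0 < psi_n w.
Proof.
move=> wd w2; have [i1 _ _ _] := psiP wd; have := sm_a S i1 (psi_in wd w2).
have c0 := sm_c S; rewrite /psi_n => ca.
have : 0 < a (psi w) ^+ 2 by apply: exprn_gt0; slra.
have := sqr_ge0 (b (psi w)); slra.
Qed.

Lemma inhalf_near w : inhalf d w -> 0 < w.2 -> exists2 e : R, 0 < e &
  forall h k, `|h| < e -> `|k| < e -> inhalf d (w.1 + h, w.2 + k) /\ 0 < w.2 + k.
Proof.
move=> [w1 w2] w20; pose e := Num.min (d - `|w.1|) (Num.min w.2 (d - w.2)).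
exists e; first by rewrite /e !lt_min; slra.
move=> h k; rewrite /e !lt_min => /andP[h1 _] /and3P[_ k2 k3].
rewrite /inhalf /=; rewrite ltr_norml in k2; rewrite ltr_norml in k3.
split; last by slra.
split; last by slra.
by apply: le_lt_trans (ler_normD _ _) _; slra.
Qed.

Lemma psi_rder w : inhalf d w -> 0 < w.2 ->
  rder (fun w => (psi w).1) w (a (psi w) / psi_n w) (b (psi w) / psi_n w) /\
  rder (fun w => (psi w).2) w (- b (psi w) / psi_n w) (a (psi w) / psi_n w).
Proof.
move=> wd w2; have n0 := psi_n_gt0 wd w2; have Ow := psi_in wd w2.
have [i1 e1 e2 _] := psiP wd; have k0 := sakai_modulus_gt0 S.
have D1 := sm_der1 S i1 Ow; have D2 := sm_der2 S i1 Ow.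
have [e3 e30 near] := inhalf_near wd w2.
set A := a (psi w) in D1 D2 *; set B := b (psi w) in D1 D2 *; set n := psi_n w in n0 *.
have nE : n = A ^+ 2 + B ^+ 2 by [].
suff H (e : R) : 0 < e -> exists2 d : R, 0 < d & forall h k, `|h| < d -> `|k| < d ->
    `|(psi (w.1 + h, w.2 + k)).1 - (psi w).1 - (A / n * h + B / n * k)| <=
      e * (`|h| + `|k|) /\
    `|(psi (w.1 + h, w.2 + k)).2 - (psi w).2 - (- B / n * h + A / n * k)| <=
      e * (`|h| + `|k|).
  by split=> e /H[d' d'0 Hd]; exists d' => // h k hd kd; have [] := Hd h k hd kd.
move=> e0; pose Q : R := 2 * (`|A| + `|B| + 1) / n / sakai_modulus c M.
have AB0 : 0 < `|A| + `|B| + 1 by have := normr_ge0 A; have := normr_ge0 B; slra.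
have Q0 : 0 < Q by apply: divr_gt0 => //; apply: divr_gt0 => //; exact: mulr_gt0.
have eQ : 0 < e / Q by rewrite divr_gt0.
have [d1 d10 Hd1] := D1 _ eQ; have [d2 d20 Hd2] := D2 _ eQ.
pose m := Num.min d1 d2; have m0 : 0 < m by rewrite /m lt_min d10.
exists (Num.min e3 (m * sakai_modulus c M / 2)).
  by rewrite lt_min e30 divr_gt0// mulr_gt0.
move=> h k; rewrite !lt_min => /andP[h1 h2] /andP[k1 k2].
have [wd' w2'] := near h k h1 k1; have [i1' e1' e2' _] := psiP wd'.
have [/=] := psi_lip wd' wd.
have -> : w.1 + h - w.1 = h by ring.
have -> : w.2 + k - w.2 = k by ring.
set s := `|h| + `|k|; have s0 : 0 <= s by exact: addr_ge0.
set u := (psi (_, _)).1 - _; set v := (psi (_, _)).2 - _ => us vs.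
have sm : s / sakai_modulus c M < m by rewrite ltr_pdivrMr// /s; slra.
have um1 : `|u| < d1 by apply: (le_lt_trans us); apply: (lt_le_trans sm); rewrite /m ge_min lexx.
have vm1 : `|v| < d1 by apply: (le_lt_trans vs); apply: (lt_le_trans sm); rewrite /m ge_min lexx.
have um2 : `|u| < d2 by apply: (le_lt_trans us); apply: (lt_le_trans sm); rewrite /m ge_min lexx orbT.
have vm2 : `|v| < d2 by apply: (le_lt_trans vs); apply: (lt_le_trans sm); rewrite /m ge_min lexx orbT.
have := Hd1 u v um1 vm1; have := Hd2 u v um2 vm2.
have -> : ((psi w).1 + u, (psi w).2 + v) = psi (w.1 + h, w.2 + k).
  by rewrite /u /v !subrKC; case: (psi (_, _)).
rewrite e1 e2 e1' e2' /=.
have -> : w.1 + h - w.1 = h by ring.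
have -> : w.2 + k - w.2 = k by ring.
set x2 := k - _; set x1 := h - _ => H2 H1.
have E : e / Q * (`|u| + `|v|) <= e / Q * (2 * (s / sakai_modulus c M)).
  by apply: ler_wpM2l; [exact: ltW|slra].
have bound p q : `|p| + `|q| <= `|A| + `|B| -> `|(p * x1 + q * x2) / n| <= e * s.
  move=> pq; rewrite normrM normfV (gtr0_norm n0) ler_pdivrMr//.
  apply: le_trans (ler_normD _ _) _; rewrite !normrM.
  apply: (@le_trans _ _ ((`|A| + `|B| + 1) * (e / Q * (2 * (s / sakai_modulus c M))))); last first.
    rewrite le_eqVlt; apply/orP; left; apply/eqP; rewrite /Q; field.
    by rewrite !gt_eqF.
  have X1 := le_trans H1 E; have X2 := le_trans H2 E.
  set W := e / Q * (2 * _) in X1 X2 *.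
  have W0 : 0 <= W by exact: le_trans X1.
  have : `|p| * `|x1| <= `|p| * W by exact: ler_wpM2l.
  have : `|q| * `|x2| <= `|q| * W by exact: ler_wpM2l.
  have : (`|p| + `|q|) * W <= (`|A| + `|B|) * W by exact: ler_wpM2r.
  slra.
have uE : u - (A / n * h + B / n * k) = ((- A) * x1 + (- B) * x2) / n.
  by rewrite /x1 /x2 nE; field; rewrite -nE gt_eqF.
have vE : v - (- B / n * h + A / n * k) = (B * x1 + (- A) * x2) / n.
  by rewrite /x1 /x2 nE; field; rewrite -nE gt_eqF.
rewrite uE vE; split; apply: bound; rewrite !normrN; slra.
Qed.

End sakai_psi.

Section sakai_psi_continuous.
Variable R : realType.
Variables (T1 T2 a b : R * R -> R) (O : set (R * R)) (r c M L d : R).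
Hypothesis S : sakai_map T1 T2 a b O r c M L.
Variable psi : R * R -> R * R.
Hypothesis psiP : forall w, inhalf d w ->
  [/\ insq r (psi w), T1 (psi w) = w.1, T2 (psi w) = w.2 & above T2 r (psi w)].

Lemma psi_continuous w : inhalf d w -> 0 < w.2 -> {for w, continuous psi}.
Proof.
move=> wd w2; have [H1 H2] := psi_rder S psiP wd w2.
have -> : psi = fun w => ((psi w).1, (psi w).2) by apply/funext => u; case: (psi u).
have c1 : {for w, continuous (fun w => (psi w).1)} by exact: (rder_continuous H1).
have c2 : {for w, continuous (fun w => (psi w).2)} by exact: (rder_continuous H2).
exact: (cvg_pair c1 c2).
Qed.

Lemma psi_der_continuous w : inhalf d w -> 0 < w.2 ->
  {for w, continuous (fun w => a (psi w) / psi_n a b psi w)} /\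
  {for w, continuous (fun w => b (psi w) / psi_n a b psi w)}.
Proof.
move=> wd w2; have [i1 _ _ _] := psiP wd; have Ow := psi_in S psiP wd w2.
have ca : {for w, continuous (fun w => a (psi w))}.
  apply: (@continuous_comp _ _ _ psi a); first exact: psi_continuous.
  exact: (sm_ca S i1 Ow).
have cb : {for w, continuous (fun w => b (psi w))}.
  apply: (@continuous_comp _ _ _ psi b); first exact: psi_continuous.
  exact: (sm_cb S i1 Ow).
have cn : {for w, continuous (fun w => (psi_n a b psi w)^-1)}.
  apply: cvgV; first by rewrite gt_eqF// (psi_n_gt0 S psiP).
  have -> : psi_n a b psi = fun w => a (psi w) * a (psi w) + b (psi w) * b (psi w).
    by apply/funext => u; rewrite /psi_n !expr2.
  by apply: cvgD; apply: cvgM.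
by split; apply: cvgM.
Qed.

End sakai_psi_continuous.

Section sakai_axis.
Variable R : realType.
Variables (T1 T2 a b : R * R -> R) (O : set (R * R)) (r c M L : R).
Hypothesis S : sakai_map T1 T2 a b O r c M L.
Implicit Types z w : R * R.

Lemma sakai_between (x y y1 y2 : R) : `|x| < r -> `|y1| < r -> `|y2| < r ->
  T2 (x, y1) = 0 -> T2 (x, y2) = 0 -> y1 < y < y2 -> ~ O (x, y).
Proof.
move=> xr y1r y2r t1 t2 yy; have c0 : 0 < c by have := sm_c S; slra.
apply: (@sakai_diamond _ _ _ _ _ _ _ _ _ _ S (x, y1) (x, y2)) => //=.
- split=> //=; move: y1r y2r; rewrite !ltr_norml; slra.
- by rewrite subrr normr0 mulr0 mulr_gt0//; slra.
- by rewrite subrr normr0 mulr0 mulr_gt0//; slra.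
Qed.

Lemma sakai_same_abscissa z w : insq r z -> insq r w -> T1 z = T1 w -> T2 z = T2 w ->
  z.1 = w.1.
Proof.
move=> zr wr e1 e2; have := sakai_monotone S wr zr; rewrite e1 e2 !subrr !mul0r addr0.
have c0 : 0 < c by have := sm_c S; slra.
rewrite pmulr_rle0// => H; apply/eqP; rewrite -subr_eq0 -sqrf_eq0.
by rewrite eq_le H sqr_ge0.
Qed.

(* Both values sit over the same abscissa; if they differ, the vertical segment
   between them lies in the coincidence set, where [T1] is the abscissa. *)
Lemma sakai_axis z w s : insq r z -> insq r w -> T1 z = s -> T1 w = s ->
  T2 z = 0 -> T2 w = 0 -> z.1 = w.1 /\ (z.2 = w.2 \/ z.1 = s).
Proof.
move=> zr wr z1 w1 z2 w2.
have zw : z.1 = w.1 by apply: sakai_same_abscissa => //; rewrite ?z1 ?w1 ?z2 ?w2.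
split=> //; have [|ne] := eqVneq z.2 w.2; [by left|right].
have L0 := sm_L S.
apply/eqP; rewrite -subr_eq0 -normr_eq0 eq_le normr_ge0 andbT.
apply/ler_addgt0Pr => e e0; rewrite add0r.
pose t := Num.min (1 / 2) (e / (L * `|w.2 - z.2| + 1)).
have D0 : 0 < L * `|w.2 - z.2| + 1 by rewrite ltr_wpDl// mulr_ge0.
have t0 : 0 < t by rewrite /t lt_min !divr_gt0.
have t1 : t <= 1 / 2 by rewrite /t ge_min lexx.
have t2 : t * (L * `|w.2 - z.2| + 1) <= e by rewrite -ler_pdivlMr// /t ge_min lexx orbT.
pose y := z.2 + (w.2 - z.2) * t.
have yr : insq r (z.1, y).
  have /= := @insq_shiftv _ r z (0, w.2 - z.2) t zr; rewrite /shiftv /= mul0r addr0.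
  apply; last by slra.
  by rewrite subrKC zw; case: (w) wr.
have T2z : T2 (z.1, z.2) = 0 by rewrite -z2; case: (z).
have T2w : T2 (z.1, w.2) = 0 by rewrite -w2 zw; case: (w).
have nO : ~ O (z.1, y).
  move: ne; rewrite neq_lt => /orP[lt|lt].
    apply: (sakai_between zr.1 zr.2 wr.2 T2z T2w).
    have P0 : 0 < (w.2 - z.2) * t by apply: mulr_gt0 => //; slra.
    have P1 : (w.2 - z.2) * t <= (w.2 - z.2) * (1 / 2) by apply: ler_wpM2l => //; slra.
    by rewrite /y; slra.
  apply: (sakai_between zr.1 wr.2 zr.2 T2w T2z).
  have P0 : 0 < (z.2 - w.2) * t by apply: mulr_gt0 => //; slra.
  have P1 : (z.2 - w.2) * t <= (z.2 - w.2) * (1 / 2) by apply: ler_wpM2l => //; slra.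
  by rewrite /y; slra.
have [T1y _] := sm_off S yr nO.
have := sm_lip1 S yr zr; rewrite T1y z1 /= subrr normr0 add0r => /le_trans; apply.
rewrite /y addrAC subrr add0r normrM (gtr0_norm t0).
by have := ltW t0; slra.
Qed.

End sakai_axis.

Section sakai_local.
Variable R : realType.
Variables (T1 T2 a b : R * R -> R) (O : set (R * R)) (r c M L : R).
Hypothesis S : sakai_map T1 T2 a b O r c M L.
Hypothesis off0 : ~ O (0, 0).
Hypothesis vert0 : forall y : R, `|y| < r -> y != 0 -> O (0, y).
Hypothesis acc : forall e : R, 0 < e -> exists p : R * R, [/\ insq e p, p != (0, 0), ~ O p &
  forall y, `|y| < r -> y != p.2 -> O (p.1, y)].
Implicit Types z w : R * R.

Let S' := sakai_conj S.

Lemma psi_exists T1' T2' a' b' O' : sakai_map T1' T2' a' b' O' r c M L ->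
  ~ O' (0, 0) -> (forall y : R, `|y| < r -> y != 0 -> O' (0, y)) ->
  exists2 d : R, 0 < d & exists psi : R * R -> R * R, forall w, inhalf d w ->
  [/\ insq r (psi w), T1' (psi w) = w.1, T2' (psi w) = w.2 & above T2' r (psi w)].
Proof.
move=> S0 o0 v0; have [d d0 Hd] := sakai_exists S0 o0 v0; exists d => //.
have /choice[psi Hpsi] (w : R * R) : exists z, inhalf d w ->
  [/\ insq r z, T1' z = w.1, T2' z = w.2 & above T2' r z].
  have [[w1 w2]|nw] := pselect (inhalf d w); last by exists w.
  by have [z Hz] := Hd _ _ w1 w2; exists z.
by exists psi.
Qed.

Lemma sakai_local : exists2 e : R, 0 < e & forall x y y' : R,
  `|x| < e -> `|y| < r -> `|y'| < r -> y != y' -> O (x, y) \/ O (x, y').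
Proof.
have r0 := sm_r S; have k0 := sakai_modulus_gt0 S; have L0 := sm_L S.
have [d1 d10 [psi1 psiP1]] := psi_exists S off0 vert0.
have [||d2 d20 [phi1 phiP1]] := psi_exists S'.
- by rewrite /= /cj /= oppr0.
- by move=> y yr y0; apply: vert0; rewrite ?normrN// oppr_eq0.
pose d := Num.min d1 d2.
have d0 : 0 < d by rewrite /d lt_min d10.
have [psi psiP] : exists psi : R * R -> R * R, forall w, inhalf d w ->
    [/\ insq r (psi w), T1 (psi w) = w.1, T2 (psi w) = w.2 & above T2 r (psi w)].
  exists psi1 => w [w1 /andP[w2 w3]]; apply: psiP1; move: w1 w3; rewrite /d !lt_min.
  by move=> /andP[w1 _] /andP[w3 _]; split=> //; rewrite w2.
have [phi phiP] : exists phi : R * R -> R * R, forall w, inhalf d w ->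
    [/\ insq r (phi w), T1 (cj (phi w)) = w.1, - T2 (cj (phi w)) = w.2 &
     above (fun z => - T2 (cj z)) r (phi w)].
  exists phi1 => w [w1 /andP[w2 w3]]; apply: phiP1; move: w1 w3; rewrite /d !lt_min.
  by move=> /andP[_ w1] /andP[_ w3]; split=> //; rewrite w2.
clear psi1 psiP1 phi1 phiP1; clearbody d.
pose E1 w := (psi w).1 + (phi w).1 + (-2 * w.1 + 0 * w.2 + 0).
pose E2 w := (psi w).2 + (phi w).2 + (0 * w.1 + (-2) * w.2 + 0).
have axisP s : `|s| < d -> exists x y y' : R, [/\ psi (s, 0) = (x, y),
    cj (phi (s, 0)) = (x, y'), T2 (x, y) = 0, T2 (x, y') = 0 & y = y' \/ x = s].
  move=> sd; have wd : inhalf d (s, 0) by split=> //=; rewrite lexx.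
  have [i1 e1 e2 _] := psiP _ wd; have [i2 f1 f2 _] := phiP _ wd.
  move/insq_cj in i2; move/eqP: f2; rewrite oppr_eq0 => /eqP f2.
  have [xx yy] := sakai_axis S i1 i2 e1 f1 e2 f2.
  exists (psi (s, 0)).1, (psi (s, 0)).2, (cj (phi (s, 0))).2; split=> //.
  - by case: (psi _).
  - by rewrite xx; case: (cj _).
  - by rewrite -surjective_pairing.
  - by rewrite xx -surjective_pairing.
pose e1 w := a (psi w) / psi_n a b psi w +
  a (cj (phi w)) / psi_n (a \o @cj R) (fun z => - b (cj z)) phi w - 2.
pose e2 w := - (b (psi w) / psi_n a b psi w) -
  - b (cj (phi w)) / psi_n (a \o @cj R) (fun z => - b (cj z)) phi w.
have dE w : inhalf d w -> 0 < w.2 -> rder E1 w (e1 w) (- e2 w) /\ rder E2 w (e2 w) (e1 w).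
  move=> wd w2; have [p1 p2] := psi_rder S psiP wd w2.
  have [q1 q2] := psi_rder S' phiP wd w2.
  have l1 := rder_lin (-2) 0 0 w; have l2 := rder_lin 0 (-2) 0 w.
  have := rderD (rderD p1 q1) l1; have := rderD (rderD p2 q2) l2.
  rewrite /e1 /e2 /= !mulNr !opprK addr0 => X2 X1; split.
    by move: X1; congr rder; ring.
  by move: X2; congr rder; ring.
have ce w : inhalf d w -> 0 < w.2 -> {for w, continuous e1} /\ {for w, continuous e2}.
  move=> wd w2; have [p1 p2] := psi_der_continuous S psiP wd w2.
  have [q1 q2] := psi_der_continuous S' phiP wd w2; split.
    by apply: cvgB; [apply: cvgD|exact: cvg_cst].
  by apply: cvgB => //; apply: cvgN.
pose K := 2 / sakai_modulus c M + 2.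
have K0 : 0 <= K by rewrite /K addr_ge0// divr_ge0// ltW.
have lipE w w' : inhalf d w -> inhalf d w' ->
    `|E1 w - E1 w'| <= K * (`|w.1 - w'.1| + `|w.2 - w'.2|) /\
    `|E2 w - E2 w'| <= K * (`|w.1 - w'.1| + `|w.2 - w'.2|).
  move=> wd wd'; have [p1 p2] := psi_lip S psiP wd wd'.
  have [q1 q2] := psi_lip S' phiP wd wd'.
  set n := `|w.1 - w'.1| + `|w.2 - w'.2| in p1 p2 q1 q2 *.
  have n1 : `|w.1 - w'.1| <= n by rewrite /n lerDl.
  have n2 : `|w.2 - w'.2| <= n by rewrite /n lerDr.
  have -> : K * n = n / sakai_modulus c M + n / sakai_modulus c M + 2 * n by rewrite /K; ring.
  split.
    have -> : E1 w - E1 w' = ((psi w).1 - (psi w').1) + ((phi w).1 - (phi w').1)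
      - 2 * (w.1 - w'.1) by rewrite /E1; ring.
    apply: le_trans (ler_normB _ _) _; rewrite normrM (ger0_norm (_ : 0 <= 2))//.
    have := ler_normD ((psi w).1 - (psi w').1) ((phi w).1 - (phi w').1); slra.
  have -> : E2 w - E2 w' = ((psi w).2 - (psi w').2) + ((phi w).2 - (phi w').2)
    - 2 * (w.2 - w'.2) by rewrite /E2; ring.
  apply: le_trans (ler_normB _ _) _; rewrite normrM (ger0_norm (_ : 0 <= 2))//.
  have := ler_normD ((psi w).2 - (psi w').2) ((phi w).2 - (phi w').2); slra.
pose B := 2 * r + 2 * d.
have B0 : 0 <= B by rewrite /B; slra.
have EB w : inhalf d w -> `|E1 w| <= B /\ `|E2 w| <= B.
  move=> wd; have [[i1 i2] _ _ _] := psiP _ wd; have [[j1 j2] _ _ _] := phiP _ wd.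
  move: wd i1 i2 j1 j2; rewrite /inhalf /E1 /E2 /B !ltr_norml !ler_norml => wd.
  by split; slra.
have prod (x y x' y' D : R) : `|x| <= B -> `|y'| <= B -> `|x - x'| <= D ->
    `|y - y'| <= D -> `|x * y - x' * y'| <= 2 * B * D.
  move=> xB yB xD yD.
  have -> : x * y - x' * y' = x * (y - y') + (x - x') * y' by ring.
  apply: le_trans (ler_normD _ _) _; rewrite !normrM.
  have : `|x| * `|y - y'| <= B * D by exact: ler_pM.
  have : `|x - x'| * `|y'| <= D * B by exact: ler_pM.
  slra.
pose F1 w := E1 w * E1 w + - (E2 w * E2 w).
pose F2 w := E1 w * E2 w + E1 w * E2 w.
pose D1 w := (e1 w * E1 w + E1 w * e1 w) - (e2 w * E2 w + E2 w * e2 w).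
pose D2 w := (e1 w * E2 w + E1 w * e2 w) + (e1 w * E2 w + E1 w * e2 w).
have lipF w w' : inhalf d w -> inhalf d w' ->
    `|F1 w - F1 w'| <= 4 * B * K * (`|w.1 - w'.1| + `|w.2 - w'.2|) /\
    `|F2 w - F2 w'| <= 4 * B * K * (`|w.1 - w'.1| + `|w.2 - w'.2|).
  move=> wd wd'; have [p1 p2] := lipE _ _ wd wd'.
  have [b1 b2] := EB _ wd; have [b1' b2'] := EB _ wd'.
  set n := `|w.1 - w'.1| + `|w.2 - w'.2| in p1 p2 *.
  have -> : 4 * B * K * n = 2 * B * (K * n) + 2 * B * (K * n) by ring.
  have h11 := prod _ _ _ _ _ b1 b1' p1 p1; have h22 := prod _ _ _ _ _ b2 b2' p2 p2.
  have h12 := prod _ _ _ _ _ b1 b2' p1 p2; split.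
    have -> : F1 w - F1 w' = (E1 w * E1 w - E1 w' * E1 w') -
      (E2 w * E2 w - E2 w' * E2 w') by rewrite /F1; ring.
    by apply: le_trans (ler_normB _ _) _; exact: lerD.
  have -> : F2 w - F2 w' = (E1 w * E2 w - E1 w' * E2 w') +
      (E1 w * E2 w - E1 w' * E2 w') by rewrite /F2; ring.
  by apply: le_trans (ler_normD _ _) _; exact: lerD.
have dF1 w : inhalf d w -> 0 < w.2 -> rder F1 w (D1 w) (- D2 w).
  move=> wd w2; have [h1 h2] := dE _ wd w2.
  have := rderD (rderM h1 h1) (rderN (rderM h2 h2)); congr rder; rewrite /D1 /D2; ring.
have dF2 w : inhalf d w -> 0 < w.2 -> rder F2 w (D2 w) (D1 w).
  move=> wd w2; have [h1 h2] := dE _ wd w2.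
  have := rderD (rderM h1 h2) (rderM h1 h2); congr rder; rewrite /D1 /D2; ring.
have cE w : inhalf d w -> 0 < w.2 -> {for w, continuous E1} /\ {for w, continuous E2}.
  by move=> wd w2; have [h1 h2] := dE _ wd w2; split; [exact: rder_continuous h1|
    exact: rder_continuous h2].
have cD1 w : inhalf d w -> 0 < w.2 -> {for w, continuous D1}.
  move=> wd w2; have [h1 h2] := cE _ wd w2; have [g1 g2] := ce _ wd w2.
  by apply: cvgB; apply: cvgD; apply: cvgM.
have cD2 w : inhalf d w -> 0 < w.2 -> {for w, continuous D2}.
  move=> wd w2; have [h1 h2] := cE _ wd w2; have [g1 g2] := ce _ wd w2.
  by apply: cvgD; apply: cvgD; apply: cvgM.
have axis s : `|s| < d -> F2 (s, 0) = 0.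
  move=> /axisP[x [y [y' [ep ef _ _]]]].
  have ef' : phi (s, 0) = (x, - y') by rewrite -[LHS]cjK ef.
  rewrite /F2 /E1 /E2 ep ef' /=.
  by case=> ->; ring.
have KK : 0 <= 4 * B * K by rewrite !mulr_ge0.
have zeros (e : R) : 0 < e -> exists2 t : R, 0 < `|t| < e & F1 (t, 0) = 0.
  move=> e0; have m0 : 0 < Num.min e (Num.min d r) by rewrite !lt_min e0 d0.
  have [p [[p1 p2] p0 nOp vp]] := acc m0.
  move: p1 p2; rewrite !lt_min => /and3P[p1e p1d p1r] /and3P[_ _ p2r].
  have pr : insq r p by [].
  have x0 : p.1 != 0.
    apply/eqP => x0; apply: nOp; rewrite (_ : p = (0, p.2)); last by rewrite -x0; case: (p).
    apply: vert0 => //; apply: contra p0 => /eqP y0.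
    by rewrite (surjective_pairing p) x0 y0.
  exists p.1; first by rewrite normr_gt0 x0.
  have [T1p T2p] := sm_off S pr nOp.
  have uniq (y : R) : `|y| < r -> T1 (p.1, y) = p.1 -> T2 (p.1, y) = 0 -> y = p.2.
    move=> yr t1 t2; apply/eqP; apply/negP => /negP ne.
    have T2p' : T2 (p.1, p.2) = 0 by rewrite -T2p; case: (p).
    have mid : `|(y + p.2) / 2| < r by move: yr p2r; rewrite !ltr_norml; slra.
    have Om : O (p.1, (y + p.2) / 2).
      apply: vp => //; apply: contra ne => /eqP H; apply/eqP; slra.
    move: ne; rewrite neq_lt => /orP[lt|lt].
      by apply: (sakai_between S p1r yr p2r t2 T2p' _ Om); slra.
    by apply: (sakai_between S p1r p2r yr T2p' t2 _ Om); slra.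
  have wd : inhalf d (p.1, 0) by split=> //=; rewrite lexx.
  have [i1 f1 f2 _] := psiP _ wd; have [i2 g1 g2 _] := phiP _ wd.
  move/insq_cj in i2; move/eqP: g2; rewrite oppr_eq0 => /eqP g2.
  have pairE (z : R * R) x : z.1 = x -> z = (x, z.2) by case: z => ? ? /= ->.
  have x1 : (psi (p.1, 0)).1 = p.1.
    by apply: (sakai_same_abscissa S) => //; rewrite ?f1 ?T1p ?f2 ?T2p.
  have x2 : (cj (phi (p.1, 0))).1 = p.1.
    by apply: (sakai_same_abscissa S) => //; rewrite ?g1 ?T1p ?g2 ?T2p.
  have y1 : (psi (p.1, 0)).2 = p.2.
    by apply: uniq; [exact: i1.2|rewrite -(pairE _ _ x1)..].
  have y2 : (cj (phi (p.1, 0))).2 = p.2.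
    by apply: uniq; [exact: i2.2|rewrite -(pairE _ _ x2)..].
  have y2' : (phi (p.1, 0)).2 = - p.2 by rewrite -y2 /cj /= opprK.
  rewrite /F1 /E1 /E2 x1 y1 y2' -[(phi _).1]/((cj (phi (p.1, 0))).1) x2 /=; ring.
have H1 w w' : inhalf d w -> inhalf d w' ->
  `|F1 w - F1 w'| <= 4 * B * K * (`|w.1 - w'.1| + `|w.2 - w'.2|).
  by move=> wd wd'; have [] := lipF _ _ wd wd'.
have H2 w w' : inhalf d w -> inhalf d w' ->
  `|F2 w - F2 w'| <= 4 * B * K * (`|w.1 - w'.1| + `|w.2 - w'.2|).
  by move=> wd wd'; have [] := lipF _ _ wd wd'.
have F0 := half_plane_identity d0 KK H1 H2 dF1 dF2 cD1 cD2 axis zeros.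
exists (Num.min r (d / 4)); first by rewrite lt_min r0 divr_gt0.
move=> x y y'; rewrite lt_min => /andP[xr xd] yr y'r ne.
have xd' : `|x| < d by apply: (lt_trans xd); slra.
have [x1 [Y [Y' [ep ef T2Y T2Y' alt]]]] := axisP _ xd'.
have ef' : phi (x, 0) = (x1, - Y') by rewrite -[LHS]cjK ef.
have := F0 _ (ltW xd); rewrite /F1 /E1 /E2 ep ef' /= => F00.
have [xe ye] : x1 = x /\ Y = Y'.
  case: alt => ye; split=> //; apply/eqP; rewrite -subr_eq0 -sqrf_eq0; apply/eqP.
    by move: F00; rewrite ye; slra.
  by move: F00; rewrite ye; slra.
subst x1 Y'.
have wd : inhalf d (x, 0) by split=> //=; rewrite lexx.
have [_ _ _ up] := psiP _ wd; have [_ _ _ dn] := phiP _ wd.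
rewrite ep /= in up; rewrite ef' in dn.
have out t : `|t| < r -> t != Y -> O (x, t).
  move=> tr; rewrite neq_lt => /orP[lt|lt]; apply: (sakai_pos_in S) => //.
    have := dn (Y - t) ltac:(slra).
    rewrite /cj /= (_ : - Y + (Y - t) = - t); last by ring.
    rewrite opprK oppr_gt0 => H; rewrite lt_eqF// H// /insq /= normrN.
    by split.
  have := up (t - Y) ltac:(slra); rewrite /= subrKC => H; rewrite gt_eqF// H//.
have [yY|yY] := eqVneq y Y; last by left; exact: out.
by right; apply: out => //; rewrite -yY eq_sym.
Qed.

End sakai_local.

(** * Density *)

Section plane_measure.
Variable R : realType.
Local Notation mR := (measurableTypeR R).

Lemma open_plane_measurable (A : set (R * R)) :
  open A -> measurable (A : set (mR * mR)).
Proof.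
move=> oA.
pose box (q : rat * rat * rat) : set (mR * mR) :=
  `]ratr q.1.1 - ratr q.2, ratr q.1.1 + ratr q.2[%classic `*`
  `]ratr q.1.2 - ratr q.2, ratr q.1.2 + ratr q.2[%classic.
pose F q : set (mR * mR) := if `[< box q `<=` A >] then box q else set0.
have -> : A = \bigcup_q F q.
  apply/seteqP; split=> [z Az|z [q _]]; last first.
    by rewrite /F; case: asboolP => // + zb; apply.
  have /nbhs_ballP[d /= d0 dA] : nbhs z A by exact: open_nbhs_nbhs.
  have [e] := rat_in_itvoo (divr_gt0 d0 (ltr0n R 2)); rewrite in_itv/= => /andP[e0 ed].
  have [p] := @rat_in_itvoo R (z.1 - ratr e) (z.1 + ratr e) ltac:(slra).
  have [q] := @rat_in_itvoo R (z.2 - ratr e) (z.2 + ratr e) ltac:(slra).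
  rewrite !in_itv/= => qz pz; exists (p, q, e) => //; rewrite /F.
  case: asboolP => [_|nA].
    by split; rewrite /= in_itv/=; slra.
  exfalso; apply: nA => w [] /=; rewrite !in_itv/= => w1 w2; apply: dA.
  by split; rewrite /ball/= ltr_norml; slra.
apply: countable_bigcupT_measurable => [|q]; first exact: countableP.
by rewrite /F; case: asboolP => // _; exact: measurableX.
Qed.

Lemma leb2_box (a b c d : R) : a < b -> c < d ->
  leb2 (`]a, b[%classic `*` `]c, d[%classic) = ((b - a) * (d - c))%:E.
Proof.
have E (p q : R) : p < q -> lebesgue_measure `]p, q[%classic = (q - p)%:E.
  by move=> pq; rewrite lebesgue_measure_itv/= lte_fin pq EFinB.
move=> ab cd; rewrite /leb2 EFinM; etransitivity; first exact: product_measure1E.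
by congr (_ * _)%E; exact: E.
Qed.

Lemma edisc_open (x : R * R) (r : R) : open (edisc x r).
Proof.
have -> : edisc x r = Defs.edist x @^-1` [set t | t < r] by [].
apply: open_comp; last exact: open_lt.
move=> z _; apply: (@continuous_comp _ _ _
  (fun y => (x.1 - y.1) * (x.1 - y.1) + (x.2 - y.2) * (x.2 - y.2)) Num.sqrt).
  by apply: cvgD; apply: cvgM; (apply: cvgB; [exact: cvg_cst|]);
    (exact: cvg_fst || exact: cvg_snd).
exact: sqrt_continuous.
Qed.

Lemma edist_le (x y : R * R) : Defs.edist x y <= `|x.1 - y.1| + `|x.2 - y.2|.
Proof.
rewrite /Defs.edist -[leRHS]ger0_norm ?addr_ge0// -sqrtr_sqr ler_wsqrtr//.
rewrite -(real_normK (num_real (x.1 - y.1))) -(real_normK (num_real (x.2 - y.2))).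
by rewrite sqrrD addrAC lerDl mulrn_wge0// mulr_ge0.
Qed.

Lemma edist_ge (x y : R * R) : `|x.1 - y.1| <= Defs.edist x y /\ `|x.2 - y.2| <= Defs.edist x y.
Proof.
by rewrite /Defs.edist -!sqrtr_sqr; split; rewrite ler_wsqrtr// ?lerDl ?lerDr sqr_ge0.
Qed.

Lemma density_one_no_cone (A : set (R * R)) (x v : R * R) (rho : R) :
  open A -> 0 < rho ->
  (forall t w, 0 < t <= 1 -> `|w.1 - (x.1 + t * v.1)| < t * rho ->
    `|w.2 - (x.2 + t * v.2)| < t * rho -> ~ A w) ->
  ~ density_one A x.
Proof.
move=> oA rho0 cone dens.
pose W := `|v.1| + `|v.2| + 2 * rho + 1.
have W0 : 0 < W by rewrite /W; have := normr_ge0 v.1; have := normr_ge0 v.2; slra.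
pose m : {measure set (mR * mR) -> \bar R} := (lebesgue_measure \x lebesgue_measure)%E.
have key (q : R) : 0 < q -> q < W ->
    fine (leb2 (edisc x q `&` A)) / fine (leb2 (edisc x q)) <= 1 - rho ^+ 2 / W ^+ 2.
  move=> q0 qW; pose t := q / W.
  have t0 : 0 < t by rewrite /t divr_gt0.
  have t1 : t <= 1 by rewrite /t ler_pdivrMr// mul1r ltW.
  have tW : t * W = q by rewrite /t divfK// gt_eqF.
  pose sq := `]x.1 + t * v.1 - t * rho, x.1 + t * v.1 + t * rho[%classic `*`
    `]x.2 + t * v.2 - t * rho, x.2 + t * v.2 + t * rho[%classic.
  pose bx := `]x.1 - q, x.1 + q[%classic `*` `]x.2 - q, x.2 + q[%classic.
  have tr : 0 < t * rho by exact: mulr_gt0.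
  have sqE w : sq w -> `|w.1 - (x.1 + t * v.1)| < t * rho /\
      `|w.2 - (x.2 + t * v.2)| < t * rho.
    by case; rewrite /= !in_itv/= !ltr_norml; slra.
  have sqD : sq `<=` edisc x q.
    move=> w /sqE[w1 w2]; apply: le_lt_trans (edist_le _ _) _.
    have e1 : `|x.1 - w.1| <= t * `|v.1| + t * rho.
      rewrite distrC (_ : w.1 - x.1 = (w.1 - (x.1 + t * v.1)) + t * v.1); last by ring.
      apply: le_trans (ler_normD _ _) _; rewrite [`|t * _|]normrM (gtr0_norm t0); slra.
    have e2 : `|x.2 - w.2| <= t * `|v.2| + t * rho.
      rewrite distrC (_ : w.2 - x.2 = (w.2 - (x.2 + t * v.2)) + t * v.2); last by ring.
      apply: le_trans (ler_normD _ _) _; rewrite [`|t * _|]normrM (gtr0_norm t0); slra.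
    by rewrite -tW /W !mulrDr; slra.
  have Dbx : edisc x q `<=` bx.
    move=> w; rewrite /edisc /= => wq; have [w1 w2] := edist_ge x w.
    have {}w1 := le_lt_trans w1 wq; have {}w2 := le_lt_trans w2 wq.
    by move: w1 w2; rewrite !ltr_norml => w1 w2; split; rewrite /= in_itv/=; slra.
  have mD : measurable (edisc x q : set (mR * mR)).
    by apply: open_plane_measurable; exact: edisc_open.
  have mDA : measurable (edisc x q `&` A : set (mR * mR)).
    by apply: open_plane_measurable; apply: openI => //; exact: edisc_open.
  have msq : measurable (sq : set (mR * mR)) by exact: measurableX.
  have mbx : measurable (bx : set (mR * mR)) by exact: measurableX.
  have Ebx : m bx = (4 * q ^+ 2)%:E.
    by rewrite -[LHS]/(leb2 bx) leb2_box; [congr EFin; ring|slra|slra].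
  have Esq : m sq = (4 * (t * rho) ^+ 2)%:E.
    by rewrite -[LHS]/(leb2 sq) leb2_box; [congr EFin; ring|slra|slra].
  have leD : (m (edisc x q) <= (4 * q ^+ 2)%:E)%E by rewrite -Ebx le_measure ?inE.
  have split : (m (edisc x q `&` A) + m sq <= m (edisc x q))%E.
    rewrite -measureU//; last first.
      by apply/seteqP; split=> // w [[_ Aw] /sqE[w1 w2]]; apply: (cone t w) => //; rewrite t0.
    apply: le_measure; rewrite ?inE//; first exact: measurableU.
    by move=> w [[]|/sqD].
  have D0 : (m sq <= m (edisc x q))%E by rewrite le_measure ?inE.
  have finD : m (edisc x q) \is a fin_num.
    by rewrite ge0_fin_numE ?measure_ge0// (le_lt_trans leD)// ltry.
  have leDA : (m (edisc x q `&` A) <= m (edisc x q))%E.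
    by rewrite le_measure ?inE//; exact: subIsetl.
  have finDA : m (edisc x q `&` A) \is a fin_num.
    by rewrite ge0_fin_numE ?measure_ge0// (le_lt_trans leDA)// ltey_eq finD.
  rewrite /leb2 -/m; move: split leD D0; rewrite Esq -(fineK finD) -(fineK finDA).
  rewrite -EFinD !lee_fin.
  set D := fine (m (edisc x q)); set DA := fine (m _) => H1 H2 H3.
  have s0 : 0 < (t * rho) ^+ 2 by exact: exprn_gt0.
  have D1 : 0 < D by apply: lt_le_trans H3; slra.
  rewrite -[leLHS]/(DA / D) ler_pdivrMr// mulrBl mul1r.
  have : rho ^+ 2 / W ^+ 2 * D <= 4 * (t * rho) ^+ 2; last by slra.
  have -> : 4 * (t * rho) ^+ 2 = rho ^+ 2 / W ^+ 2 * (4 * q ^+ 2).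
    by rewrite /t; field; rewrite gt_eqF.
  by apply: ler_wpM2l => //; rewrite divr_ge0// exprn_ge0// ltW.
have e0 : 0 < rho ^+ 2 / W ^+ 2 by rewrite divr_gt0// exprn_gt0.
have /cvgrPdist_lt/(_ _ e0) near1 := dens.
near (0 : R)^'+ => q.
have q0 : 0 < q by near: q; exact: nbhs_right_gt.
have qW : q < W by near: q; exact: nbhs_right_lt.
have : `|1 - fine (leb2 (edisc x q `&` A)) / fine (leb2 (edisc x q))| < rho ^+ 2 / W ^+ 2.
  by near: q.
by have := key q q0 qW; move: (_ / _) => z; rewrite ltr_norml; slra.
Unshelve. all: by end_near. Qed.

End plane_measure.

(** * Isolation of branching points *)

Section sakai_isolated.
Variable R : realType.

Definition cone_free (O : set (R * R)) (w : R * R) := forall (v : R * R) (rho : R), 0 < rho ->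
  ~ (forall t w', 0 < t <= 1 -> `|w'.1 - (w.1 + t * v.1)| < t * rho ->
    `|w'.2 - (w.2 + t * v.2)| < t * rho -> ~ O w').

Variables (T1 T2 a b : R * R -> R) (O : set (R * R)) (r c M L : R).
Hypothesis S : sakai_map T1 T2 a b O r c M L.

Let c0 : 0 < c. Proof. by have := sm_c S; slra. Qed.
Let M0 : 0 <= M. Proof. exact: sm_M S. Qed.

Lemma off_diamond (x y1 y2 : R) (w : R * R) : `|x| < r -> `|y1| < r -> `|y2| < r ->
  ~ O (x, y1) -> ~ O (x, y2) -> `|w.1| < r ->
  M * `|w.1 - x| < c * (w.2 - y1) -> M * `|w.1 - x| < c * (y2 - w.2) -> ~ O w.
Proof.
move=> xr y1r y2r n1 n2 wr s1 s2.
have i1 : insq r (x, y1) by []. have i2 : insq r (x, y2) by [].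
have [_ t1] := sm_off S i1 n1; have [_ t2] := sm_off S i2 n2.
have p : 0 <= M * `|w.1 - x| by exact: mulr_ge0.
have q1 : y1 < w.2 by rewrite -subr_gt0 -(pmulr_rgt0 _ c0); exact: le_lt_trans s1.
have q2 : w.2 < y2 by rewrite -subr_gt0 -(pmulr_rgt0 _ c0); exact: le_lt_trans s2.
apply: (sakai_diamond S i1 i2 _ t1 t2) => //=; last by rewrite distrC.
by split=> //; move: y1r y2r; rewrite !ltr_norml; slra.
Qed.

Lemma cone_free_vertical (w : R * R) : insq r w -> ~ O w -> cone_free O w ->
  forall y, `|y| < r -> y != w.2 -> O (w.1, y).
Proof.
move=> [w1 w2] nOw cf y yr yw; apply: contrapT => nOy.
have nOw' : ~ O (w.1, w.2) by rewrite -surjective_pairing.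
pose h := (y - w.2) / 2.
have h0 : 0 < `|h| by rewrite normr_gt0 /h mulf_neq0// ?invr_eq0 ?pnatr_eq0// subr_eq0.
pose rho := Num.min (r - `|w.1|) (c * `|h| / (M + c + 1)).
have D0 : 0 < M + c + 1 by move: c0 M0; slra.
have rho0 : 0 < rho by rewrite /rho lt_min subr_gt0 w1 divr_gt0// mulr_gt0.
have rho1 : rho <= r - `|w.1| by rewrite /rho ge_min lexx.
have rho2 : rho * (M + c + 1) <= c * `|h|.
  by rewrite -ler_pdivlMr// /rho ge_min lexx orbT.
apply: (cf (0, h) rho rho0) => t w' t01 /=.
rewrite mulr0 addr0 => d1 d2.
have tr : t * rho <= rho by apply: ler_piMl; [exact: ltW|slra].
have w1r : `|w'.1| < r.
  rewrite (_ : w'.1 = (w'.1 - w.1) + w.1); last by ring.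
  by apply: le_lt_trans (ler_normD _ _) _; slra.
have st : M * `|w'.1 - w.1| < c * (t * `|h| - t * rho).
  apply: (@le_lt_trans _ _ (M * (t * rho))).
    by apply: ler_wpM2l => //; exact: ltW.
  have : 0 < t * rho by apply: mulr_gt0 => //; slra.
  have : t * (rho * (M + c + 1)) <= t * (c * `|h|) by apply: ler_wpM2l => //; slra.
  slra.
have th : t * `|h| <= `|h| by apply: ler_piMl => //; slra.
have cc (p q : R) : p <= q -> c * p <= c * q by move=> pq; rewrite ler_pM2l.
move: yw; rewrite neq_lt => /orP[lt|lt].
  have hE : `|h| = - h by rewrite ltr0_norm// /h; slra.
  move: d2; rewrite ltr_norml => /andP[d2 d3].
  apply: (@off_diamond w.1 y w.2 w') => //; apply: (lt_le_trans st); apply: cc.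
    by move: th; rewrite hE; rewrite /h in d2 d3 *; slra.
  by rewrite hE; slra.
have hE : `|h| = h by rewrite gtr0_norm// /h; slra.
move: d2; rewrite ltr_norml => /andP[d2 d3].
apply: (@off_diamond w.1 w.2 y w') => //; apply: (lt_le_trans st); apply: cc.
  by rewrite hE; slra.
by move: th; rewrite hE; rewrite /h in d2 d3 *; slra.
Qed.

Lemma sakai_isolated : ~ O (0, 0) ->
  (forall e : R, 0 < e -> exists p : R * R, [/\ insq e p, p != (0, 0), ~ O p & cone_free O p]) ->
  (forall e : R, 0 < e -> exists2 p : R * R, insq e p & exists2 h : R, 0 < h &
    forall p', `|p'.1 - p.1| < h -> `|p'.2 - p.2| < h -> ~ O p') ->
  False.
Proof.
move=> off0 acc int; have r0 := sm_r S.
have acc' (e : R) : 0 < e -> exists p : R * R, [/\ insq e p, p != (0, 0), ~ O p &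
    forall y, `|y| < r -> y != p.2 -> O (p.1, y)].
  move=> e0; have [|p [[p1 p2] p0 nOp cf]] := acc (Num.min e r); first by rewrite lt_min e0.
  move: p1 p2; rewrite !lt_min => /andP[p1e p1r] /andP[p2e p2r].
  by exists p; split=> //; exact: cone_free_vertical.
have vert0 (y : R) : `|y| < r -> y != 0 -> O (0, y).
  move=> yr y0; apply: contrapT => nOy.
  have m0 : 0 < c * `|y| / (4 * (M + 1)).
    by rewrite divr_gt0 ?mulr_gt0 ?normr_gt0//; move: M0; slra.
  have [|p [[p1 _] _ _ vp]] := acc' (Num.min r (c * `|y| / (4 * (M + 1)))).
    by rewrite lt_min r0.
  move: p1; rewrite lt_min => /andP[p1r]; rewrite ltr_pdivlMr; last by move: M0; slra.
  move=> p1c.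
  have st : M * `|p.1 - 0| < c * (`|y| / 3).
    rewrite subr0; have := mulr_ge0 M0 (normr_ge0 p.1); have := normr_ge0 p.1.
    have : 0 < c * `|y| by rewrite mulr_gt0// normr_gt0.
    by move: p1c; slra.
  have y3 (k : R) : 1 / 3 <= k <= 2 / 3 -> ~ O (p.1, k * y).
    move=> k3; have n0 : `|0 : R| < r by rewrite normr0.
    have [yp|yn] := ltP 0 y.
      have yE : `|y| = y by rewrite gtr0_norm.
      apply: (@off_diamond 0 0 y) => //=; apply: (lt_le_trans st);
        rewrite ler_pM2l// yE; nra.
    have {}yn : y < 0 by rewrite lt_neqAle y0.
    have yE : `|y| = - y by rewrite ltr0_norm.
    apply: (@off_diamond 0 y 0) => //=; apply: (lt_le_trans st);
      rewrite ler_pM2l// yE; nra.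
  have kr (k : R) : 1 / 3 <= k <= 2 / 3 -> `|k * y| < r.
    move=> k3; rewrite normrM; apply: le_lt_trans yr; apply: ler_piMl => //.
    by rewrite ger0_norm; slra.
  have [e1|n1] := eqVneq (1 / 3 * y) p.2.
    apply: (y3 (2 / 3)); first by slra.
    apply: vp; first by apply: kr; slra.
    by apply: contra y0 => /eqP e2; apply/eqP; slra.
  by apply: (y3 (1 / 3)); [slra|apply: vp => //; apply: kr; slra].
have [e e0 He] := sakai_local S off0 vert0 acc'.
have [|p [p1 p2] [h h0 Hh]] := int (Num.min e r); first by rewrite lt_min e0.
move: p1 p2; rewrite !lt_min => /andP[p1e _] /andP[_ p2r].
pose k := Num.min h (r - `|p.2|) / 2.
have m0 : 0 < Num.min h (r - `|p.2|) by rewrite lt_min h0 subr_gt0.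
have k0 : 0 < k by rewrite /k; slra.
have kh : k < h.
  by apply: (@lt_le_trans _ _ (Num.min h (r - `|p.2|))); [rewrite /k; slra|rewrite ge_min lexx].
have kr : k < r - `|p.2|.
  by apply: (@lt_le_trans _ _ (Num.min h (r - `|p.2|))); [rewrite /k; slra|rewrite ge_min lexx orbT].
have pk : `|p.2 + k| < r.
  by apply: le_lt_trans (ler_normD _ _) _; rewrite (gtr0_norm k0); slra.
have ne : p.2 != p.2 + k by apply/eqP; slra.
by case: (He _ _ _ p1e p2r pk ne); apply: Hh; rewrite /= ?subrr ?normr0//
  (addrAC p.2) subrr add0r gtr0_norm.
Qed.

End sakai_isolated.

Section gradient_map.
Variable R : realType.

Lemma sakai_map_gradient (V1 V2 A11 A12 A22 : R * R -> R) (O : set (R * R)) (r c M L : R) :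
  0 < r -> 0 < c <= 1 -> 0 <= M -> 0 <= L -> open O ->
  (forall z z', insq r z -> insq r z' ->
    `|V1 z - V1 z'| <= L * (`|z.1 - z'.1| + `|z.2 - z'.2|) /\
    `|V2 z - V2 z'| <= L * (`|z.1 - z'.1| + `|z.2 - z'.2|)) ->
  (forall z, insq r z -> ~ O z -> V1 z = 0 /\ V2 z = 0) ->
  (forall z, insq r z -> O z -> [/\ rder V1 z (A11 z) (A12 z), rder V2 z (A12 z) (A22 z),
    A11 z + A22 z = 1, c <= A22 z & `|A12 z| <= M]) ->
  (forall z, insq r z -> O z -> {for z, continuous A12} /\ {for z, continuous A22}) ->
  sakai_map (fun z => z.1 - V1 z) V2 A22 A12 O r c M (1 + L).
Proof.
move=> r0 c01 M0 L0 oO lip off der cont; split=> //.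
- by slra.
- move=> z z' zr zr'; have [h _] := lip _ _ zr zr'.
  rewrite (_ : _ - _ = (z.1 - z'.1) - (V1 z - V1 z')); last by ring.
  apply: le_trans (ler_normB _ _) _; rewrite mulrDl mul1r.
  by have := normr_ge0 (z.2 - z'.2); slra.
- move=> z z' zr zr'; have [_ h] := lip _ _ zr zr'; apply: le_trans h _.
  by apply: ler_wpM2r; [exact: addr_ge0|slra].
- by move=> z zr /(off _ zr)[-> ->]; rewrite subr0.
- move=> z zr Oz; have [h _ e _ _] := der _ zr Oz.
  have := rderD (rder_lin 1 0 0 z) (rderN h).
  have -> : 1 + - A11 z = A22 z by slra.
  rewrite add0r; congr rder; apply/funext => w.
  by rewrite mul1r mul0r !addr0.
- by move=> z zr Oz; have [_ h _ _ _] := der _ zr Oz.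
- by move=> z zr Oz; have [_ _ _ h _] := der _ zr Oz.
- by move=> z zr Oz; have [_ _ _ _ h] := der _ zr Oz.
- by move=> z zr Oz; have [_ h] := cont _ zr Oz.
- by move=> z zr Oz; have [h _] := cont _ zr Oz.
Qed.

Definition trans (z0 w : R * R) : R * R := (z0.1 + w.1, z0.2 + w.2).
Definition swap (w : R * R) : R * R := (w.2, w.1).

Lemma swapK : involutive swap.
Proof. by case. Qed.

Lemma rder_trans (f : R * R -> R) z0 w p q :
  rder f (trans z0 w) p q -> rder (fun w => f (trans z0 w)) w p q.
Proof.
move=> H e e0; have [d d0 Hd] := H e e0; exists d => // h k hd kd.
by have := Hd h k hd kd; rewrite /trans /= !addrA.
Qed.

Lemma rder_swap (f : R * R -> R) w p q :
  rder f (swap w) p q -> rder (fun w => f (swap w)) w q p.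
Proof.
move=> H e e0; have [d d0 Hd] := H e e0; exists d => // h k hd kd.
by have := Hd k h kd hd; rewrite /swap /= [`|k| + _]addrC [p * k + _]addrC.
Qed.

Lemma plane_continuous_trans (f : R * R -> R) z0 w :
  {for trans z0 w, continuous f} -> {for w, continuous (fun w => f (trans z0 w))}.
Proof.
move=> /plane_continuousP H; apply/plane_continuousP => e e0.
have [d d0 Hd] := H e e0; exists d => // h k hd kd.
by have := Hd h k hd kd; rewrite /trans /= !addrA.
Qed.

Lemma plane_continuous_swap (f : R * R -> R) w :
  {for swap w, continuous f} -> {for w, continuous (fun w => f (swap w))}.
Proof.
move=> /plane_continuousP H; apply/plane_continuousP => e e0.
have [d d0 Hd] := H e e0; exists d => // h k hd kd.
exact: Hd.
Qed.

Lemma trans_continuous z0 : continuous (trans z0).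
Proof.
move=> w; have c1 : {for w, continuous (fun w : R * R => z0.1 + w.1)}.
  by apply: cvgD; [exact: cvg_cst|exact: cvg_fst].
have c2 : {for w, continuous (fun w : R * R => z0.2 + w.2)}.
  by apply: cvgD; [exact: cvg_cst|exact: cvg_snd].
exact: (cvg_pair c1 c2).
Qed.

Lemma swap_continuous : continuous swap.
Proof.
move=> w; have c1 : {for w, continuous (fun w : R * R => w.2)} by exact: cvg_snd.
have c2 : {for w, continuous (fun w : R * R => w.1)} by exact: cvg_fst.
exact: (cvg_pair c1 c2).
Qed.

Lemma rder_min (f : R * R -> R) z p q (d : R) : 0 < d -> rder f z p q ->
  (forall h k, `|h| < d -> `|k| < d -> f z <= f (z.1 + h, z.2 + k)) -> p = 0 /\ q = 0.
Proof.
move=> d0 H mn.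
have key (l : R) : (forall e : R, 0 < e -> exists2 d' : R, 0 < d' &
    forall h : R, `|h| < d' -> - (e * `|h|) <= l * h) -> l = 0.
  move=> K; apply/eqP; rewrite -normr_eq0 eq_le normr_ge0 andbT.
  apply/ler_addgt0Pr => e e0; rewrite add0r; have [d' d'0 Hd] := K e e0.
  have h0 : 0 < d' / 2 by slra.
  have := Hd (d' / 2); have := Hd (- (d' / 2)); rewrite normrN (gtr0_norm h0).
  move=> /(_ ltac:(slra)) A /(_ ltac:(slra)) B.
  by rewrite ler_norml; apply/andP; split; rewrite -(ler_pM2r h0); slra.
split; apply: key => e e0; have [d' d'0 Hd] := H e e0;
  (exists (Num.min d d'); first by rewrite lt_min d0);
  move=> h; rewrite lt_min => /andP[h1 h2]; have n0 (x : R) : 0 < x -> `|0 : R| < x by rewrite normr0.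
  have := Hd h 0 h2 (n0 _ d'0); have := mn h 0 h1 (n0 _ d0).
  by rewrite normr0 mulr0 !addr0 ler_norml; slra.
have := Hd 0 h (n0 _ d'0) h2; have := mn 0 h (n0 _ d0) h1.
by rewrite normr0 mulr0 add0r ler_norml; slra.
Qed.

Lemma second_difference (f fx : R * R -> R) (z : R * R) (p q d : R) : 0 < d ->
  (forall h k : R, `|h| < d -> `|k| < d ->
    is_derive (z.1 + h) 1 (fun t : R => f (t, z.2 + k)) (fx (z.1 + h, z.2 + k))) ->
  rder fx z p q ->
  forall e : R, 0 < e -> exists2 d' : R, 0 < d' & forall h : R, 0 < h < d' ->
    `|f (z.1 + h, z.2 + h) - f (z.1 + h, z.2) - f (z.1, z.2 + h) + f z - q * h ^+ 2| <=
    e * h ^+ 2.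
Proof.
move=> d0 df dfx e e0; have [d1 d10 H1] := dfx (e / 3) ltac:(slra).
exists (Num.min d d1) => [|h]; first by rewrite lt_min d0.
rewrite lt_min => /andP[h0 /andP[hd hd1]].
pose phi (t : R) := f (t, z.2 + h) - f (t, z.2 + 0).
have nh : `|h| < d by rewrite gtr0_norm.
have n0 : `|0 : R| < d by rewrite normr0.
have dphi (x : R) : z.1 <= x <= z.1 + h -> is_derive x 1 phi (fx (x, z.2 + h) - fx (x, z.2 + 0)).
  move=> xh; have xd : `|x - z.1| < d by rewrite ger0_norm; slra.
  have := df (x - z.1) h xd nh; have := df (x - z.1) 0 xd n0.
  rewrite !subrKC => a1 a2; exact: is_deriveB.
have zh : z.1 < z.1 + h by slra.
have [||x xI] := @MVT R phi (fun x : R => fx (x, z.2 + h) - fx (x, z.2 + 0)) _ _ zh.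
- by move=> x; rewrite in_itv/= => xI; apply: dphi; slra.
- apply: derivable_within_continuous => x; rewrite in_itv/= => xI.
  exact: (@ex_derive _ _ _ _ _ _ _ (dphi x xI)).
rewrite in_itv/= in xI => E.
have xd1 : `|x - z.1| < d1 by rewrite ger0_norm; slra.
have hd1' : `|h| < d1 by rewrite gtr0_norm.
have nd1 : `|0 : R| < d1 by rewrite normr0.
have A1 := H1 (x - z.1) h xd1 hd1'; have A2 := H1 (x - z.1) 0 xd1 nd1.
rewrite !subrKC mulr0 addr0 normr0 addr0 in A1 A2.
have fz : f (z.1, z.2) = f z by rewrite -surjective_pairing.
rewrite /phi !addr0 fz in E; rewrite addr0 in A2.
have -> : f (z.1 + h, z.2 + h) - f (z.1 + h, z.2) - f (z.1, z.2 + h) + f z - q * h ^+ 2 =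
   ((fx (x, z.2 + h) - fx z - (p * (x - z.1) + q * h)) -
    (fx (x, z.2) - fx z - p * (x - z.1))) * h.
  have -> : f (z.1 + h, z.2 + h) - f (z.1 + h, z.2) - f (z.1, z.2 + h) + f z =
    f (z.1 + h, z.2 + h) - f (z.1 + h, z.2) - (f (z.1, z.2 + h) - f z) by ring.
  by rewrite E; ring.
rewrite normrM (gtr0_norm h0) expr2 mulrA; apply: ler_wpM2r; first exact: ltW.
apply: le_trans (ler_normB _ _) _.
have xn : `|x - z.1| <= h by rewrite ger0_norm; slra.
rewrite (gtr0_norm h0) in A1.
have : e / 3 * (`|x - z.1| + h) <= e / 3 * (2 * h) by apply: ler_wpM2l; slra.
have : e / 3 * `|x - z.1| <= e / 3 * h by apply: ler_wpM2l; slra.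
slra.
Qed.

Lemma mixed_derivatives (f fx fy : R * R -> R) (z : R * R) (p q p' q' d : R) : 0 < d ->
  (forall h k : R, `|h| < d -> `|k| < d -> rder f (z.1 + h, z.2 + k)
     (fx (z.1 + h, z.2 + k)) (fy (z.1 + h, z.2 + k))) ->
  rder fx z p q -> rder fy z p' q' -> q = p'.
Proof.
move=> d0 df dfx dfy.
have D1 (h k : R) : `|h| < d -> `|k| < d ->
    is_derive (z.1 + h) 1 (fun t : R => f (t, z.2 + k)) (fx (z.1 + h, z.2 + k)).
  move=> hd kd; have a1 : is_derive (z.1 + h) 1 (@id R) 1 by exact: is_derive_id.
  have a2 : is_derive (z.1 + h) 1 (cst (z.2 + k)) 0 by exact: is_derive_cst.
  have := @rder_curve _ f id (cst (z.2 + k)) (z.1 + h) _ _ _ _ (df h k hd kd) a1 a2.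
  by rewrite mulr1 mulr0 addr0.
have D2 (h k : R) : `|h| < d -> `|k| < d -> is_derive ((swap z).1 + h) 1
    (fun t : R => f (swap (t, (swap z).2 + k))) (fy (swap ((swap z).1 + h, (swap z).2 + k))).
  move=> hd kd; have a1 : is_derive (z.2 + h) 1 (@id R) 1 by exact: is_derive_id.
  have a2 : is_derive (z.2 + h) 1 (cst (z.1 + k)) 0 by exact: is_derive_cst.
  have := @rder_curve _ f (cst (z.1 + k)) id (z.2 + h) _ _ _ _ (df k h kd hd) a2 a1.
  by rewrite mulr1 mulr0 add0r.
have dfy' : rder (fun w => fy (swap w)) (swap z) q' p'.
  by apply: rder_swap; rewrite /swap /= -surjective_pairing.
apply/eqP; rewrite -subr_eq0 -normr_eq0 eq_le normr_ge0 andbT.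
apply/ler_addgt0Pr => e e0; rewrite add0r.
have e20 : 0 < e / 2 by slra.
have [d1 d10 H1] := second_difference d0 D1 dfx e20.
have [d2 d20 H2] := @second_difference (fun w => f (swap w)) (fun w => fy (swap w))
  (swap z) q' p' d d0 D2 dfy' _ e20.
have m0 : 0 < Num.min d1 d2 by rewrite lt_min d10.
pose h := Num.min d1 d2 / 2.
have h0 : 0 < h by rewrite /h; slra.
have hd1 : h < d1.
  by apply: (@lt_le_trans _ _ (Num.min d1 d2)); [rewrite /h; slra|rewrite ge_min lexx].
have hd2 : h < d2.
  by apply: (@lt_le_trans _ _ (Num.min d1 d2)); [rewrite /h; slra|rewrite ge_min lexx orbT].
have := H1 h ltac:(slra); have := H2 h ltac:(slra); rewrite /swap /= -surjective_pairing.
have h2 : 0 < h ^+ 2 by exact: exprn_gt0.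
set A := f _; set B := f _; set C := f _; set D := f _ => X2 X1.
rewrite -(ler_pM2r h2) -{1}(gtr0_norm h2) -normrM.
rewrite (_ : (q - p') * h ^+ 2 =
  (A - B - C + D - p' * h ^+ 2) - (A - C - B + D - q * h ^+ 2)); last by ring.
by apply: le_trans (ler_normB _ _) _; slra.
Qed.

End gradient_map.

Section obstacle.
Variable R : realType.
Variable u : R * R -> R.
Let B1 := @B1 R.
Let Om := [set x | 0 < u x] `&` B1.
Hypothesis u_ge0 : forall x, B1 x -> 0 <= u x.
Hypothesis u_C11 : C11_on B1 u.
Hypothesis u_C2 : C2_closure Om u.
Hypothesis u_lap : forall x, Om x -> laplacian u x = 1.
Implicit Types z w p : R * R.

Lemma plane_nbhs (A : set (R * R)) z : nbhs z A -> exists2 d : R, 0 < d &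
  forall w, `|w.1 - z.1| < d -> `|w.2 - z.2| < d -> A w.
Proof.
move=> /nbhs_ballP[d /= d0 dA]; exists d => // w w1 w2; apply: dA.
by split; rewrite /ball/= distrC.
Qed.

Let B1_open : open B1. Proof. exact: edisc_open. Qed.

Let u_rder z : B1 z -> rder u z (d1 u z) (d2 u z).
Proof. by move=> Bz; apply: differentiable_rder; exact: u_C11.1. Qed.

Let Om_open : open Om.
Proof.
rewrite openE => z [uz Bz]; apply: filterI; last exact: open_nbhs_nbhs.
have cu : {for z, continuous u} := rder_continuous (u_rder Bz).
exact: (cvgr_gt (u z) cu).
Qed.

Let off_Om z : B1 z -> ~ Om z -> d1 u z = 0 /\ d2 u z = 0.
Proof.
move=> Bz nz.
have uz : u z = 0.
  apply/eqP; rewrite eq_le u_ge0// andbT leNgt; apply/negP => uz.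
  by apply: nz.
have [d d0 Hd] : exists2 d : R, 0 < d &
    forall w, `|w.1 - z.1| < d -> `|w.2 - z.2| < d -> B1 w.
  by apply: plane_nbhs; exact: open_nbhs_nbhs.
apply: (rder_min d0 (u_rder Bz)) => h k hd kd; rewrite uz; apply: u_ge0; apply: Hd.
  by rewrite /= addrAC subrr add0r.
by rewrite /= addrAC subrr add0r.
Qed.

Let hess1 z : Om z -> rder (d1 u) z (d1 (d1 u) z) (d2 (d1 u) z).
Proof. by move=> Oz; have [_ [h _]] := u_C2.1 _ Oz; exact: differentiable_rder. Qed.

Let hess2 z : Om z -> rder (d2 u) z (d1 (d2 u) z) (d2 (d2 u) z).
Proof. by move=> Oz; have [_ [_ h]] := u_C2.1 _ Oz; exact: differentiable_rder. Qed.

Let hess_sym z : Om z -> d2 (d1 u) z = d1 (d2 u) z.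
Proof.
move=> Oz; have [d d0 Hd] : exists2 d : R, 0 < d &
    forall w, `|w.1 - z.1| < d -> `|w.2 - z.2| < d -> Om w.
  by apply: plane_nbhs; exact: open_nbhs_nbhs.
apply: (@mixed_derivatives _ u (d1 u) (d2 u) z _ _ _ _ d d0 _ (hess1 Oz) (hess2 Oz)).
move=> h k hd kd; apply: u_rder; have [] // := Hd (z.1 + h, z.2 + k).
  by rewrite /= addrAC subrr add0r.
by rewrite /= addrAC subrr add0r.
Qed.

Let ext_eps (g : R * R -> R) z : {within closure Om, continuous g} -> closure Om z ->
  forall e : R, 0 < e -> exists2 d : R, 0 < d & forall w, Om w ->
    `|w.1 - z.1| < d -> `|w.2 - z.2| < d -> `|g w - g z| <= e.
Proof.
move=> /subspace_continuousP cg cz e e0; have /cvgrPdist_le/(_ e e0) := cg _ cz.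
move=> near1; have [d d0 Hd] : exists2 d : R, 0 < d & forall w,
    `|w.1 - z.1| < d -> `|w.2 - z.2| < d -> closure Om w -> `|g z - g w| <= e.
  exact: plane_nbhs near1.
exists d => // w Ow w1 w2; rewrite distrC; apply: Hd => //; exact: subset_closure.
Qed.

Let ext_cont (f g : R * R -> R) z : {within closure Om, continuous g} ->
  (forall x, Om x -> g x = f x) -> Om z -> {for z, continuous f}.
Proof.
move=> cg gf Oz; apply/plane_continuousP => e e0.
have [d d0 Hd] := ext_eps cg (subset_closure Oz) e0.
have [d1 d10 Hd1] : exists2 d : R, 0 < d &
    forall w, `|w.1 - z.1| < d -> `|w.2 - z.2| < d -> Om w.
  by apply: plane_nbhs; exact: open_nbhs_nbhs.
exists (Num.min d d1) => [|h k]; first by rewrite lt_min d0.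
rewrite !lt_min => /andP[h1 h2] /andP[k1 k2].
have e1 : (z.1 + h, z.2 + k).1 - z.1 = h by rewrite /=; ring.
have e2 : (z.1 + h, z.2 + k).2 - z.2 = k by rewrite /=; ring.
have Ow : Om (z.1 + h, z.2 + k) by apply: Hd1; rewrite ?e1 ?e2.
by rewrite -!gf//; apply: Hd => //; rewrite ?e1 ?e2.
Qed.

Let ders := [:: u; d1 u; d2 u; d1 (d1 u); d2 (d1 u); d1 (d2 u); d2 (d2 u)].

Let ext (n : nat) : (n < 7)%N ->
  exists g, {within closure Om, continuous g} /\ forall x, Om x -> g x = nth u ders n x.
Proof. by move=> n7; apply: u_C2.2; exact: mem_nth. Qed.

Let br p := branching_points u p.

Let br_off p : br p -> [/\ B1 p, closure Om p, ~ Om p & density_one Om p].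
Proof.
move=> [[[[cp nip] Bp] dens] _]; split=> // Op; apply: nip.
by rewrite /interior; exact: open_nbhs_nbhs.
Qed.

Let br_int p : br p -> forall e : R, 0 < e -> exists2 q : R * R,
  `|q.1 - p.1| < e /\ `|q.2 - p.2| < e & exists2 h : R, 0 < h &
  forall w, `|w.1 - q.1| < h -> `|w.2 - q.2| < h -> ~ Om w.
Proof.
move=> [_ cl] e e0.
have nb : nbhs p (ball p e) by exact: nbhsx_ballx.
have [q [/plane_nbhs[h h0 Hh] [q1 q2]]] := cl _ nb.
exists q; first by split; rewrite distrC.
exists h => // w w1 w2 [uw _]; have [u0 _] := Hh w w1 w2.
by move: uw; rewrite /= u0 ltxx.
Qed.

Let cone_trans z0 w : density_one Om (trans z0 w) -> cone_free (trans z0 @^-1` Om) w.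
Proof.
move=> dens v rho rho0 H; apply: (density_one_no_cone (v := v) Om_open rho0 _ dens).
move=> t w' t01 w1 w2 Ow'.
apply: (H t (w'.1 - z0.1, w'.2 - z0.2) t01) => /=.
- by move: w1; rewrite /trans /= -!addrA opprD !addrA.
- by move: w2; rewrite /trans /= -!addrA opprD !addrA.
- by rewrite /trans /= !subrKC -surjective_pairing.
Qed.

Let cone_swap (O : set (R * R)) w : cone_free O (swap w) -> cone_free (@swap R @^-1` O) w.
Proof.
move=> H v rho rho0 K; apply: (H (swap v) rho rho0) => t w' t01 w1 w2 Ow'.
apply: (K t (swap w') t01) => //=.
by rewrite /swap /= -surjective_pairing.
Qed.

Let br_isolated z0 : B1 z0 -> exists2 e : R, 0 < e & forall p, br p ->
  `|p.1 - z0.1| < e -> `|p.2 - z0.2| < e -> p = z0.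
Proof.
move=> Bz0; apply: contrapT => noe.
have acc (e : R) : 0 < e -> exists p, [/\ br p, `|p.1 - z0.1| < e, `|p.2 - z0.2| < e & p != z0].
  move=> e0; apply: contrapT => np; apply: noe; exists e => // p bp p1 p2.
  by apply: contrapT => /eqP pz; apply: np; exists p.
have clz : closure Om z0.
  move=> A /plane_nbhs[d d0 Hd]; have [p [bp p1 p2 _]] := acc (d / 2) ltac:(lra).
  have [_ cp _ _] := br_off bp.
  have d20 : 0 < d / 2 by lra.
  have nb : nbhs p (ball p (d / 2)) by exact: nbhsx_ballx.
  have [q [Oq [q1 q2]]] := cp _ nb.
  rewrite /ball/= in q1 q2.
  exists q; split=> //; apply: Hd.
    rewrite (_ : q.1 - z0.1 = (p.1 - z0.1) - (p.1 - q.1)); last by ring.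
    by apply: le_lt_trans (ler_normB _ _) _; lra.
  rewrite (_ : q.2 - z0.2 = (p.2 - z0.2) - (p.2 - q.2)); last by ring.
  by apply: le_lt_trans (ler_normB _ _) _; lra.
have nz : ~ Om z0.
  move=> Oz; have [d d0 Hd] : exists2 d : R, 0 < d &
      forall w, `|w.1 - z0.1| < d -> `|w.2 - z0.2| < d -> Om w.
    by apply: plane_nbhs; exact: open_nbhs_nbhs.
  have [p [bp p1 p2 _]] := acc d d0; have [_ _ np _] := br_off bp.
  by apply: np; exact: Hd.
have [g11 [c11 e11]] : exists g, {within closure Om, continuous g} /\
    forall x, Om x -> g x = d1 (d1 u) x := ext (isT : (3 < 7)%N).
have [g12 [c12 e12]] : exists g, {within closure Om, continuous g} /\
    forall x, Om x -> g x = d1 (d2 u) x := ext (isT : (5 < 7)%N).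
have [g22 [c22 e22]] : exists g, {within closure Om, continuous g} /\
    forall x, Om x -> g x = d2 (d2 u) x := ext (isT : (6 < 7)%N).
have q4 : 0 < (1 / 4 : R) by lra.
have [r1 r10 H11] := ext_eps c11 clz q4.
have [r2 r20 H22] := ext_eps c22 clz q4.
have [r3 r30 H12] := ext_eps c12 clz ltr01.
have [r4 r40 HB] : exists2 d : R, 0 < d &
    forall w, `|w.1 - z0.1| < d -> `|w.2 - z0.2| < d -> B1 w.
  by apply: plane_nbhs; exact: open_nbhs_nbhs.
pose r := Num.min (Num.min r1 r2) (Num.min r3 r4).
have r0 : 0 < r by rewrite /r !lt_min r10 r20 r30.
have rP w : insq r w -> [/\ B1 (trans z0 w) & Om (trans z0 w) ->
    [/\ `|d1 (d1 u) (trans z0 w) - g11 z0| <= 1 / 4,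
        `|d2 (d2 u) (trans z0 w) - g22 z0| <= 1 / 4 &
        `|d1 (d2 u) (trans z0 w)| <= `|g12 z0| + 1]].
  have s1 : (trans z0 w).1 - z0.1 = w.1 by rewrite /trans /=; ring.
  have s2 : (trans z0 w).2 - z0.2 = w.2 by rewrite /trans /=; ring.
  move=> []; rewrite /r !lt_min => /andP[/andP[a1 a2] /andP[a3 a4]].
  move=> /andP[/andP[b1 b2] /andP[b3 b4]]; split; first by apply: HB; rewrite ?s1 ?s2.
  move=> Ow; split.
  - by rewrite -e11//; apply: H11; rewrite ?s1 ?s2.
  - by rewrite -e22//; apply: H22; rewrite ?s1 ?s2.
  - rewrite -e12//; have := H12 _ Ow; rewrite s1 s2 => /(_ a3 b3).
    have := ler_normD (g12 (trans z0 w) - g12 z0) (g12 z0); rewrite subrK; lra.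
clearbody r.
have [L0 HL0] := u_C11.2.
pose L := `|L0|; have L_ge0 : 0 <= L by exact: normr_ge0.
have lip z z' : B1 z -> B1 z' ->
    `|d1 u z - d1 u z'| <= L * (`|z.1 - z'.1| + `|z.2 - z'.2|) /\
    `|d2 u z - d2 u z'| <= L * (`|z.1 - z'.1| + `|z.2 - z'.2|).
  move=> Bz Bz'; have H := HL0 _ _ Bz Bz'.
  have H2 : L0 * Defs.edist z z' <= L * (`|z.1 - z'.1| + `|z.2 - z'.2|).
    apply: (@le_trans _ _ (L * Defs.edist z z')).
      by apply: ler_wpM2r; [exact: sqrtr_ge0|exact: ler_norm].
    by apply: ler_wpM2l => //; exact: edist_le.
  have [G1 G2] := edist_ge (d1 u z, d2 u z) (d1 u z', d2 u z').
  by split; apply: le_trans H2; apply: le_trans H.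
have M0 : 0 <= `|g12 z0| + 1 by have := normr_ge0 (g12 z0); lra.
have c01 : 0 < (1 / 4 : R) <= 1 by lra.
have tr : g11 z0 + g22 z0 = 1.
  apply/eqP; rewrite -subr_eq0 -normr_eq0 eq_le normr_ge0 andbT.
  apply/ler_addgt0Pr => e e0; rewrite add0r; have e20 : 0 < e / 2 by lra.
  have [s1 s10 K1] := ext_eps c11 clz e20; have [s2 s20 K2] := ext_eps c22 clz e20.
  have m0 : 0 < Num.min s1 s2 by rewrite lt_min s10.
  have nb : nbhs z0 (ball z0 (Num.min s1 s2)) by exact: nbhsx_ballx.
  have [w [Ow []]] := clz _ nb.
  rewrite /ball/= !lt_min distrC => /andP[a1 a2]; rewrite distrC => /andP[b1 b2].
  have := K1 w Ow a1 b1; have := K2 w Ow a2 b2; have := u_lap Ow.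
  rewrite /laplacian -e11// -e22// => lw h2 h1.
  rewrite (_ : g11 z0 + g22 z0 - 1 = - (g11 w - g11 z0) - (g22 w - g22 z0)); last by lra.
  by apply: le_trans (ler_normB _ _) _; rewrite normrN; lra.
have oT : open (trans z0 @^-1` Om).
  by apply: open_comp => // z _; exact: trans_continuous.
have accT (e : R) : 0 < e -> exists w, [/\ insq e w, w != (0, 0), ~ Om (trans z0 w) &
    cone_free (trans z0 @^-1` Om) w].
  move=> e0; have [p [bp p1 p2 pz]] := acc e e0; have [_ _ np dp] := br_off bp.
  have tE : trans z0 (p.1 - z0.1, p.2 - z0.2) = p.
    by rewrite /trans /= !subrKC -surjective_pairing.
  exists (p.1 - z0.1, p.2 - z0.2); split=> //.
  - by apply: contra pz => /eqP E; rewrite -tE E /trans /= !addr0 -surjective_pairing.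
  - by rewrite tE.
  - by apply: cone_trans; rewrite tE.
have intT (e : R) : 0 < e -> exists2 w, insq e w & exists2 h : R, 0 < h &
    forall w', `|w'.1 - w.1| < h -> `|w'.2 - w.2| < h -> ~ Om (trans z0 w').
  move=> e0; have e20 : 0 < e / 2 by lra.
  have [p [bp p1 p2 _]] := acc _ e20.
  have [q [q1 q2] [h h0 Hh]] := br_int bp e20.
  exists (q.1 - z0.1, q.2 - z0.2).
    split=> /=.
      rewrite (_ : q.1 - z0.1 = (q.1 - p.1) + (p.1 - z0.1)); last by ring.
      by apply: le_lt_trans (ler_normD _ _) _; lra.
    rewrite (_ : q.2 - z0.2 = (q.2 - p.2) + (p.2 - z0.2)); last by ring.
    by apply: le_lt_trans (ler_normD _ _) _; lra.
  exists h => // w' /= w1 w2; apply: Hh; rewrite /trans /=.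
    by rewrite (_ : _ - _ = w'.1 - (q.1 - z0.1)); last by ring.
  by rewrite (_ : _ - _ = w'.2 - (q.2 - z0.2)); last by ring.
have n0 : ~ Om (trans z0 (0, 0)) by rewrite /trans /= !addr0 -surjective_pairing.
have dT z z' : (trans z0 z).1 - (trans z0 z').1 = z.1 - z'.1 /\
    (trans z0 z).2 - (trans z0 z').2 = z.2 - z'.2 by rewrite /trans /=; split; ring.
have [g2|g2] := leP (1 / 2) (g22 z0).
  pose O := trans z0 @^-1` Om.
  have S : sakai_map (fun z => z.1 - d1 u (trans z0 z)) (fun z => d2 u (trans z0 z))
     (fun z => d2 (d2 u) (trans z0 z)) (fun z => d1 (d2 u) (trans z0 z)) O r (1 / 4)
     (`|g12 z0| + 1) (1 + L).
    apply: (@sakai_map_gradient _ _ _ (fun z => d1 (d1 u) (trans z0 z))) => //.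
    - move=> z z' /rP[Bz _] /rP[Bz' _]; have := lip _ _ Bz Bz'.
      by have [-> ->] := dT z z'.
    - by move=> z /rP[Bz _] nO; exact: off_Om.
    - move=> z /rP[Bz HO] Oz; have [h1 h2 h3] := HO Oz; split=> //.
      + by have := hess1 Oz; rewrite (hess_sym Oz) => /rder_trans.
      + exact/rder_trans/hess2.
      + exact: u_lap Oz.
      + by move: h2; rewrite ler_norml; lra.
    - move=> z _ Oz; split; apply: (plane_continuous_trans (f := _)).
        exact: ext_cont c12 e12 Oz.
      exact: ext_cont c22 e22 Oz.
  exact: (sakai_isolated S n0 accT intT).
have g1 : 1 / 2 <= g11 z0 by lra.
pose O := @swap R @^-1` (trans z0 @^-1` Om).
have swr z : insq r z -> insq r (swap z) by case.
have S : sakai_map (fun z => z.1 - d2 u (trans z0 (swap z))) (fun z => d1 u (trans z0 (swap z)))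
   (fun z => d1 (d1 u) (trans z0 (swap z))) (fun z => d1 (d2 u) (trans z0 (swap z))) O r (1 / 4)
   (`|g12 z0| + 1) (1 + L).
  apply: (@sakai_map_gradient _ _ _ (fun z => d2 (d2 u) (trans z0 (swap z)))) => //.
  - by apply: open_comp => // z _; exact: swap_continuous.
  - move=> z z' /swr/rP[Bz _] /swr/rP[Bz' _]; have [l1 l2] := lip _ _ Bz Bz'.
    have [t1 t2] := dT (swap z) (swap z').
    rewrite t1 t2 /= [`|z.2 - z'.2| + _]addrC in l1 l2; exact: conj l2 l1.
  - by move=> z /swr/rP[Bz _] nO; have [] := off_Om Bz nO.
  - move=> z /swr/rP[Bz HO] Oz; have [h1 h2 h3] := HO Oz; split=> //.
    + exact/(@rder_swap _ (fun w => d2 u (trans z0 w)))/rder_trans/hess2.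
    + have := hess1 Oz; rewrite (hess_sym Oz) => /rder_trans.
      exact: (@rder_swap _ (fun w => d1 u (trans z0 w))).
    + by rewrite addrC; exact: u_lap Oz.
    + by move: h1; rewrite ler_norml; lra.
  - move=> z _ Oz; split.
      apply: (@plane_continuous_swap _ (fun w => d1 (d2 u) (trans z0 w))).
      by apply: plane_continuous_trans; exact: ext_cont c12 e12 Oz.
    apply: (@plane_continuous_swap _ (fun w => d1 (d1 u) (trans z0 w))).
    by apply: plane_continuous_trans; exact: ext_cont c11 e11 Oz.
apply: (sakai_isolated S) => //.
- move=> e /accT[w [[w1 w2] w0 nw cw]]; exists (swap w); split=> //.
  + by apply: contra w0 => /eqP[e2 e1]; rewrite (surjective_pairing w) e1 e2.
  + by apply: cone_swap; rewrite swapK.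
- move=> e /intT[w [w1 w2] [h h0 Hh]]; exists (swap w) => //.
  by exists h => // w' a1 a2; exact: Hh.
Qed.

Lemma branching_points_locally_finite (K : set (R * R)) :
  compact K -> K `<=` B1 -> finite_set (K `&` br).
Proof.
move=> cK KB; apply: contrapT => infE; set E := K `&` br in infE.
pose F : set_system (R * R) := [set A | finite_set (E `\` A)].
have FF : ProperFilter F.
  apply: Build_ProperFilter; first by rewrite /F /= setD0.
  split=> [|A B FA FB|A B AB FA].
  - by rewrite /F /= setDT.
  - by rewrite /F /= setDIr finite_setU.
  - by apply: sub_finite_set FA => z [Ez nB]; split=> // /AB.
have FK : F K by rewrite /F /= (_ : E `\` K = set0)// -subset0 => z [[]].
have [z [Kz clz]] := cK F FF FK.
have [e e0 He] := br_isolated (KB _ Kz).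
have FE : F (E `\` [set z]).
  by apply: (@sub_finite_set _ _ [set z]) => // w [Ew nw]; apply: contrapT => wz; apply: nw.
have nb : nbhs z (ball z e) by exact: nbhsx_ballx.
have [p [[[Kp bp] pz] [p1 p2]]] := clz _ _ FE nb.
by apply: pz; apply: He => //; rewrite distrC.
Qed.

End obstacle.

Theorem theorem1p3 (R : realType) (u : R * R -> R) :
  (forall x, (@B1 R) x -> 0 <= u x) ->
  C11_on ((@B1 R)) u ->
  C2_closure ([set x | 0 < u x] `&` (@B1 R)) u ->
  (forall x, ([set x | 0 < u x] `&` (@B1 R)) x -> laplacian u x = 1) ->
  (forall x, (boundary ([set x | 0 < u x] `&` (@B1 R)) `&` (@B1 R)) x ->
     u x = 0 /\ gradnorm u x = 0) ->
  forall K : set (R * R), compact K -> K `<=` (@B1 R) ->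
    finite_set (K `&` branching_points u).
Proof. by move=> u0 uC11 uC2 ulap _ K; exact: branching_points_locally_finite. Qed.
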